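(* Let $\mathcal{T}_1, \dots, \mathcal{T}_m$ be pairing structures with index set $[n] = \{1,\dots,n\}$, ordered so that $|S(\mathcal{T}_1)| \ge \dots \ge |S(\mathcal{T}_m)|$. Let $\sigma_m$ be the smallest singular value of the correlation matrix of $X_{\mathcal{T}_1}, \dots, X_{\mathcal{T}_m}$. Let $\delta, \varepsilon > 0$ and let $f$ be the output of the randomized algorithm Estimator (specified explicitly in the context) with arguments $\mathcal{T}_1, \dots, \mathcal{T}_m, \delta, \varepsilon$, regarded as an estimator of $Y = \mathrm{haf}(\Sigma)$. Then Estimator is $(\delta, \varepsilon, \{1, X_{\mathcal{T}_1}, \dots, X_{\mathcal{T}_m}, f\})$-multiaccurate over $\mathcal{D}_n$, and the expected runtime of Estimator is polynomial in $1/\delta$, $1/\varepsilon$, $1/\sigma_m$, and the sum of the representation sizes of $\mathcal{T}_1, \dots, \mathcal{T}_m$.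
   Context: Pairings. A pairing of a finite set $K$ is a set of $|K|/2$ unordered pairs of elements of $K$ such that each element of $K$ appears in exactly one pair. $\mathcal{P}_2(K)$ denotes the set of all pairings of $K$ (empty if $|K|$ is odd), and $\mathcal{P}_2(n) := \mathcal{P}_2([n])$. Throughout, $n$ is positive and even. The distribution $\mathcal{D}_n$. Let $\Sigma$ be a random symmetric $n \times n$ matrix whose off-diagonal entries $\Sigma_{i,j} = \Sigma_{j,i}$, $i<j$, are independent standard normal $\mathcal{N}(0,1)$ random variables (the diagonal entries are chosen large enough that $\Sigma$ is positive semidefinite; they play no role). $\mathcal{D}_n$ is the induced distribution of the expression $Y = \mathrm{haf}(\Sigma) := \sum_{p \in \mathcal{P}_2(n)} \prod_{\{i,j\} \in p} \Sigma_{i,j}$, and $\mathbb{E}_{\mathcal{D}_n}$ denotes expectation over the random $\Sigma$; predictors and estimators are real-valued functions of $\Sigma$. Estimators $X_S$. For a pairing $p$ of a set $K \subseteq [n]$, let $X_p := \prod_{\{i,j\} \in p} \Sigma_{i,j}$. For a set of pairings $S \subseteq \mathcal{P}_2(K)$, let $X_S := \sum_{p \in S} X_p$. Pairing structures. A pairing structure $\mathcal{T}$ over an index set $K$ is a structured (formal-expression) representation of a subset $S(\mathcal{T}) \subseteq \mathcal{P}_2(K)$, defined recursively as any one of the following: (i) Base: if $K = \{i,j\}$ has size $2$, then $\mathcal{T}_K$ is a base pairing structure over $K$, with $S(\mathcal{T}_K) := \mathcal{P}_2(K)$ (a single pairing). (ii) Union: if $\mathcal{T}_1$ and $\mathcal{T}_2$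 are pairing structures over the same index set $K$ such that $S(\mathcal{T}_1)$ and $S(\mathcal{T}_2)$ are disjoint sets, then $\mathcal{T}_1 \cup \mathcal{T}_2$ is a pairing structure over $K$, with $S(\mathcal{T}_1 \cup \mathcal{T}_2) := S(\mathcal{T}_1) \cup S(\mathcal{T}_2)$. (iii) Product: if $\mathcal{T}_1$ and $\mathcal{T}_2$ are pairing structures over disjoint index sets $K_1$ and $K_2$, then $\mathcal{T}_1 \otimes \mathcal{T}_2$ is a pairing structure over $K_1 \cup K_2$, with $S(\mathcal{T}_1 \otimes \mathcal{T}_2) := \{p_1 \cup p_2 : p_1 \in S(\mathcal{T}_1), p_2 \in S(\mathcal{T}_2)\}$. The representation size of a pairing structure is $1$ for a base structure, and the sum of the representation sizes of $\mathcal{T}_1$ and $\mathcal{T}_2$ plus $1$ for $\mathcal{T}_1 \cup \mathcal{T}_2$ and for $\mathcal{T}_1 \otimes \mathcal{T}_2$. Write $X_{\mathcal{T}} := X_{S(\mathcal{T})}$. Correlation. The correlation of random variables $Z_1, Z_2$ is $\mathrm{Cov}(Z_1,Z_2)/\sqrt{\mathrm{Var}(Z_1)\mathrm{Var}(Z_2)}$, and the correlation matrix of $Z_1, \dots, Z_m$ is the $m \times m$ matrix of correlations of all pairs. Here correlations are over $\mathcal{D}_n$. Approximate accuracy. For $\varepsilon \ge 0$, an estimator $f$ is $(\varepsilon, X)$-accurate over $\mathcal{D}_n$ with respect to a predictor $X$ if $$\left(\mathbb{E}_{\mathcal{D}_n}[(Y - f)X]\right)^2 \le \varepsilon^2\,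 \mathbb{E}_{\mathcal{D}_n}[X^2]\, \mathbb{E}_{\mathcal{D}_n}[f^2].$$ A randomized algorithm $A$ that outputs an estimator $f$ is $(\delta, \varepsilon, S)$-multiaccurate over $\mathcal{D}_n$, for a set $S$ of predictors (which may depend on the randomness of $A$; e.g. $S$ may contain $f$ itself), if with probability at least $1 - \delta$ over the randomness of $A$, the output $f$ is $(\varepsilon, X)$-accurate over $\mathcal{D}_n$ for all $X \in S$. Here $1$ denotes the constant predictor. Helper routines of the algorithm, all recursive on the structure. NumPairings$(\mathcal{T})$ returns $|S(\mathcal{T})|$: it is $1$ for a base structure, the product of the two recursive values for a product, and their sum for a union. Sample$(\mathcal{T})$ returns a uniformly random element of $S(\mathcal{T})$: for a base structure it returns the unique pairing; for $\mathcal{T}_1 \otimes \mathcal{T}_2$ it returns Sample$(\mathcal{T}_1) \,\cup\,$ Sample$(\mathcal{T}_2)$; for $\mathcal{T}_1 \cup \mathcal{T}_2$ it returns Sample$(\mathcal{T}_1)$ with probability NumPairings$(\mathcal{T}_1)/$NumPairings$(\mathcal{T})$ and Sample$(\mathcal{T}_2)$ otherwise. Contains$(\mathcal{T}, p)$, for $p$ a pairing of the index set of $\mathcal{T}$, decides whether $p \in S(\mathcal{T})$: for a base structure it returns True; for $\mathcal{T}_1 \otimes \mathcal{T}_2$ with index sets $K_1, K_2$ it returns False if some pair of $p$ has exactly one element in $K_1$, and otherwise, letting $p_1$ be the set of pairs of $p$ contained in $K_1$, returns Contains$(\mathcal{T}_1, p_1)$ and Contains$(\mathcal{T}_2, p \setminus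 p_1)$; for $\mathcal{T}_1 \cup \mathcal{T}_2$ it returns Contains$(\mathcal{T}_1, p)$ or Contains$(\mathcal{T}_2, p)$. The algorithm Estimator$(\mathcal{T}_1, \dots, \mathcal{T}_m, \delta, \varepsilon)$. 1. Let $D$ be the $m \times m$ diagonal matrix with entries $D_{i,i} = \sqrt{\text{NumPairings}(\mathcal{T}_i)} = \sqrt{|S(\mathcal{T}_i)|}$, let $M$ be the $m \times m$ zero matrix, and let $s := 0$ (number of samples taken). 2. Repeat the following. Increase $s$ by $1$. For each $i = 1, \dots, m$: increase $M_{i,i}$ by $1$; and for each $j = i+1, \dots, m$, draw a fresh sample $p = $ Sample$(\mathcal{T}_j)$ and, if Contains$(\mathcal{T}_i, p)$ is True, increase $M_{i,j}$ and $M_{j,i}$ by $1$. Then let $\hat{C}$ (the estimated correlation matrix) be the symmetric $m \times m$ matrix with entries $\hat{C}_{i,j} = \hat{C}_{j,i} := \frac{M_{i,j}}{s} \cdot \frac{\sqrt{|S(\mathcal{T}_j)|}}{\sqrt{|S(\mathcal{T}_i)|}}$ for $i \le j$, and let $\hat{\sigma}_m$ be the least singular value of $\hat{C}$. Continue looping as long as $\hat{\sigma}_m \le 0$ or $s < \frac{80 m^2 (m^2 + 3 \ln(2/\delta))}{\varepsilon^2 \hat{\sigma}_m^4}$; otherwise stop. 3. Let $\boldsymbol{\beta} := D^{-1} \hat{C}^{-1} \mathbf{d}$, where $\mathbf{d} = (\sqrt{|S(\mathcal{T}_1)|}, \dots, \sqrt{|S(\mathcal{T}_m)|})$ is the vector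 of diagonal entries of $D$. Return the function $\mathbf{x} \mapsto \boldsymbol{\beta}^\top \mathbf{x}$, i.e. the estimator $f = \sum_{i=1}^m \beta_i X_{\mathcal{T}_i}$.
   Formalization: Accuracy is claimed only for ε ≤ 1, since it fails for large ε (e.g. some n=24, m=6, ε=10^4, δ=10^-5); the runtime bound is for all ε > 0. If σ_m = 0, where Estimator may never stop, the claim is that an inaccurate f is output with probability at most δ. *)

(* Defs.v *)
From HB Require Import structures.
From mathcomp Require Import all_boot all_order all_algebra.
From mathcomp Require Import all_classical all_reals all_analysis.
(* Required but not imported: its notations clash with those of analysis. *)
From mathcomp Require mpoly.
Set Implicit Arguments.
Unset Strict Implicit.
Unset Printing Implicit Defensive.
Import Order.TTheory GRing.Theory Num.Theory.

Local Open Scope ring_scope.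

Definition pairing (n : nat) : Type := {set {set 'I_n}}.

Definition pairings n (K : {set 'I_n}) : {set {set {set 'I_n}}} :=
  [set p : {set {set 'I_n}} |
     finset.partition p K && [forall e in p, #|e : {set 'I_n}| == 2%N]]%SET.

(* Raw expressions; the side conditions of the recursive definition of pairing
   structures are collected in ps_wf. *)
Inductive pstruct (n : nat) : Type :=
| PBase of 'I_n & 'I_n
| PUnion of pstruct n & pstruct n
| PProd of pstruct n & pstruct n.

Fixpoint ps_index n (t : pstruct n) : {set 'I_n} :=
  match t with
  | PBase i j => [set i; j]%SET
  | PUnion t1 t2 => ps_index t1
  | PProd t1 t2 => ps_index t1 :|: ps_index t2
  end.

Fixpoint ps_set n (t : pstruct n) : {set {set {set 'I_n}}} :=
  match t with
  | PBase i j => pairings [set i; j]%SET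
  | PUnion t1 t2 => ps_set t1 :|: ps_set t2
  | PProd t1 t2 => [set p1 :|: p2 | p1 in ps_set t1, p2 in ps_set t2]%SET
  end.

Fixpoint ps_wf n (t : pstruct n) : bool :=
  match t with
  | PBase i j => i != j
  | PUnion t1 t2 => [&& ps_wf t1, ps_wf t2, ps_index t1 == ps_index t2
                      & [disjoint ps_set t1 & ps_set t2]]
  | PProd t1 t2 => [&& ps_wf t1, ps_wf t2
                     & [disjoint ps_index t1 & ps_index t2]]
  end.

Fixpoint ps_size n (t : pstruct n) : nat :=
  match t with
  | PBase _ _ => 1
  | PUnion t1 t2 | PProd t1 t2 => (ps_size t1 + ps_size t2).+1
  end.

Definition mxfun (R : realType) (n : nat) : Type := 'M[R]_n -> R.

(* Each pair {i, j} of p is read once, as the entry A i j with i < j. *)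
Definition X_pairing (R : realType) n (p : {set {set 'I_n}}) : mxfun R n :=
  fun A => \prod_(ij : 'I_n * 'I_n |
                    (ij.1 < ij.2)%N && ([set ij.1; ij.2]%SET \in p)) A ij.1 ij.2.

Definition X_set (R : realType) n (S : {set {set {set 'I_n}}}) : mxfun R n :=
  fun A => \sum_(p in S) X_pairing p A.

Definition X_ps (R : realType) n (t : pstruct n) : mxfun R n :=
  X_set (ps_set t).

Definition haf (R : realType) n : mxfun R n := X_set (pairings [set: 'I_n]%SET).

Local Open Scope classical_set_scope.

(* The singular values of A are the square roots of the eigenvalues of A^T A;
   for m > 0 the infimum below ranges over a finite nonempty set. *)
Definition least_singular_value (R : realType) m (A : 'M[R]_m) : R :=
  inf [set s : R | 0 <= s /\ eigenvalue (A^T *m A) (s ^+ 2)].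

Definition mutually_independent (R : realType) (d : measure_display)
    (Omega : measurableType d) (P : probability Omega R)
    (I : finType) (X : I -> {RV P >-> R}) : Prop :=
  forall (J : {set I}) (B : I -> set R), (forall i, measurable (B i)) ->
    P (\bigcap_(i in [set` J]) (X i @^-1` B i)) =
    (\prod_(i in J) P (X i @^-1` B i))%E.

(* The entries above the diagonal are i.i.d. standard normal; the diagonal is
   left arbitrary, since no pairing uses it. *)
Definition symmetric_gaussian (R : realType) (d : measure_display)
    (Omega : measurableType d) (P : probability Omega R) n
    (Sigma : 'I_n -> 'I_n -> {RV P >-> R}) : Prop :=
  [/\ forall i j, Sigma i j = Sigma j i,
      forall i j : 'I_n, (i < j)%N -> forall B : set R, measurable B ->
        distribution P (Sigma i j) B = normal_prob 0 1 B
    & mutually_independent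
        (fun ij : {ij : 'I_n * 'I_n | (ij.1 < ij.2)%N} =>
           Sigma (val ij).1 (val ij).2)].

Section OverDn.
Context (R : realType) (d : measure_display) (Omega : measurableType d).
Context (P : probability Omega R) (n : nat).
Variable Sigma : 'I_n -> 'I_n -> {RV P >-> R}.

Definition at_Sigma (X : mxfun R n) : Omega -> R :=
  fun w => X (\matrix_(i, j) Sigma i j w).

Definition correlation (Z1 Z2 : Omega -> R) : R :=
  fine (covariance P Z1 Z2) /
  Num.sqrt (fine (variance P Z1) * fine (variance P Z2)).

Definition correlation_mx m (Z : 'I_m -> Omega -> R) : 'M[R]_m :=
  \matrix_(i, j) correlation (Z i) (Z j).

(* f is read as an estimator of Y = haf(Sigma). *)
Definition accurate (eps : R) (X f : mxfun R n) : Prop :=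
  ('E_P[at_Sigma (fun A => ((haf A - f A) * X A)%R)] ^+ 2 <=
   (eps ^+ 2)%:E * 'E_P[at_Sigma (fun A => (X A ^+ 2)%R)]
                 * 'E_P[at_Sigma (fun A => (f A ^+ 2)%R)])%E.

End OverDn.

(* Tick c p spends c time units and continues as p; Flip q k draws a fresh
   coin, which is true with probability q. *)
Inductive prog (R A : Type) : Type :=
| Ret of A
| Tick of nat & prog R A
| Flip of R & (bool -> prog R A).
Arguments Ret {R A} a.
Arguments Tick {R A} c p.
Arguments Flip {R A} q k.

Fixpoint bind (R A B : Type) (p : prog R A) (f : A -> prog R B) : prog R B :=
  match p with
  | Ret a => f a
  | Tick c p' => Tick c (bind p' f)
  | Flip q k => Flip q (fun b => bind (k b) f)
  end.

Notation "'letp' x ':=' p 'in' q" := (bind p (fun x => q))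
  (at level 200, x name, p at level 200, q at level 200, right associativity).

Fixpoint mapP (R A B : Type) (f : A -> prog R B) (s : seq A) : prog R (seq B) :=
  if s is a :: s' then
    letp b := f a in letp bs := mapP f s' in Ret (b :: bs)
  else Ret [::].

Fixpoint foldP (R A B : Type) (f : B -> A -> prog R B) (b : B) (s : seq A) :
    prog R B :=
  if s is a :: s' then letp b' := f b a in foldP f b' s' else Ret b.

(* Iterate the body until it exits with inr; None after k rounds without exit. *)
Fixpoint repeatP (R A B : Type) (body : A -> prog R (A + B)) (k : nat) (a : A) :
    prog R (option B) :=
  if k is k'.+1 then
    letp r := body a in
    match r with inl a' => repeatP body k' a' | inr b => Ret (Some b) end
  else Ret None.

Section Semantics.
Context (R : realType).

Fixpoint expect A (p : prog R A) (g : A -> R) : R :=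
  match p with
  | Ret a => g a
  | Tick _ p' => expect p' g
  | Flip q k => q * expect (k true) g + (1 - q) * expect (k false) g
  end.

Definition prob A (p : prog R A) (E : set A) : R := expect p \1_E.

Fixpoint expected_cost A (p : prog R A) : R :=
  match p with
  | Ret _ => 0
  | Tick c p' => c%:R + expected_cost p'
  | Flip q k => q * expected_cost (k true) + (1 - q) * expected_cost (k false)
  end.

(* A randomized algorithm with an unbounded loop is given by its truncations:
   p k is the run cut off after k rounds of the loop, with result None when it
   has not stopped by then. *)
Definition rand_alg (A : Type) : Type := nat -> prog R (option A).

(* Probability that the algorithm stops with an output in E: the supremum (and
   limit) of the probabilities that it does so within k rounds. *)
Definition output_prob A (p : rand_alg A) (E : set A) : \bar R :=
  ereal_sup [set (prob (p k) [set o | exists2 a, o = Some a & E a])%:E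
            | k in [set: nat]].

(* Expected running time of the untruncated run, by monotone convergence. *)
Definition expected_runtime A (p : rand_alg A) : \bar R :=
  ereal_sup [set (expected_cost (p k))%:E | k in [set: nat]].

End Semantics.

(* S maps the output f to the set of predictors, which may depend on f. *)
Definition all_accurate (R : realType) (d : measure_display)
    (Omega : measurableType d) (P : probability Omega R) n
    (Sigma : 'I_n -> 'I_n -> {RV P >-> R}) (eps : R)
    (S : mxfun R n -> set (mxfun R n)) : set (mxfun R n) :=
  [set f | forall X, S f X -> accurate Sigma eps X f].

(* A run that never stops counts as a failure here. *)
Definition multiaccurate (R : realType) (d : measure_display)
    (Omega : measurableType d) (P : probability Omega R) n
    (Sigma : 'I_n -> 'I_n -> {RV P >-> R}) (delta eps : R)
    (S : mxfun R n -> set (mxfun R n)) (A : rand_alg R (mxfun R n)) : Prop :=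
  ((1 - delta)%:E <= output_prob A (all_accurate Sigma eps S))%E.

(* Cost model of the programs below: unit cost for an operation on real numbers
   (including square roots and comparisons) and for visiting a node of an
   expression; bit-length cost for exact arithmetic on the possibly huge
   integers |S(T)| and for a coin whose bias is a quotient of such integers; the
   cost of a naive list implementation for operations on finite sets; m ^ 3 for
   the singular values or the inverse of an m x m matrix. *)

Definition bitlen (a : nat) : nat := (trunc_log 2 a).+1.

Section Algorithm.
Context (R : realType) (n : nat).

Fixpoint index_set (t : pstruct n) : prog R {set 'I_n} :=
  match t with
  | PBase i j => Tick 2 (Ret [set i; j]%SET)
  | PUnion t1 t2 => Tick 1 (index_set t1)
  | PProd t1 t2 =>
      letp K1 := index_set t1 in
      letp K2 := index_set t2 in
      Tick (#|K1| + #|K2|).+1 (Ret (K1 :|: K2))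
  end.

Fixpoint NumPairings (t : pstruct n) : prog R nat :=
  match t with
  | PBase _ _ => Tick 1 (Ret 1%N)
  | PUnion t1 t2 =>
      letp a := NumPairings t1 in
      letp b := NumPairings t2 in
      Tick (bitlen a + bitlen b).+1 (Ret (a + b)%N)
  | PProd t1 t2 =>
      letp a := NumPairings t1 in
      letp b := NumPairings t2 in
      Tick (bitlen a * bitlen b).+1 (Ret (a * b)%N)
  end.

Fixpoint Sample (t : pstruct n) : prog R (pairing n) :=
  match t with
  | PBase i j => Tick 1 (Ret [set [set i; j]]%SET)
  | PProd t1 t2 =>
      letp p1 := Sample t1 in
      letp p2 := Sample t2 in
      Tick (#|p1| + #|p2|).+1 (Ret (p1 :|: p2))
  | PUnion t1 t2 =>
      letp a := NumPairings t1 in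
      letp b := NumPairings t in
      Tick (bitlen a + bitlen b).+1
        (Flip (a%:R / b%:R) (fun c => if c then Sample t1 else Sample t2))
  end.

Fixpoint Contains (t : pstruct n) (p : pairing n) : prog R bool :=
  match t with
  | PBase _ _ => Tick 1 (Ret true)
  | PProd t1 t2 =>
      letp K1 := index_set t1 in
      Tick (2 * (#|p| * #|K1|)).+1
        (if [exists e in p, #|e :&: K1| == 1%N] then Ret false
         else
           let p1 := [set e in p | e \subset K1]%SET in
           letp b1 := Contains t1 p1 in
           letp b2 := Contains t2 (p :\: p1) in
           Ret (b1 && b2))
  | PUnion t1 t2 =>
      Tick 1
        (letp b1 := Contains t1 p in
         letp b2 := Contains t2 p in
         Ret (b1 || b2))
  end.

Variables (m : nat) (Ts : 'I_m -> pstruct n) (delta eps : R).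

Definition sample_round (M : 'M[R]_m) : prog R 'M[R]_m :=
  foldP (fun M (i : 'I_m) =>
    Tick 1
      (foldP (fun M (j : 'I_m) =>
         letp p := Sample (Ts j) in
         letp b := Contains (Ts i) p in
         Tick 1 (Ret (if b then M + delta_mx i j + delta_mx j i else M)))
       (M + delta_mx i i) [seq j : 'I_m <- enum 'I_m | (i < j)%N]))
  M (enum 'I_m).

(* dS is the row of the sqrt |S(T_i)|. *)
Definition Chat (dS : 'rV[R]_m) (s : nat) (M : 'M[R]_m) : 'M[R]_m :=
  \matrix_(i, j)
    if (i <= j)%N then M i j / s%:R * (dS 0 j / dS 0 i)
    else M j i / s%:R * (dS 0 i / dS 0 j).

Definition continue (s : nat) (sv : R) : bool :=
  (sv <= 0) ||
  (s%:R < 80 * m%:R ^+ 2 * (m%:R ^+ 2 + 3 * ln (2 / delta))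
          / (eps ^+ 2 * sv ^+ 4)).

Definition round (dS : 'rV[R]_m) (st : nat * 'M[R]_m) :
    prog R ((nat * 'M[R]_m) + 'M[R]_m) :=
  let s := st.1.+1 in
  letp M := sample_round st.2 in
  let C := Chat dS s M in
  Tick (m ^ 2 + m ^ 3).+2
    (Ret (if continue s (least_singular_value C) then inl (s, M) else inr C)).

Definition Estimator : rand_alg R (mxfun R n) := fun k =>
  letp N := mapP NumPairings [seq Ts i | i <- enum 'I_m] in
  let dS : 'rV[R]_m := \row_i Num.sqrt (nth 0%N N i)%:R in
  Tick (m + m ^ 2)
    (letp r := repeatP (round dS) k (0%N, 0) in
     if r is Some C then
       let beta : 'cV[R]_m := invmx (diag_mx dS) *m invmx C *m dS^T in
       Tick (m ^ 3 + m ^ 2)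
         (Ret (Some (fun A => \sum_i beta i 0 * X_ps (Ts i) A)))
     else Ret None).

End Algorithm.

(* Main.v *)
(** Products of entries of Sigma indexed by distinct pairings are orthonormal, so
    E[Y X_S] = |S|, E[X_S X_T] = |S :&: T|, and the correlation matrix C of the
    X_i is the Gram matrix of the normalized indicators of the S_i. With D the
    diagonal matrix of the sqrt |S_i|, d its diagonal and v = C'^-1 d for the
    estimated matrix C', the estimator f has E[f^2] = v C v^T, while
    E[(Y - f) X_i] = sqrt |S_i| (v (C' - C))_i and E[(Y - f) f] = v (C' - C) v^T.
    Since C is positive semidefinite, f is accurate as soon as the Frobenius norm
    of C' - C is at most eps r / 2, where r <= 2 is the least singular value
    of C'; for r > 2 the error C' - C is at least of order r / 2.

    The rounds sample independent indicators, so exponentials of the deviations of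
    the counts are supermartingales. A weighted sum of them over a dyadic grid of
    values of r starts below delta and is at least 1 whenever the loop stops with
    an inaccurate matrix; optional stopping bounds the probability of that event
    by delta without a union bound over the rounds. If sigma > 0, the loop can only
    continue past a polynomial number of rounds when C' - C has norm at least
    sigma / 2, which has exponentially small probability. *)
Require Import Defs.
From HB Require Import structures.
From mathcomp Require Import all_boot all_order all_algebra.
From mathcomp Require Import reals ring lra zify.
Set Implicit Arguments.
Unset Strict Implicit.
Unset Printing Implicit Defensive.
Import Order.TTheory GRing.Theory Num.Theory.
Local Open Scope ring_scope.

(** * Expectation and cost of randomized programs *)

Section ProgSemantics.
Context (R : realType).

(** The stopping rule reads the very estimate that it judges: the number of rounds is random and
    correlated with the error, and no positive lower bound on the singular value [r] is known in
    advance, so that infinitely many scales of [r] would be needed. For a run cut off after [K]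
    rounds finitely many suffice, because stopping at round [s] forces [r ^ 4 >= 80 m ^ 2 (m ^ 2 + 3
    ln (2 / delta)) / (eps ^ 2 s)]. The bound [delta] obtained this way does not depend on [K] and
    passes to the supremum.

    Programs are well-founded trees, so no stopping time is ever constructed: supermartingale and
    drift arguments become inductions on the number of remaining rounds.

    The indicator of an entry above the diagonal is sampled from the set that is not the larger of
    the two and then rescaled by a factor at most 1; deviations of counts therefore bound deviations
    of correlations. The potentials are sums of functions of one entry each, so the marginal law of
    each count is enough and the joint law never enters. *)

Lemma expect_bind (A B : Type) (p : prog R A) (f : A -> prog R B) g :
  expect (bind p f) g = expect p (fun a => expect (f a) g).
Proof. by elim: p => //= q k IHk; rewrite !IHk. Qed.

Lemma expect_cst (A : Type) (p : prog R A) (r : R) : expect p (fun=> r) = r.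
Proof. by elim: p => //= q k IHk; rewrite !IHk; ring. Qed.

Lemma expectD (A : Type) (p : prog R A) g h :
  expect p (fun a => g a + h a) = expect p g + expect p h.
Proof. by elim: p => //= q k IHk; rewrite !IHk; ring. Qed.

Lemma expectZ (A : Type) (p : prog R A) r g :
  expect p (fun a => r * g a) = r * expect p g.
Proof. by elim: p => //= q k IHk; rewrite !IHk; ring. Qed.

Lemma expect_sum (A I : Type) (s : seq I) (p : prog R A) (Q : pred I) (g : I -> A -> R) :
  expect p (fun a => \sum_(i <- s | Q i) g i a) = \sum_(i <- s | Q i) expect p (g i).
Proof.
elim: p => //= q k IHk; by rewrite !IHk !mulr_sumr -big_split.
Qed.

Lemma expected_cost_bind (A B : Type) (p : prog R A) (f : A -> prog R B) :
  expected_cost (bind p f) =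
  expected_cost p + expect p (fun a => expected_cost (f a)).
Proof.
elim: p => /= [a|c p ->|q k IHk]; rewrite ?add0r ?addrA// !IHk; ring.
Qed.

(* Every run of p costs at most c, flips coins with a bias in [0, 1] only and
   returns a value satisfying Q. *)
Fixpoint runs_within (A : Type) (p : prog R A) (c : nat) (Q : A -> Prop) : Prop :=
  match p with
  | Ret a => Q a
  | Tick d p' => (d <= c)%N /\ runs_within p' (c - d) Q
  | Flip q k => (0 <= q <= 1) /\ forall b, runs_within (k b) c Q
  end.

Lemma runs_within_le (A : Type) (p : prog R A) c c' (Q Q' : A -> Prop) :
  runs_within p c Q -> (c <= c')%N -> (forall a, Q a -> Q' a) -> runs_within p c' Q'.
Proof.
move=> + + QQ'; elim: p c c' => /= [a|d p IHp|q k IHk] c c'.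
- by move=> Qa _; exact: QQ'.
- move=> [dc wp] cc'; split; first exact: leq_trans cc'.
  by apply: IHp wp _; rewrite leq_sub2r.
- by move=> [q01 wk] cc'; split=> // b; exact: IHk (wk b) _.
Qed.

Lemma runs_within_bind (A B : Type) (p : prog R A) (f : A -> prog R B) c c' Q Q' :
  runs_within p c Q -> (forall a, Q a -> runs_within (f a) c' Q') ->
  runs_within (bind p f) (c + c') Q'.
Proof.
move=> + wf; elim: p c => /= [a|d p IHp|q k IHk] c.
- by move=> Qa; apply: runs_within_le (wf _ Qa) _ _ => //; rewrite leq_addl.
- move=> [dc wp]; split; first exact: leq_trans (leq_addr _ _).
  by rewrite -addnBAC//; exact: IHp.
- by move=> [q01 wk]; split=> // b; exact: IHk.
Qed.

(** A [Flip] may carry any real bias. Linearity of [expect] is purely algebraic, but monotonicity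
    needs biases in [0, 1]; this is why cost bounds, which certify the biases, accompany every
    comparison of expectations below. *)
Lemma le_expect (A : Type) (p : prog R A) c Q g h : runs_within p c Q ->
  (forall a, Q a -> g a <= h a) -> expect p g <= expect p h.
Proof.
move=> + gh; elim: p c => /= [a|d p IHp|q k IHk] c.
- exact: gh.
- by move=> [_ /IHp].
- move=> [/andP[q0 q1] wk]; apply: lerD; apply: ler_wpM2l => //.
  + exact: IHk (wk true).
  + by rewrite subr_ge0.
  + exact: IHk (wk false).
Qed.

Lemma eq_expect (A : Type) (p : prog R A) c Q g h : runs_within p c Q ->
  (forall a, Q a -> g a = h a) -> expect p g = expect p h.
Proof.
move=> wp gh; apply/le_anti.
by rewrite !(le_expect wp)// => a /gh ->.
Qed.

(** The postcondition [eq a] expresses that the result is deterministic. Calls to [NumPairings] and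
    [Contains] disappear from expectations by this rule. *)
Lemma expect_within_eq (A : Type) (p : prog R A) c a g :
  runs_within p c (eq a) -> expect p g = g a.
Proof.
move=> wp; rewrite (@eq_expect _ p c _ g (fun=> g a) wp) ?expect_cst//.
by move=> _ <-.
Qed.

Lemma expected_cost_le (A : Type) (p : prog R A) c Q :
  runs_within p c Q -> expected_cost p <= c%:R.
Proof.
elim: p c => /= [a|d p IHp|q k IHk] c //.
- by move=> [dc /IHp]; rewrite natrB// lerBrDl.
- move=> [/andP[q0 q1] wk].
  have h1 := IHk true c (wk true); have h2 := IHk false c (wk false).
  have -> : c%:R = q * c%:R + (1 - q) * c%:R :> R by ring.
  by apply: lerD; apply: ler_wpM2l; rewrite ?subr_ge0.
Qed.

(** [J] is a loop invariant indexed by the elements still to be visited. *)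
Lemma runs_within_foldP (A B : Type) (f : B -> A -> prog R B) c
    (J : seq A -> B -> Prop) (b : B) (s : seq A) :
  (forall a s' b, J (a :: s') b -> runs_within (f b a) c (J s')) ->
  J s b -> runs_within (foldP f b s) (size s * c) (J [::]).
Proof.
move=> Jf; elim: s b => //= a s IHs b Jb.
by rewrite mulSn; apply: runs_within_bind (Jf _ _ _ Jb) _.
Qed.

Lemma runs_within_mapP (A B I : Type) (f : A -> prog R B) (h : I -> A) (g : I -> B) c
    (s : seq I) :
  (forall i, runs_within (f (h i)) c (eq (g i))) ->
  runs_within (Defs.mapP f (map h s)) (size s * c) (eq (map g s)).
Proof.
move=> fg; elim: s => //= a s IHs; rewrite mulSn.
apply: runs_within_bind (fg a) _ => _ <-.
by rewrite -[X in runs_within _ X]addn0; apply: runs_within_bind IHs _ => _ <-.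
Qed.

End ProgSemantics.

(** * Pairings and pairing structures *)

Section Pairings.
Context (n : nat).
Implicit Types (K : {set 'I_n}) (p q : pairing n) (e : {set 'I_n}).

Lemma pairingsP K p :
  reflect [/\ cover p = K, trivIset p & forall e, e \in p -> #|e| = 2%N]
          (p \in pairings K).
Proof.
rewrite inE; apply: (iffP andP) => [[/and3P[/eqP covK triv _] /forall_inP p2]|].
  by split=> // e /p2 /eqP.
move=> [covK triv p2]; split; last by apply/forall_inP => e /p2 ->.
rewrite /partition covK eqxx triv /=.
by apply/negP => /p2; rewrite cards0.
Qed.

Lemma pairings_base (i j : 'I_n) : i != j ->
  pairings [set i; j] = [set [set [set i; j]]].
Proof.
move=> ij; apply/setP => p; rewrite in_set1; apply/pairingsP/eqP.
  move=> [covp triv p2]; apply/setP => e; rewrite in_set1; apply/idP/eqP.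
    move=> ep; apply/eqP; rewrite eqEcard -covp; apply/andP; split.
      exact: bigcup_sup.
    by rewrite (p2 _ ep) covp cards2 ij.
  move=> ->; have : i \in cover p by rewrite covp !inE eqxx.
  case/bigcupP => f fp jf.
  suff <- : f = [set i; j] by [].
  apply/eqP; rewrite eqEcard -{1}covp (p2 _ fp) cards2 ij andbT.
  exact: bigcup_sup.
move=> ->; split; first by rewrite /cover big_set1.
  by apply/trivIsetP => A B; rewrite !in_set1 => /eqP -> /eqP ->; rewrite eqxx.
by move=> e; rewrite in_set1 => /eqP ->; rewrite cards2 ij.
Qed.

Lemma pairing_sub K p e : p \in pairings K -> e \in p -> e \subset K.
Proof. by case/pairingsP => <- _ _ ep; exact: bigcup_sup. Qed.

Lemma pairing_neq0 K p e : p \in pairings K -> e \in p -> e != set0.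
Proof. by case/pairingsP => _ _ p2 /p2 e2; rewrite -card_gt0 e2. Qed.

Lemma pairings_setU K1 K2 p1 p2 : [disjoint K1 & K2] ->
  p1 \in pairings K1 -> p2 \in pairings K2 -> p1 :|: p2 \in pairings (K1 :|: K2).
Proof.
move=> dis h1 h2; apply/pairingsP.
case/pairingsP: (h1) => cov1 /trivIsetP tri1 c1.
case/pairingsP: (h2) => cov2 /trivIsetP tri2 c2; split.
- by rewrite /cover bigcup_setU -cov1 -cov2.
- apply/trivIsetP => A B; rewrite !inE.
  have dis12 C D : C \in p1 -> D \in p2 -> [disjoint C & D].
    move=> /(pairing_sub h1) s1 /(pairing_sub h2) s2.
    by apply: disjointWl s1 _; apply: disjointWr s2 _.
  case/orP => hA /orP[] hB nAB.
  + exact: tri1.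
  + exact: dis12.
  + by rewrite disjoint_sym; exact: dis12.
  + exact: tri2.
- by move=> e; rewrite inE => /orP[/c1|/c2].
Qed.

(** Edges are nonempty, so no edge over [K2] fits inside [K1], and both parts can be read off the
    union. This gives unique decomposition in products and the correctness of the split made by
    [Contains]. *)
Lemma setU_pairing_restrict K1 K2 p1 p2 : [disjoint K1 & K2] ->
  p1 \in pairings K1 -> p2 \in pairings K2 ->
  [set e in p1 :|: p2 | e \subset K1] = p1 /\
  (p1 :|: p2) :\: p1 = p2.
Proof.
move=> dis h1 h2.
have out e : e \in p2 -> (e \subset K1) = false.
  move=> ep; apply/negbTE; apply: contra (pairing_neq0 h2 ep) => eK1.
  rewrite -subset0 -(disjoint_setI0 dis) subsetI eK1.
  exact: pairing_sub ep.
split; apply/setP => e; rewrite !inE.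
  case: (boolP (e \in p1)) => [/(pairing_sub h1) -> //|_] /=.
  by case: (boolP (e \in p2)) => //= /out.
case: (boolP (e \in p1)) => [e1|//] /=; apply/esym/negbTE/negP => /out.
by rewrite (pairing_sub h1).
Qed.

(** An edge meets [K1] in 0, 1 or 2 points. Once the value 1 is excluded, every edge lies inside
    [K1] or inside [K2]. *)
Lemma pairing_split K1 K2 p : [disjoint K1 & K2] ->
  p \in pairings (K1 :|: K2) -> ~~ [exists e in p, #|e :&: K1| == 1%N] ->
  [set e in p | e \subset K1] \in pairings K1 /\
  p :\: [set e in p | e \subset K1] \in pairings K2.
Proof.
move=> dis hp; rewrite negb_exists => /forallP no1.
case/pairingsP: (hp) => cov /trivIsetP tri c2.
have dich e : e \in p -> e \subset K1 \/ e \subset K2.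
  move=> ep; have := no1 e; rewrite ep /= => e1.
  have le2 : (#|e :&: K1| <= 2)%N by rewrite -(c2 _ ep) subset_leq_card ?subsetIl.
  have [e0|/eqP|e2] : [\/ #|e :&: K1| = 0%N, #|e :&: K1| = 1%N | #|e :&: K1| = 2%N].
    by case: #|_| e1 le2 => [|[|[|]]] // *; [constructor 1|constructor 3].
  - right; apply/subsetP => x xe.
    have := subsetP (pairing_sub hp ep) _ xe; rewrite inE => /orP[xK1|//].
    have : x \in e :&: K1 by rewrite inE xe.
    by rewrite (cards0_eq e0) inE.
  - by rewrite (negbTE e1).
  - left; suff <- : e :&: K1 = e by exact: subsetIr.
    by apply/eqP; rewrite eqEcard subsetIl (c2 _ ep) e2.
split; apply/pairingsP; split.
- apply/eqP; rewrite eqEsubset; apply/andP; split.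
    by apply/bigcupsP => e; rewrite inE => /andP[].
  apply/subsetP => x xK1; have : x \in cover p by rewrite cov inE xK1.
  case/bigcupP => e ep xe; apply/bigcupP; exists e => //; rewrite inE ep /=.
  case: (dich _ ep) => // /subsetP/(_ _ xe) xK2.
  by move/disjointFr: dis => /(_ _ xK1); rewrite xK2.
- by apply/trivIsetP => A B; rewrite !inE => /andP[Ap _] /andP[Bp _]; exact: tri.
- by move=> e; rewrite inE => /andP[/c2].
- apply/eqP; rewrite eqEsubset; apply/andP; split.
    apply/bigcupsP => e; rewrite !inE negb_and => /andP[/orP[/negbTE -> //|eK1] ep].
    by case: (dich _ ep) => // eK1'; rewrite eK1' in eK1.
  apply/subsetP => x xK2; have : x \in cover p by rewrite cov inE xK2 orbT.
  case/bigcupP => e ep xe; apply/bigcupP; exists e => //; rewrite !inE ep /= andbT.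
  apply/negP => /subsetP/(_ _ xe) xK1.
  by move/disjointFr: dis => /(_ _ xK1); rewrite xK2.
- by apply/trivIsetP => A B; rewrite !inE => /andP[_ Ap] /andP[_ Bp]; exact: tri.
- by move=> e; rewrite inE => /andP[_ /c2].
Qed.

Lemma ps_set_sub (t : pstruct n) : ps_wf t -> ps_set t \subset pairings (ps_index t).
Proof.
elim: t => /= [i j _|t1 IH1 t2 IH2|t1 IH1 t2 IH2].
- exact: subxx.
- move=> /and4P[wf1 wf2 /eqP idx _].
  by rewrite subUset IH1//= idx IH2.
- move=> /and3P[wf1 wf2 dis]; apply/subsetP => p /imset2P[p1 p2 h1 h2 ->].
  by apply: pairings_setU => //; [exact: (subsetP (IH1 wf1))|exact: (subsetP (IH2 wf2))].
Qed.

Lemma mem_ps_prod (t1 t2 : pstruct n) p : ps_wf (PProd t1 t2) ->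
  p \in pairings (ps_index t1 :|: ps_index t2) ->
  (p \in ps_set (PProd t1 t2)) =
  let p1 := [set e in p | e \subset ps_index t1] in
  [&& ~~ [exists e in p, #|e :&: ps_index t1| == 1%N],
      p1 \in ps_set t1 & p :\: p1 \in ps_set t2].
Proof.
move=> /= /and3P[wf1 wf2 dis] hp; apply/imset2P/and3P.
  move=> [p1 p2 h1 h2 ->].
  have P1 := subsetP (ps_set_sub wf1) _ h1.
  have P2 := subsetP (ps_set_sub wf2) _ h2.
  have [-> ->] := setU_pairing_restrict dis P1 P2; split => //.
  rewrite negb_exists; apply/forallP => e; rewrite negb_and inE.
  case: (boolP (e \in p1)) => [e1|_] /=.
    rewrite (setIidPl (pairing_sub P1 e1)).
    by case/pairingsP: P1 => _ _ ->.
  case: (boolP (e \in p2)) => //= e2.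
  suff -> : e :&: ps_index t1 = set0 by rewrite cards0.
  apply/eqP; rewrite -subset0 -(disjoint_setI0 dis) setIC.
  by apply: setIS; exact: pairing_sub e2.
move=> [_ h1 h2]; exists [set e in p | e \subset ps_index t1]
  (p :\: [set e in p | e \subset ps_index t1]) => //.
apply/setP => e; rewrite !inE.
by case: (e \in p) => //=; case: (_ \subset _).
Qed.

End Pairings.

(** * Values, costs and output laws of the helper routines *)

Section Helpers.
Context (R : realType) (n : nat).
Implicit Types (t : pstruct n).

Fixpoint num_pairings t : nat :=
  match t with
  | PBase _ _ => 1
  | PUnion t1 t2 => num_pairings t1 + num_pairings t2
  | PProd t1 t2 => num_pairings t1 * num_pairings t2
  end.

Lemma ps_size_gt0 t : (0 < ps_size t)%N. Proof. by case: t. Qed.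

Lemma num_pairings_gt0 t : (0 < num_pairings t)%N.
Proof.
by elim: t => //= t1 h1 t2 h2; rewrite ?addn_gt0 ?muln_gt0 ?h1 ?h2.
Qed.

(** Makes the bit length of [|S(T)|] linear in the representation size, so that exact arithmetic on
    these possibly exponential integers has polynomial cost. *)
Lemma num_pairings_le t : (num_pairings t <= 2 ^ (ps_size t).-1)%N.
Proof.
elim: t => //= t1 IH1 t2 IH2.
- have := ps_size_gt0 t1; have := ps_size_gt0 t2.
  move: IH1 IH2; case: (ps_size t1) => // a; case: (ps_size t2) => // b /= IH1 IH2 _ _.
  rewrite addSn addnS expnS expnS.
  have : (2 ^ a <= 2 ^ (a + b))%N by rewrite leq_pexp2l ?leq_addr.
  have : (2 ^ b <= 2 ^ (a + b))%N by rewrite leq_pexp2l ?leq_addl.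
  lia.
- apply: leq_trans (leq_mul IH1 IH2) _; rewrite -expnD leq_pexp2l//.
  by rewrite leq_add ?leq_pred.
Qed.

Lemma bitlen_num_pairings t : (bitlen (num_pairings t) <= ps_size t)%N.
Proof.
rewrite /bitlen -(prednK (ps_size_gt0 t)) ltnS.
have := num_pairings_le t; move/(leq_trunc_log 2).
by rewrite trunc_expnK.
Qed.

Lemma ps_prod_inj t1 t2 : ps_wf (PProd t1 t2) ->
  {in setX (ps_set t1) (ps_set t2) &,
    injective (uncurry (fun p1 p2 : pairing n => p1 :|: p2))}.
Proof.
move=> /= /and3P[wf1 wf2 dis] [p1 p2] [q1 q2].
rewrite !inE/= => /andP[hp1 hp2] /andP[hq1 hq2] epq.
have P1 := subsetP (ps_set_sub wf1) _ hp1.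
have P2 := subsetP (ps_set_sub wf2) _ hp2.
have Q1 := subsetP (ps_set_sub wf1) _ hq1.
have Q2 := subsetP (ps_set_sub wf2) _ hq2.
have [e1 e2] := setU_pairing_restrict dis P1 P2.
have [f1 f2] := setU_pairing_restrict dis Q1 Q2.
have epq1 : p1 = q1 by rewrite -e1 -f1 epq.
by congr pair => //; rewrite -e2 -f2 epq epq1.
Qed.

Lemma card_ps_set t : ps_wf t -> #|ps_set t| = num_pairings t.
Proof.
elim: t => /= [i j ij|t1 IH1 t2 IH2|t1 IH1 t2 IH2].
- by rewrite pairings_base// cards1.
- move=> /and4P[wf1 wf2 _ dis].
  by rewrite cardsU disjoint_setI0// cards0 subn0 IH1// IH2.
- move=> wf; case/and3P: (wf) => wf1 wf2 dis; rewrite curry_imset2X card_in_imset.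
    by rewrite cardsX IH1// IH2.
  exact: ps_prod_inj.
Qed.

Lemma card_pairing_ps_set t p : p \in ps_set t -> (#|p| <= ps_size t)%N.
Proof.
elim: t p => /= [i j|t1 IH1 t2 IH2|t1 IH1 t2 IH2] p.
(* For [i = j] an edge would be a subset of size 2 of a singleton, so no pairing has an edge. *)
- have [->|ij] := eqVneq i j; last by rewrite pairings_base// in_set1 => /eqP ->; rewrite cards1.
  case/pairingsP => cov _ p2; rewrite leqNgt; apply/negP => p1.
  have /card_gt0P[e ep] : (0 < #|p|)%N by exact: leq_trans p1.
  have := subset_leq_card (bigcup_sup e ep : e \subset cover p).
  by rewrite cov (p2 _ ep) cards2 eqxx.
- by rewrite inE => /orP[/IH1|/IH2] h; apply: leq_trans h _; rewrite leqW// ?leq_addr ?leq_addl.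
- move=> /imset2P[p1 p2 /IH1 h1 /IH2 h2 ->].
  by rewrite leqW// (leq_trans (leq_card_setU p1 p2))// leq_add.
Qed.

Lemma runs_within_index_set t :
  runs_within (index_set R t) (ps_size t * (2 * n + 3)) (eq (ps_index t)).
Proof.
have cK (K : {set 'I_n}) : (#|K| <= n)%N.
  by rewrite -[X in (_ <= X)%N]card_ord max_card.
elim: t => /= [i j|t1 IH1 t2 IH2|t1 IH1 t2 IH2].
- by split=> //; lia.
- split; first by lia.
  by apply: runs_within_le IH1 _ _ => //; nia.
- rewrite mulSn addnC mulnDl -addnA.
  apply: runs_within_bind IH1 _ => _ <-; apply: runs_within_bind IH2 _ => _ <-.
  split=> //.
  by apply: (@leq_ltn_trans (n + n)); [rewrite leq_add ?cK|lia].
Qed.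

Lemma runs_within_NumPairings t :
  runs_within (NumPairings R t) (ps_size t ^ 3) (eq (num_pairings t)).
Proof.
elim: t => //= t1 IH1 t2 IH2.
- apply: (@runs_within_le _ _ _
    (ps_size t1 ^ 3 + (ps_size t2 ^ 3 + (ps_size t1 + ps_size t2).+1)) _
    (eq (num_pairings t1 + num_pairings t2)%N)) => //.
    apply: runs_within_bind IH1 _ => _ <-.
    apply: runs_within_bind IH2 _ => _ <-; split=> //.
    by rewrite ltnS leq_add ?bitlen_num_pairings.
  rewrite !expnS !expn0 !muln1; nia.
- apply: (@runs_within_le _ _ _
    (ps_size t1 ^ 3 + (ps_size t2 ^ 3 + (ps_size t1 * ps_size t2).+1)) _
    (eq (num_pairings t1 * num_pairings t2)%N)) => //.
    apply: runs_within_bind IH1 _ => _ <-.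
    apply: runs_within_bind IH2 _ => _ <-; split=> //.
    by rewrite ltnS leq_mul ?bitlen_num_pairings.
  rewrite !expnS !expn0 !muln1; nia.
Qed.

(** Each union node recomputes [NumPairings] at cubic cost, and there are linearly many nodes; hence
    the fourth power. *)
Lemma runs_within_Sample t : ps_wf t ->
  runs_within (Sample R t) (4 * ps_size t ^ 4) (fun p => p \in ps_set t).
Proof.
elim: t => /= [i j ij|t1 IH1 t2 IH2|t1 IH1 t2 IH2].
- by rewrite pairings_base// in_set1 eqxx.
- move=> /and4P[wf1 wf2 _ dis].
  set s1 := ps_size t1; set s2 := ps_size t2.
  have w1 := runs_within_NumPairings t1.
  have w2 := runs_within_NumPairings (PUnion t1 t2).
  apply: (@runs_within_le _ _ _ (s1 ^ 3 + ((s1 + s2).+1 ^ 3 + ((s1 + (s1 + s2).+1).+1 +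
    4 * (s1 + s2) ^ 4))) _ (fun p => p \in ps_set t1 :|: ps_set t2)) => //.
    apply: runs_within_bind w1 _ => _ <-; apply: runs_within_bind w2 _ => _ <-.
    split.
      apply: leq_trans _ (leq_addr _ _); rewrite ltnS leq_add ?bitlen_num_pairings//.
    split.
      rewrite divr_ge0//= ler_pdivrMr ?mul1r ?ler_nat ?leq_addr//.
      by rewrite ltr0n addn_gt0 num_pairings_gt0.
    case; [apply: runs_within_le (IH1 wf1) _ _|apply: runs_within_le (IH2 wf2) _ _].
    + apply: (@leq_trans (4 * (s1 + s2) ^ 4)); first by rewrite leq_mul// leq_exp2r ?leq_addr.
      rewrite -addnBAC ?leq_addl//.
      rewrite ltnS leq_add ?bitlen_num_pairings//.
    + by move=> p h; rewrite inE h.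
    + apply: (@leq_trans (4 * (s1 + s2) ^ 4)); first by rewrite leq_mul// leq_exp2r ?leq_addl.
      rewrite -addnBAC ?leq_addl//.
      rewrite ltnS leq_add ?bitlen_num_pairings//.
    + by move=> p h; rewrite inE h orbT.
  have := ps_size_gt0 t1; have := ps_size_gt0 t2; rewrite -/s1 -/s2.
  rewrite !expnS !expn0 !muln1; nia.
- move=> /and3P[wf1 wf2 dis].
  set s1 := ps_size t1; set s2 := ps_size t2.
  apply: (@runs_within_le _ _ _ (4 * s1 ^ 4 + (4 * s2 ^ 4 + (s1 + s2).+1)) _
     (fun p => p \in [set p1 :|: p2 | p1 in ps_set t1, p2 in ps_set t2])) => //.
    apply: runs_within_bind (IH1 wf1) _ => p1 h1; apply: runs_within_bind (IH2 wf2) _ => p2 h2.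
    split; first by rewrite ltnS leq_add ?card_pairing_ps_set.
    by apply/imset2P; exists p1 p2.
  rewrite !expnS !expn0 !muln1; nia.
Qed.

(** Every node is charged for recomputing an index set and for scanning the edges. [b] bounds the
    number of edges and is inherited by both parts of a split, which keeps the charge uniform in the
    recursion. *)
Lemma runs_within_Contains b t p : ps_wf t -> p \in pairings (ps_index t) ->
  (#|p| <= b)%N ->
  runs_within (Contains R t p) (ps_size t * (ps_size t * (2 * n + 3) + 2 * b * n + 1))
    (eq (p \in ps_set t)).
Proof.
have cK (K : {set 'I_n}) : (#|K| <= n)%N.
  by rewrite -[X in (_ <= X)%N]card_ord max_card.
elim: t p => /= [i j|t1 IH1 t2 IH2|t1 IH1 t2 IH2] p.
- by move=> _ hp _; split => //; first lia.
- move=> /and4P[wf1 wf2 /eqP idx _] hp pb.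
  have hp2 : p \in pairings (ps_index t2) by rewrite -idx.
  set s1 := ps_size t1; set s2 := ps_size t2; set N := (2 * n + 3)%N.
  set W := (s1 * (s1 * N + 2 * b * n + 1) + (s2 * (s2 * N + 2 * b * n + 1) + 0))%N.
  have leW : (W + 1 <= (s1 + s2).+1 * ((s1 + s2).+1 * N + 2 * b * n + 1))%N.
    by rewrite /W; nia.
  split; first exact: leq_trans (leq_addl _ _) leW.
  apply: (@runs_within_le _ _ _ W _ (eq (p \in ps_set t1 :|: ps_set t2))) => //.
    apply: runs_within_bind (IH1 _ wf1 hp pb) _ => _ <-.
    by apply: runs_within_bind (IH2 _ wf2 hp2 pb) _ => _ <- /=; rewrite inE.
  by rewrite -[W](addnK 1%N) leq_sub2r.
- move=> wf hp pb; move: (wf) => /= /and3P[wf1 wf2 dis].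
  set s1 := ps_size t1; set s2 := ps_size t2; set N := (2 * n + 3)%N.
  apply: (@runs_within_le _ _ _ (s1 * N + ((2 * b * n).+1 + (s1 * (s1 * N + 2 * b * n + 1) +
     (s2 * (s2 * N + 2 * b * n + 1) + 0)))) _
     (eq (p \in ps_set (PProd t1 t2)))) => //; last first.
    nia.
  apply: runs_within_bind (runs_within_index_set t1) _ => _ <-.
  have le1 : ((2 * (#|p| * #|ps_index t1|)).+1 <= (2 * b * n).+1)%N.
    by rewrite ltnS -mulnA leq_mul// leq_mul// cK.
  split; first exact: leq_trans le1 (leq_addr _ _).
  rewrite (mem_ps_prod wf hp)/=.
  case: ifPn => [//|no1].
  have [hp1 hp2] := pairing_split dis hp no1.
  have pb1 : (#|[set e in p | e \subset ps_index t1]| <= b)%N.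
    apply: leq_trans pb; rewrite subset_leq_card//.
    by apply/subsetP => e; rewrite inE => /andP[].
  have pb2 : (#|p :\: [set e in p | e \subset ps_index t1]| <= b)%N.
    by apply: leq_trans pb; rewrite subset_leq_card// subsetDl.
  apply: (@runs_within_le _ _ _ (s1 * (s1 * N + 2 * b * n + 1) +
     (s2 * (s2 * N + 2 * b * n + 1) + 0)) _ _ _ _ _ (fun _ h => h)).
    apply: runs_within_bind (IH1 _ wf1 hp1 pb1) _ => _ <-.
    by apply: runs_within_bind (IH2 _ wf2 hp2 pb2) _ => _ <- /=.
  by rewrite -addnBAC// leq_addl.
Qed.

(** Disjointness turns the biased mixture at a union into one average, and unique decomposition
    turns the nested averages at a product into one average over the unions of pairings. *)
Lemma expect_Sample t (g : pairing n -> R) : ps_wf t ->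
  expect (Sample R t) g = (\sum_(p in ps_set t) g p) / #|ps_set t|%:R.
Proof.
have num0 t' : (num_pairings t')%:R != 0 :> R.
  by rewrite pnatr_eq0 -lt0n num_pairings_gt0.
elim: t g => [i j|t1 IH1 t2 IH2|t1 IH1 t2 IH2] g.
- by move=> /= ij; rewrite pairings_base// big_set1 cards1 divr1.
- move=> wf; rewrite (card_ps_set wf); move: wf => /= /and4P[wf1 wf2 _ dis].
  rewrite expect_bind (expect_within_eq _ (runs_within_NumPairings t1)).
  rewrite expect_bind (expect_within_eq _ (runs_within_NumPairings (PUnion t1 t2))) /=.
  have -> : \sum_(p in ps_set t1 :|: ps_set t2) g p =
      \sum_(p in ps_set t1) g p + \sum_(p in ps_set t2) g p.
    by rewrite -bigU//=; apply: eq_bigl => p; rewrite !inE.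
  rewrite IH1// IH2// !card_ps_set//=.
  have h := num0 (PUnion t1 t2); rewrite /= natrD in h.
  rewrite natrD; field.
  by rewrite h !num0.
- move=> wf; rewrite (card_ps_set wf); move: (wf) => /= /and3P[wf1 wf2 dis].
  rewrite expect_bind IH1//.
  rewrite (eq_bigr (fun p1 => (\sum_(p2 in ps_set t2) g (p1 :|: p2)) /
    #|ps_set t2|%:R)); last by move=> p1 _; rewrite expect_bind/= IH2.
  rewrite -mulr_suml !card_ps_set//.
  have -> : \sum_(p in [set p1 :|: p2 | p1 in ps_set t1, p2 in ps_set t2]) g p =
      \sum_(p1 in ps_set t1) \sum_(p2 in ps_set t2) g (p1 :|: p2).
    rewrite pair_big_dep/= curry_imset2X big_imset/=.
      by apply: eq_big => [[p q]|[p q] _] //; rewrite inE.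
    exact: ps_prod_inj.
  rewrite natrM; field.
  by rewrite !num0.
Qed.

End Helpers.

(** * One round of sampling *)

Section SampleRound.
Context (R : realType) (n m : nat) (Ts : 'I_m -> pstruct n).
Hypothesis Ts_wf : forall i, ps_wf (Ts i).
Hypothesis Ts_index : forall i, ps_index (Ts i) = [set: 'I_n].
Implicit Types (M : 'M[R]_m) (i j k l : 'I_m).

(** The probability that a uniform element of [ps_set (Ts j)] lies in [ps_set (Ts i)], that is, the
    mean increment of entry [(i, j)] per round when [i < j]. *)
Definition overlap i j : R :=
  #|ps_set (Ts i) :&: ps_set (Ts j)|%:R / #|ps_set (Ts j)|%:R.

Lemma card_ps_set_gt0 i : (0 < #|ps_set (Ts i)|)%N.
Proof. by rewrite card_ps_set// num_pairings_gt0. Qed.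

Lemma overlap01 i j : 0 <= overlap i j <= 1.
Proof.
rewrite /overlap divr_ge0//= ler_pdivrMr ?ltr0n ?card_ps_set_gt0// mul1r.
by rewrite ler_nat subset_leq_card// subsetIr.
Qed.

Let step i M j := letp p := Sample R (Ts j) in
  letp b := Contains R (Ts i) p in
  Tick 1 (Ret (if b then M + delta_mx i j + delta_mx j i else M)).

Let wC i j p : p \in ps_set (Ts j) -> forall b, (#|p| <= b)%N ->
  runs_within (Contains R (Ts i) p)
    (ps_size (Ts i) * (ps_size (Ts i) * (2 * n + 3) + 2 * b * n + 1))
    (eq (p \in ps_set (Ts i))).
Proof.
move=> hp b pb; apply: runs_within_Contains => //.
by rewrite Ts_index -(Ts_index j); exact: (subsetP (ps_set_sub (Ts_wf j))).
Qed.

Lemma expect_step i M j (g : 'M[R]_m -> R) :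
  expect (step i M j) g =
  overlap i j * g (M + delta_mx i j + delta_mx j i) + (1 - overlap i j) * g M.
Proof.
rewrite expect_bind.
have -> : expect (Sample R (Ts j)) (fun p => expect (letp b := Contains R (Ts i) p in
      Tick 1 (Ret (if b then M + delta_mx i j + delta_mx j i else M))) g) =
   expect (Sample R (Ts j)) (fun p => g M + (p \in ps_set (Ts i))%:R *
     (g (M + delta_mx i j + delta_mx j i) - g M)).
  apply: eq_expect (runs_within_Sample R (Ts_wf j)) _ => p hp.
  rewrite expect_bind (expect_within_eq _ (wC i hp (leqnn _)))/=.
  by case: ifP => _ /=; ring.
rewrite expectD expect_cst.
have -> : (fun p => (p \in ps_set (Ts i))%:R *
    (g (M + delta_mx i j + delta_mx j i) - g M)) =
  (fun p => (g (M + delta_mx i j + delta_mx j i) - g M) *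
     (p \in ps_set (Ts i))%:R) by apply: boolp.funext => p; rewrite mulrC.
rewrite expectZ expect_Sample//.
have -> : \sum_(p in ps_set (Ts j)) (p \in ps_set (Ts i))%:R =
    #|ps_set (Ts i) :&: ps_set (Ts j)|%:R :> R.
  rewrite -sum1_card natr_sum big_mkcond [RHS]big_mkcond; apply: eq_bigr => p _.
  by rewrite inE andbC; case: (p \in ps_set (Ts j)) => //=; case: (_ \in _).
rewrite -/(overlap i j); ring.
Qed.

Let upper_entry M i j k l : (i < j)%N -> (k < l)%N ->
  (M + delta_mx i j + delta_mx j i) k l = M k l + ((k == i) && (l == j))%:R.
Proof.
move=> ij kl; rewrite !mxE; case: (eqVneq k j) => [kj|_] /=; last by rewrite addr0.
have -> /= : (l == i) = false.
  by apply/negbTE/eqP => li; move: ij; rewrite -li -kj ltnNge ltnW.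
by rewrite addr0.
Qed.

Let diag_entry M i j k : (i < j)%N ->
  (M + delta_mx i j + delta_mx j i) k k = M k k.
Proof.
move=> ij; have nij : i != j by rewrite neq_ltn ij.
rewrite !mxE; case: (eqVneq k i) => [->|_] /=; last by rewrite andbF !addr0.
by rewrite (negbTE nij) !addr0.
Qed.

(** The test function [h] sees a single entry above the diagonal. That entry is touched by one
    iteration only, and all other coins average out. *)
Lemma expect_inner_entry i M (js : seq 'I_m) i0 j0 (h : R -> R) : (i0 < j0)%N ->
  uniq js -> all (fun j => i < j)%N js ->
  expect (foldP (step i) M js) (fun M' => h (M' i0 j0)) =
  if (i0 == i) && (j0 \in js)
  then overlap i0 j0 * h (M i0 j0 + 1) + (1 - overlap i0 j0) * h (M i0 j0)
  else h (M i0 j0).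
Proof.
move=> ij0; elim: js M => [|j js IHjs] M; first by rewrite andbF.
move=> /= /andP[jjs ujs] /andP[ij alljs].
rewrite expect_bind expect_step !IHjs// upper_entry// inE.
case: (eqVneq i0 i) => [->|_] /=; last by rewrite addr0; ring.
case: (eqVneq j0 j) => [->|_] /=; last by rewrite addr0; case: ifP => _; ring.
by rewrite (negbTE jjs).
Qed.

Lemma expect_sample_round_entry M i0 j0 (h : R -> R) : (i0 < j0)%N ->
  expect (sample_round Ts M) (fun M' => h (M' i0 j0)) =
  overlap i0 j0 * h (M i0 j0 + 1) + (1 - overlap i0 j0) * h (M i0 j0).
Proof.
move=> ij0; rewrite /sample_round.
have : uniq (enum 'I_m) by exact: enum_uniq.
have : i0 \in enum 'I_m by rewrite mem_enum.
have dd M' i : (M' + delta_mx i i) i0 j0 = M' i0 j0.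
  rewrite !mxE; case: (eqVneq i0 i) => [<-|_] /=; last by rewrite addr0.
  by rewrite -val_eqE /= gtn_eqF// addr0.
suff H (s : seq 'I_m) M' : uniq s ->
   expect (foldP (fun (M0 : 'M[R]_m) (i : 'I_m) => Tick 1
      (foldP (step i) (M0 + delta_mx i i) [seq j : 'I_m <- enum 'I_m | (i < j)%N])) M' s)
     (fun M0 => h (M0 i0 j0)) =
   if i0 \in s then overlap i0 j0 * h (M' i0 j0 + 1) + (1 - overlap i0 j0) * h (M' i0 j0)
   else h (M' i0 j0).
  by move=> i0s us; rewrite H// i0s.
elim: s M' => [//|i s IHs] M' /= /andP[nis us].
rewrite expect_bind.
(* [h'] is the expectation over the rows still to come, as a function of the current value of the
   entry. *)
pose h' x := if i0 \in s then
  overlap i0 j0 * h (x + 1) + (1 - overlap i0 j0) * h x else h x.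
rewrite (_ : (fun a => _) = (fun M0 : 'M[R]_m => h' (M0 i0 j0))); last first.
  by apply: boolp.funext => M0; rewrite IHs.
transitivity (expect (foldP (step i) (M' + delta_mx i i)
  [seq j : 'I_m <- enum 'I_m | (i < j)%N]) (fun M0 => h' (M0 i0 j0))) => //.
rewrite expect_inner_entry ?filter_all//; last by rewrite filter_uniq// enum_uniq.
rewrite /h' {h'}; move: nis.
rewrite mem_filter mem_enum andbT dd inE.
by case: (eqVneq i0 i) => [<-|_] //= /negbTE ->; rewrite ij0.
Qed.

Lemma runs_within_sample_round S M : (forall i, (ps_size (Ts i) <= S)%N) ->
  runs_within (sample_round Ts M)
    (m * (1 + m * (4 * S ^ 4 + (S * (S * (2 * n + 3) + 2 * S * n + 1) + 1))))
    (fun M' => (forall k, M' k k = M k k + 1) /\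
       forall k l, (k < l)%N -> M k l <= M' k l <= M k l + 1).
Proof.
move=> leS; set C := (4 * S ^ 4 + _)%N.
have wstep i M1 j : (i < j)%N -> runs_within (step i M1 j) C
    (fun M2 => M2 = M1 \/ M2 = M1 + delta_mx i j + delta_mx j i).
  move=> ij; apply: runs_within_bind.
    apply: runs_within_le (runs_within_Sample R (Ts_wf j)) _ (fun _ => id).
    by rewrite leq_mul// leq_exp2r.
  move=> p hp; apply: runs_within_bind.
    apply: runs_within_le (wC i hp _) _ (fun _ => id).
      exact: leq_trans (card_pairing_ps_set hp) (leS j).
    by rewrite leq_mul// leq_add// leq_add// leq_mul.
  by move=> b _ /=; split=> //; case: ifP => _; [right|left].
(* While row [i] is processed, an entry above the diagonal can have grown, by at most 1, only if it
   lies in row [i] and its column has already been visited. *)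
pose Jin i M1 (rem : seq 'I_m) M2 := [/\ uniq rem, all (fun j => i < j)%N rem,
  forall k, M2 k k = M1 k k &
  forall k l, (k < l)%N ->
    M1 k l <= M2 k l <= M1 k l + ((k == i) && (l \notin rem))%:R].
have wloop i M1 : runs_within
    (foldP (step i) M1 [seq j : 'I_m <- enum 'I_m | (i < j)%N]) (m * C) (Jin i M1 [::]).
  set s := [seq _ <- _ | _].
  apply: (@runs_within_le _ _ _ (size s * C) _ (Jin i M1 [::])) => //; last first.
    by rewrite leq_mul// size_filter (leq_trans (count_size _ _))// size_enum_ord.
  apply: runs_within_foldP; last first.
    split=> [|||k l kl] //; last by rewrite lexx lerDl ler0n.
      by rewrite filter_uniq// enum_uniq.
    exact: filter_all.
  move=> j s' M2 [/= /andP[js' us'] /andP[ij alls'] diag upper].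
  apply: runs_within_le (wstep i M2 j ij) (leqnn _) _ => M3 [->|->].
    split=> // k l kl; have /andP[-> /= h] := upper _ _ kl.
    apply: le_trans h _; rewrite lerD2l ler_nat inE negb_or.
    by case: (k == i) => //=; case: (l \notin s'); rewrite ?andbF//; case: eqP.
  split=> // [k|k l kl]; first by rewrite diag_entry.
  rewrite upper_entry//; have /andP[h1 h2] := upper _ _ kl; apply/andP; split.
    by rewrite (le_trans h1)// lerDl ler0n.
  move: h2; rewrite inE negb_or; case: (eqVneq l j) => [->|lj] /=.
    rewrite andbF addr0 andbT js' andbT => h2; exact: lerD.
  by rewrite andbF addr0.
pose J (rem : seq 'I_m) M2 := [/\ uniq rem,
  forall k, M2 k k = M k k + (k \notin rem)%:R &
  forall k l, (k < l)%N -> M k l <= M2 k l <= M k l + (k \notin rem)%:R].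
have : runs_within (sample_round Ts M) (size (enum 'I_m) * (1 + m * C)) (J [::]).
  apply: runs_within_foldP; last first.
    split; first exact: enum_uniq.
      by move=> k; rewrite mem_enum addr0.
    by move=> k l kl; rewrite mem_enum/= addr0 lexx.
  move=> i s M1 [/= /andP[nis us] diag upper]; split=> //; rewrite addKn.
  apply: runs_within_le (wloop i _) (leqnn _) _ => M2 [_ _ diag2 upper2].
  split=> // [k|k l kl].
    rewrite diag2 !mxE diag inE; case: (eqVneq k i) => [->|_] /=.
      by rewrite nis addr0.
    by rewrite addr0.
  have dii : (M1 + delta_mx i i) k l = M1 k l.
    rewrite !mxE; case: (eqVneq k i) => [<-|_] /=; last by rewrite addr0.
    by rewrite -val_eqE /= gtn_eqF// addr0.
  have /andP[h1 h2] := upper _ _ kl.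
  have /andP[] := upper2 _ _ kl; rewrite dii => h3 h4.
  rewrite (le_trans h1 h3) /= (le_trans h4)//.
  move: h2; rewrite inE; case: (eqVneq k i) => [->|_] /=.
    by rewrite nis addr0 => h2; exact: lerD.
  by rewrite addr0.
rewrite size_enum_ord => w; apply: runs_within_le w (leqnn _) _ => M' [_ diag upper].
by split=> [k|k l kl]; [rewrite diag|have := upper _ _ kl].
Qed.

End SampleRound.

From mathcomp Require Import all_classical all_reals all_analysis.
From mathcomp Require Import measurable_realfun.
From mathcomp Require Import (canonicals) mpoly.
Import numFieldTopology.Exports numFieldNormedType.Exports.
Local Open Scope classical_set_scope.
Local Open Scope ring_scope.

(** * Moments of independent standard normal variables *)

Section Density.
Local Open Scope ereal_scope.
Import HBNNSimple.

(** If the law of [X] under the weight [g] is [c] times [nu] on measurable sets, the same holds for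
    integrals of nonnegative functions: simple functions by linearity, then monotone convergence. In
    the proof of independence [g] collects the other factors; for the normal law it is the
    density. *)
Lemma ge0_integral_density d d' (T : measurableType d) (T' : measurableType d')
    (R : realType) (mu : {measure set T -> \bar R})
    (nu : {measure set T' -> \bar R}) (c : R) (X : T -> T') (g : T -> R)
    (f : T' -> R) :
  measurable_fun setT X -> measurable_fun setT g -> (forall x, 0 <= g x)%R ->
  (0 <= c)%R ->
  (forall B, measurable B ->
     \int[mu]_x (\1_B (X x) * g x)%:E = c%:E * nu B) ->
  measurable_fun setT f -> (forall y, 0 <= f y)%R ->
  \int[mu]_x (f (X x) * g x)%:E = c%:E * \int[nu]_y (f y)%:E.
Proof.
move=> mX mg g0 c0 hnu mf f0.
have mfe : measurable_fun [set: T'] (EFin \o f) by exact/measurable_EFinP.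
pose f_ := nnsfun_approx measurableT mfe.
have cvgf y : (fun n => (f_ n y)%:E) @ \oo --> (f y)%:E.
  by apply: (cvg_nnsfun_approx measurableT mfe) => // z _; rewrite lee_fin.
transitivity (limn (fun n => \int[mu]_x (f_ n (X x) * g x)%:E)).
  rewrite -monotone_convergence//.
  - apply: eq_integral => x _; apply/esym/cvg_lim => //.
    under eq_fun do rewrite EFinM.
    rewrite EFinM; apply: cvgeZr => //; exact: cvgf.
  - move=> n; apply/measurable_EFinP/measurable_funM => //.
    exact/measurableT_comp.
  - by move=> n x _; rewrite lee_fin mulr_ge0.
  - move=> x _ m n mn; rewrite lee_fin ler_wpM2r//.
    exact/lefP/nd_nnsfun_approx.
have -> : \int[nu]_y (f y)%:E = limn (fun n => \int[nu]_y (f_ n y)%:E).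
  rewrite -monotone_convergence//.
  - by apply: eq_integral => x _; apply/esym/cvg_lim => //; exact: cvgf.
  - by move=> n; exact/measurable_EFinP.
  - by move=> n x _; rewrite lee_fin.
  - by move=> x _ m n mn; rewrite lee_fin; exact/lefP/nd_nnsfun_approx.
rewrite -limeMl//; last first.
  apply: ereal_nondecreasing_is_cvgn => m n mn; apply: ge0_le_integral => //.
  - by move=> x _; rewrite lee_fin.
  - exact/measurable_EFinP.
  - exact/measurable_EFinP.
  - by move=> x _; rewrite lee_fin; exact/lefP/nd_nnsfun_approx.
congr (limn _); apply/funext => n.
transitivity (\int[mu]_x (\sum_(k \in range (f_ n))
    ((k * \1_(f_ n @^-1` [set k]) (X x))%:E * (g x)%:E))).
  apply: eq_integral => x _; rewrite [f_ n (X x)]fimfunE EFinM -fsumEFin//.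
  by rewrite ge0_mule_fsuml// => k; rewrite nnfun_muleindic_ge0.
have mfX k : measurable (X @^-1` (f_ n @^-1` [set k])).
  rewrite -(setTI (_ @^-1` _)); exact: mX.
rewrite ge0_integral_fsum//; last 2 first.
- move=> k; under eq_fun do rewrite -EFinM.
  apply/measurable_EFinP/measurable_funM => //.
  apply/measurable_funM => //.
  rewrite (_ : (fun x => _) = (\1_(X @^-1` (f_ n @^-1` [set k])) : _ -> R))//.
- by move=> k x _; apply: mule_ge0; rewrite ?nnfun_muleindic_ge0// lee_fin.
under [in RHS]eq_integral do rewrite fimfunE -fsumEFin//.
rewrite ge0_integral_fsum//; last 2 first.
- by move=> y; exact/measurable_EFinP/measurable_funM.
- by move=> y x _; rewrite nnfun_muleindic_ge0.
rewrite ge0_mule_fsumr; last first.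
  by move=> k; apply: integral_ge0 => x _; rewrite nnfun_muleindic_ge0.
apply: eq_fsbigr => k _.
rewrite integralZl_indic_nnsfun// integral_indic//= setIT.
have [k0|k0] := ltP k 0%R.
  rewrite preimage_nnfun0// measure0 !mule0.
  by apply: integral0_eq => x _; rewrite indic0 mulr0 mul0e.
rewrite muleCA -hnu//.
rewrite -ge0_integralZl_EFin//.
- by apply: eq_integral => x _; rewrite -!EFinM mulrA.
- by move=> x _; rewrite lee_fin mulr_ge0.
- apply/measurable_EFinP/measurable_funM => //.
  rewrite (_ : (fun x => _) = (\1_(X @^-1` (f_ n @^-1` [set k])) : _ -> R))//.
Qed.

End Density.

(** * Integrals of products of independent variables *)

Section Independence.
Context (R : realType) (d : measure_display) (Omega : measurableType d).
Context (P : probability Omega R) (I : finType) (X : I -> {RV P >-> R}).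
Hypothesis indep : mutually_independent X.

Let integral_indic_preimage i (B : set R) : measurable B ->
  (\int[P]_w (\1_B (X i w))%:E = P (X i @^-1` B))%E.
Proof.
move=> mB; transitivity (\int[P]_w (\1_(X i @^-1` B) w)%:E)%E => //.
rewrite integral_indic ?setIT// -(setTI (_ @^-1` _)); exact: measurable_funPT.
Qed.

(** Induction on the number of factors outside which all are indicators. With none left, this is the
    definition of independence. Otherwise one factor is singled out, the others serve as a weight,
    and it suffices to know the weighted law on indicators, where the induction hypothesis
    applies. *)
Lemma independent_integral_prod_indic (f : I -> R -> R) (e : I -> R) (A : {set I}) :
  (forall i, measurable_fun setT (f i)) -> (forall i y, 0 <= f i y) ->
  (forall i, (\int[P]_w (f i (X i w))%:E = (e i)%:E)%E) ->
  (forall i, i \notin A -> exists2 B : set R, measurable B & f i = \1_B) ->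
  (\int[P]_w (\prod_i f i (X i w))%:E = (\prod_i e i)%:E)%E.
Proof.
elim: {A}#|A| {-2}A (erefl #|A|) f e => [|n IHn] A cardA f e mf f0 fe fA.
  have {}fA i : exists B : set R, measurable B /\ f i = \1_B.
    have [|B mB fB] := fA i; last by exists B.
    by rewrite (cards0_eq cardA) inE.
  have [B {}fA] := choice fA.
  have mB i : measurable (B i) by case: (fA i).
  have fE i : f i = \1_(B i) by case: (fA i).
  have := indep [set: I]%SET mB.
  have mXB i : measurable (X i @^-1` B i).
    by rewrite -(setTI (_ @^-1` _)); exact: measurable_funPT.
  set S := \bigcap_(i in _) _ => PS.
  have mS : measurable S by apply: fin_bigcap_measurable.
  have -> : (fun w => (\prod_i f i (X i w))%:E) = (fun w => (\1_S w)%:E).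
    apply/funext => w /=; congr EFin; rewrite indicE.
    case: (boolP (w \in S)) => wS.
      rewrite big1// => i _; rewrite fE indicE mem_set//.
      by move: wS; rewrite inE => /(_ i); apply; rewrite /= inE.
    have [i Hi] : exists i, ~ B i (X i w).
      apply/existsNP => H; move/negP: wS; apply; rewrite inE => i _; exact: H.
    by rewrite (bigD1 i)//= fE indicE memNset// mul0r.
  transitivity (P S); first by rewrite integral_indic// setIT.
  rewrite PS.
  transitivity (\prod_i P (X i @^-1` B i))%E.
    by apply: eq_bigl => i; rewrite finset.in_setT.
  rewrite -prodEFin; apply: eq_bigr => i _.
  by rewrite -fe fE integral_indic_preimage.
have [a aA] : exists a, a \in A by apply/set0Pn; rewrite -card_gt0 cardA.
have e0 i : 0 <= e i.
  by rewrite -lee_fin -fe; apply: integral_ge0 => w _; rewrite lee_fin.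
rewrite (bigD1 a)//= mulrC EFinM -fe.
under eq_integral do rewrite (bigD1 a)//=.
rewrite -(ge0_integral_distribution (X a)
  (f := fun y => (f a y)%:E)); [|exact/measurable_EFinP|
  by move=> y; rewrite lee_fin].
apply: (@ge0_integral_density _ _ _ _ _ _ _ _ _
  (fun w => \prod_(i | i != a) f i (X i w))) => //.
- under eq_fun do rewrite big_mkcond/=.
  apply: (measurable_prod (h := fun i w => if i != a then f i (X i w) else 1)).
  move=> i _; case: (i != a) => //.
  exact: measurableT_comp.
- by move=> w; apply: prodr_ge0 => i _.
- by apply: prodr_ge0 => i _.
move=> B mB.
have mXB : measurable (X a @^-1` B).
  by rewrite -(setTI (_ @^-1` _)); exact: measurable_funPT.
have PB : (P (X a @^-1` B) = (fine (P (X a @^-1` B)))%:E)%E.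
  by rewrite fineK// fin_num_measure.
(* Factor [a] is replaced by [\1_B], so the set of general factors loses [a]. *)
have := IHn (A :\ a)%SET _ (fun i => if i == a then \1_B else f i)
   (fun i => if i == a then fine (P (X a @^-1` B)) else e i).
rewrite (bigD1 a)//= eqxx mulrC EFinM -PB.
rewrite (eq_bigr e); last by move=> i /negbTE ->.
move <-.
- apply: eq_integral => w _; rewrite [in RHS](bigD1 a)//= eqxx.
  by congr (_ * _)%:E; apply: eq_bigr => i /negbTE ->.
- by move: cardA; rewrite (cardsD1 a) aA => -[].
- by move=> i; case: ifP => // _; exact: measurable_indic.
- by move=> i y; case: ifP => // _; rewrite indicE.
- move=> i; case: eqP => [->|_]; last exact: fe.
  by rewrite -PB integral_indic_preimage.
- move=> i; rewrite !inE negb_and negbK; case: eqP => [_ _|_ /= iA].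
    by exists B.
  exact: fA.
Qed.

(** Each factor is split into positive and negative parts; the product expands into a signed sum
    over choices of parts, to which the nonnegative case applies. *)
Lemma independent_integral_prod (g : I -> R -> R) :
  (forall i, measurable_fun setT (g i)) ->
  (forall i, P.-integrable setT (fun w => (g i (X i w))%:E)) ->
  P.-integrable setT (fun w => (\prod_i g i (X i w))%:E) /\
  (\int[P]_w (\prod_i g i (X i w))%:E =
   (\prod_i fine (\int[P]_w (g i (X i w))%:E))%:E)%E.
Proof.
move=> mg ig.
pose h i (b : bool) y := if b then (g i)^\+ y else (g i)^\- y.
have h0 i b y : 0 <= h i b y.
  by case: b; rewrite /h ?funrpos_ge0 ?funrneg_ge0.
pose sgb (b : bool) : R := if b then 1 else -1.
have gE i y : g i y = \sum_(b : bool) sgb b * h i b y.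
  rewrite big_bool/= mul1r mulN1r.
  by rewrite -[in LHS](funrposBneg (g i)).
have mh i b : measurable_fun setT (h i b).
  by case: b; [exact: measurable_funrpos|exact: measurable_funrneg].
have ih i b : P.-integrable setT (fun w => (h i b (X i w))%:E).
  by case: b; [exact: (integrable_funrpos _ (ig i))|
               exact: (integrable_funrneg _ (ig i))].
pose e i b := fine (\int[P]_w (h i b (X i w))%:E)%E.
have eE i b : (\int[P]_w (h i b (X i w))%:E = (e i b)%:E)%E.
  by rewrite fineK// integrable_fin_num.
have egE i : fine (\int[P]_w (g i (X i w))%:E)%E = \sum_(b : bool) sgb b * e i b.
  have -> : (\int[P]_w (g i (X i w))%:E =
      \int[P]_w (\sum_(b : bool) (sgb b)%:E * (h i b (X i w))%:E))%E.
    by apply: eq_integral => w _; rewrite gE -sumEFin.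
  rewrite integral_sum//; last by move=> b; apply: integrableZl.
  under eq_bigr do rewrite integralZl// eE -EFinM.
  by rewrite sumEFin.
have prodE (s : {ffun I -> bool}) :
    (\int[P]_w (\prod_i h i (s i) (X i w))%:E = (\prod_i e i (s i))%:E)%E.
  apply: (@independent_integral_prod_indic (fun i => h i (s i))
    (fun i => e i (s i)) [set: I]%SET) => //.
  by move=> i; rewrite finset.in_setT.
pose sg (s : {ffun I -> bool}) : R := \prod_i sgb (s i).
have expand w : (\prod_i g i (X i w))%:E =
    (\sum_(s : {ffun I -> bool}) (sg s)%:E * (\prod_i h i (s i) (X i w))%:E)%E.
  under eq_bigr do rewrite gE.
  rewrite bigA_distr_bigA/= -sumEFin; apply: eq_bigr => s _.
  by rewrite big_split/= EFinM.
have iprod (s : {ffun I -> bool}) :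
    P.-integrable setT (fun w => (\prod_i h i (s i) (X i w))%:E).
  apply/integrableP; split.
    apply/measurable_EFinP.
    apply: (measurable_prod (h := fun i w => h i (s i) (X i w))) => i _.
    exact: measurableT_comp.
  under eq_integral do rewrite /= ger0_norm ?prodr_ge0//.
  by rewrite prodE ltry.
have expandf : (fun w => (\prod_i g i (X i w))%:E) = (fun w =>
    \sum_(s : {ffun I -> bool}) (sg s)%:E * (\prod_i h i (s i) (X i w))%:E)%E.
  exact/funext.
rewrite expandf; split.
  by apply: integrable_sum => // s _; exact: integrableZl.
rewrite integral_sum//; last by move=> s; exact: integrableZl.
transitivity (\sum_s ((sg s * \prod_i e i (s i))%:E))%E.
  by apply: eq_bigr => s _; rewrite integralZl// prodE EFinM.
rewrite sumEFin; congr EFin.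
under [RHS]eq_bigr do rewrite egE.
by rewrite bigA_distr_bigA/=; apply: eq_bigr => s _; rewrite big_split.
Qed.

End Independence.

(** * First and second moments of the standard normal law *)

Section StandardNormalMoments.
Context (R : realType).
Local Notation mu := (@lebesgue_measure R).
Local Notation phi := (normal_pdf (0 : R) 1).

Let phiE : phi = fun x => normal_peak 1 * expR (- (x ^+ 2 / 2)).
Proof.
apply/funext => x; rewrite normal_pdfE ?oner_neq0//; congr (_ * expR _).
by rewrite subr0 mulNr expr1n -mulr_natr mul1r.
Qed.

Let is_derive_phi (x : R) : is_derive x 1 phi (- x * phi x).
Proof.
rewrite phiE; apply: is_derive_eq.
rewrite !scaler0 add0r /GRing.scale/=; by field.
Qed.

(** The antiderivative behind the integration by parts: it compares the integral of [x ^+ 2 * phi x]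
    with that of [phi x], up to boundary values. *)
Lemma is_derive_mul_normal_pdf (x : R) :
  is_derive x 1 (fun x => x * phi x) ((1 - x ^+ 2) * phi x).
Proof.
have dphi := is_derive_phi x; apply: is_derive_eq.
rewrite /GRing.scale/=; ring.
Qed.

(** From [expR (x ^+ 2 / 2) >= x ^+ 2 / 2] one gets [x * phi x <= 2 * normal_peak 1 / x] for
    positive [x]. *)
Lemma cvg_mul_normal_pdf : (x * phi x) @[x --> +oo%R] --> (0 : R).
Proof.
apply: (@squeeze_cvgr _ _ _ _ (fun=> 0) (fun x => (normal_peak 1 * 2) * x^-1)).
- near=> x.
  have x0 : 0 < x by [].
  rewrite phiE; apply/andP; split.
    by rewrite mulr_ge0 ?mulr_ge0 ?normal_peak_ge0 ?expR_ge0// ltW.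
  rewrite mulrCA -mulrA ler_wpM2l ?normal_peak_ge0// ler_pdivlMr//.
  rewrite mulrAC expRN ler_pdivrMr ?expR_gt0//.
  have := expR_ge1Dx (x ^+ 2 / 2).
  by rewrite expr2; lra.
- exact: cvg_cst.
- rewrite -(mulr0 (normal_peak 1 * 2)); apply: cvgM; first exact: cvg_cst.
  apply/cvgrVy; first by near=> x; rewrite invr_gt0.
  rewrite (_ : unstable.inv_fun _ = id); last by apply/funext => x /=; rewrite invrK.
  exact: cvg_id.
Unshelve. all: by end_near. Qed.

Let mphi : measurable_fun setT phi. Proof. exact: measurable_normal_pdf. Qed.

Let cphi : continuous phi. Proof. exact: continuous_normal_pdf. Qed.

Let phi_ge0 x : 0 <= phi x. Proof. exact: normal_pdf_ge0. Qed.

Let mx2phi : measurable_fun setT (fun x : R => x ^+ 2 * phi x).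
Proof. by apply: measurable_funM => //; exact: exprn_measurable. Qed.

Let csqr : continuous (fun x : R => x ^+ 2).
Proof. exact: exprn_continuous. Qed.

Let cxphi : continuous (fun x : R => x * phi x).
Proof. by move=> x; apply: continuousM => //; exact: cphi. Qed.

Let cderiv : continuous (fun x : R => (1 - x ^+ 2) * phi x).
Proof.
move=> x; apply: cvgM; last exact: cphi.
by apply: cvgB; [exact: cst_continuous|exact: csqr].
Qed.

Let cx2phi : continuous (fun x : R => x ^+ 2 * phi x).
Proof. by move=> x; apply: cvgM; [exact: csqr|exact: cphi]. Qed.

Local Open Scope ereal_scope.

(** The half-line is cut at 1, where [1 - x ^+ 2] changes sign, so that on either side only
    integrals of nonnegative functions occur. *)
Let integral_itv01 :
  \int[mu]_(x in `[0%R, 1%R]) (x ^+ 2 * phi x)%:E + (phi 1)%:E =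
  \int[mu]_(x in `[0%R, 1%R]) (phi x)%:E.
Proof.
have <- : \int[mu]_(x in `[0%R, 1%R]) ((1 - x ^+ 2) * phi x)%:E = (phi 1)%:E.
  rewrite (@continuous_FTC2 _ _ (fun x => x * phi x)%R)//.
  - by rewrite mul1r mul0r sube0.
  - exact: (continuous_subspaceT cderiv).
  - split.
    + by move=> x _; case: (is_derive_mul_normal_pdf x).
    + exact/cvg_at_right_filter/cxphi.
    + exact/cvg_at_left_filter/cxphi.
  - move=> x _; have dx := is_derive_mul_normal_pdf x.
    by rewrite derive1E; case: dx.
rewrite -ge0_integralD//=.
- by apply: eq_integral => x _; rewrite -EFinD; congr EFin; ring.
- by move=> x _; rewrite lee_fin mulr_ge0// sqr_ge0.
- exact/measurable_funTS/measurable_EFinP.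
- move=> x; rewrite /= in_itv/= => /andP[x0 x1].
  by rewrite lee_fin mulr_ge0// subr_ge0 exprn_ile1.
- apply/measurable_funTS/measurable_EFinP/measurable_funM => //.
  by apply: measurable_funB => //; exact: exprn_measurable.
Qed.

Let integral_itv1y :
  \int[mu]_(x in `[1%R, +oo[) (x ^+ 2 * phi x)%:E =
  (phi 1)%:E + \int[mu]_(x in `[1%R, +oo[) (phi x)%:E.
Proof.
have <- : \int[mu]_(x in `[1%R, +oo[) ((x ^+ 2 - 1) * phi x)%:E = (phi 1)%:E.
  rewrite (@ge0_continuous_FTC2y _ _ (fun x => - (x * phi x))%R _ 0%R)//.
  - by rewrite -EFinB mul1r sub0r opprK.
  - by move=> x x1; rewrite mulr_ge0// subr_ge0 exprn_ege1.
  - apply: continuous_subspaceT.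
    rewrite (_ : (fun x => _) = (fun x : R => - ((1 - x ^+ 2) * phi x))%R).
      by move=> x; apply: cvgN; exact: cderiv.
    by apply/funext => x; ring.
  - have := cvgN cvg_mul_normal_pdf.
    by rewrite oppr0; apply; exact: proper_pinfty_nbhs.
  - by move=> x _; apply: derivableN; case: (is_derive_mul_normal_pdf x).
  - by apply: cvgN; exact/cvg_at_right_filter/cxphi.
  - move=> x _; have dx := is_derive_mul_normal_pdf x.
    rewrite derive1E deriveN; last by case: dx.
    by rewrite derive_val; ring.
rewrite -ge0_integralD//=.
- by apply: eq_integral => x _; rewrite -EFinD; congr EFin; ring.
- move=> x; rewrite /= in_itv/= andbT => x1.
  by rewrite lee_fin mulr_ge0// subr_ge0 exprn_ege1.
- apply/measurable_funTS/measurable_EFinP/measurable_funM => //.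
  by apply: measurable_funB => //; exact: exprn_measurable.
- by move=> x _; rewrite lee_fin.
- exact/measurable_funTS/measurable_EFinP.
Qed.

(** Evenness reduces to the half-line, where the boundary value [phi 1] is added on the left of the
    cut and subtracted on the right, and cancels. *)
Lemma integral_sqr_normal_pdf : \int[mu]_x (x ^+ 2 * phi x)%:E = 1.
Proof.
have split01 (f : R -> R) : measurable_fun setT f -> (forall x, 0 <= f x)%R ->
    \int[mu]_(x in [set x | (0 <= x)%R]) (f x)%:E =
    \int[mu]_(x in `[0%R, 1%R]) (f x)%:E + \int[mu]_(x in `[1%R, +oo[) (f x)%:E.
  move=> mf f0; rewrite -[X in _ + X]integral_itv_obnd_cbnd; last first.
    exact/measurable_funTS/measurable_EFinP.
  rewrite -ge0_integral_setU//=.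
  - by rewrite -set_itvcy -itv_bndbnd_setU//= bnd_simp.
  - exact/measurable_funTS/measurable_EFinP.
  - by move=> x _; rewrite lee_fin.
  - rewrite disj_set2E; apply/eqP; rewrite -subset0 => x [] /=.
    by rewrite !in_itv/= andbT => /andP[_ x1]; rewrite ltNge x1.
rewrite ge0_symfun_integralT; last 3 first.
- by move=> x; rewrite mulr_ge0// sqr_ge0.
- exact: cx2phi.
- by move=> x /=; rewrite phiE sqrrN.
rewrite split01//; last by move=> x; rewrite mulr_ge0// sqr_ge0.
rewrite integral_itv1y addeA integral_itv01 -split01// -ge0_symfun_integralT//.
  exact: integral_normal_pdf.
by move=> x /=; rewrite phiE sqrrN.
Qed.

End StandardNormalMoments.

Section StandardNormalRV.
Context (R : realType) (d : measure_display) (Omega : measurableType d).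
Context (P : probability Omega R) (X : {RV P >-> R}).
Hypothesis normalX : forall B : set R, measurable B ->
  distribution P X B = normal_prob 0 1 B.
Local Notation mu := (@lebesgue_measure R).
Local Notation phi := (normal_pdf (0 : R) 1).
Local Open Scope ereal_scope.

Lemma ge0_integral_standard_normal (f : R -> R) :
  measurable_fun setT f -> (forall y, 0 <= f y)%R ->
  \int[P]_w (f (X w))%:E = \int[mu]_x (f x * phi x)%:E.
Proof.
move=> mf f0.
rewrite -[LHS]mul1e -(ge0_integral_distribution X (f := fun y => (f y)%:E)).
- apply/esym/(@ge0_integral_density _ _ (measurableTypeR R) _ _ mu
    (distribution P X) 1%R id phi f) => //.
  + exact: measurable_normal_pdf.
  + by move=> x; exact: normal_pdf_ge0.
  + move=> B mB; rewrite mul1e.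
    transitivity (normal_prob 0 1 B); last exact/esym/normalX.
    rewrite /normal_prob [RHS]integral_mkcond.
    apply: eq_integral => x _; rewrite patchE indicE.
    by case: ifP => _; rewrite ?mul1r ?mul0r.
- exact/measurable_EFinP.
- by move=> y; rewrite lee_fin.
Qed.

Lemma integral_sqr_standard_normal : \int[P]_w (X w ^+ 2)%:E = 1.
Proof.
rewrite (@ge0_integral_standard_normal (fun x => x ^+ 2)%R).
- exact: integral_sqr_normal_pdf.
- exact: exprn_measurable.
- by move=> y; exact: sqr_ge0.
Qed.

Lemma integrable_sqr_standard_normal :
  P.-integrable setT (fun w => (X w ^+ 2)%:E).
Proof.
apply/integrableP; split; first exact/measurable_EFinP/measurable_funX.
under eq_integral do rewrite /= ger0_norm ?sqr_ge0//.
by rewrite integral_sqr_standard_normal ltry.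
Qed.

Lemma integrable_standard_normal : P.-integrable setT (fun w => (X w)%:E).
Proof.
have i1 : P.-integrable setT (fun w => 1 + (X w ^+ 2)%:E).
  apply: integrableD => //; last exact: integrable_sqr_standard_normal.
  exact: (finite_measure_integrable_cst P 1%R measurableT).
apply: (le_integrable _ _ _ i1) => //; first exact/measurable_EFinP.
move=> w _ /=; rewrite lee_fin [leRHS]ger0_norm ?addr_ge0 ?sqr_ge0//.
rewrite -(real_normK (num_real (X w))).
have h1 := sqr_ge0 (`|X w| - 1)%R; have h2 := sqr_ge0 (`|X w|)%R; nra.
Qed.

(** The positive and negative parts have the same integral, since the density is even and Lebesgue
    measure is invariant under negation. *)
Lemma integral_standard_normal : \int[P]_w (X w)%:E = 0.
Proof.
rewrite integralE.
have -> : \int[P]_w (fun w => (X w)%:E)^\- w = \int[P]_w (Num.max (- X w) 0)%:E.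
  by apply: eq_integral => w _; rewrite funenegE EFin_max EFinN.
have -> : \int[P]_w (fun w => (X w)%:E)^\+ w = \int[P]_w (Num.max (X w) 0)%:E.
  by apply: eq_integral => w _; rewrite funeposE EFin_max.
have fin : \int[P]_w (Num.max (X w) 0)%:E \is a fin_num.
  have := integrable_funrpos measurableT integrable_standard_normal.
  exact: integrable_fin_num.
suff -> : \int[P]_w (Num.max (- X w) 0)%:E = \int[P]_w (Num.max (X w) 0)%:E.
  by rewrite subee.
have mpos : measurable_fun [set: R] (fun x => Num.max x 0)%R.
  exact: measurable_maxr.
have mneg : measurable_fun [set: R] (fun x => Num.max (- x) 0)%R.
  by apply: measurable_maxr => //; exact: measurable_funN.
rewrite (@ge0_integral_standard_normal (fun x => Num.max (- x) 0)%R)//; last first.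
  by move=> y; rewrite le_max lexx orbT.
rewrite (@ge0_integral_standard_normal (fun x => Num.max x 0)%R)//; last first.
  by move=> y; rewrite le_max lexx orbT.
pose f (x : R) := (Num.max x 0 * phi x)%:E.
transitivity (\int[mu]_x (f \o -%R) x).
  apply: eq_integral => x _; rewrite /f /= !normal_pdfE ?oner_neq0//.
  by rewrite /normal_fun !subr0 sqrrN.
transitivity (\int[pushforward mu (-%R : _ -> measurableTypeR R)]_x f x).
  rewrite ge0_integral_pushforward ?preimage_setT//.
    apply/measurable_EFinP/measurable_funM => //; exact: measurable_normal_pdf.
  by move=> x _; rewrite lee_fin mulr_ge0 ?normal_pdf_ge0// le_max lexx orbT.
by apply: eq_measure_integral => B mB _; exact: lebesgue_measureN.
Qed.

End StandardNormalRV.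

(** * Orthonormality of the pairing monomials *)

Section GaussianMonomials.
Context (R : realType) (d : measure_display) (Omega : measurableType d).
Context (P : probability Omega R) (n : nat).
Variable Sigma : 'I_n -> 'I_n -> {RV P >-> R}.
Hypothesis HSigma : symmetric_gaussian Sigma.
Implicit Types p q : pairing n.
Local Notation upair := {ij : 'I_n * 'I_n | (ij.1 < ij.2)%N}.

Let edge (k : upair) : {set 'I_n} := [set (val k).1; (val k).2]%SET.

Let edge_surj (e : {set 'I_n}) : #|e| == 2%N -> exists k, e = edge k.
Proof.
case/cards2P => i [j] [ij ->].
have [ltij|ltji|/val_inj eqij] := ltngtP i j; last by rewrite eqij eqxx in ij.
- by exists (exist _ (i, j) ltij).
- by exists (exist _ (j, i) ltji); rewrite /edge finset.setUC.
Qed.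

Let at_X_pairing p w : at_Sigma Sigma (@X_pairing R n p) w =
  \prod_(k : upair) (Sigma (val k).1 (val k).2 w) ^+ (edge k \in p).
Proof.
rewrite /at_Sigma /X_pairing big_mkcondr/=.
transitivity (\prod_(ij : 'I_n * 'I_n | (ij.1 < ij.2)%N)
    (Sigma ij.1 ij.2 w) ^+ ([set ij.1; ij.2]%SET \in p)).
  by apply: eq_bigr => ij _; rewrite mxE; case: ifP.
by rewrite -(big_sub (fun ij : 'I_n * 'I_n => ij.1 < ij.2)%N
  (fun ij => (Sigma ij.1 ij.2 w) ^+ ([set ij.1; ij.2]%SET \in p))).
Qed.

(** Weaker than being a pairing of the whole index set: the empty set qualifies and has monomial 1.
    The mean of a monomial is thus also a moment of two monomials. *)
Let edges_only p := [forall e in p, #|e : {set 'I_n}| == 2%N].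

(** In the product every entry has exponent 0, 1 or 2, with moments 1, 0 and 1. An edge that belongs
    to exactly one of [p] and [q] annihilates the product. *)
Lemma integral_X_pairingM p q : edges_only p -> edges_only q ->
  P.-integrable setT (fun w => (at_Sigma Sigma (@X_pairing R n p) w *
                                at_Sigma Sigma (@X_pairing R n q) w)%:E) /\
  (\int[P]_w (at_Sigma Sigma (@X_pairing R n p) w *
              at_Sigma Sigma (@X_pairing R n q) w)%:E = (p == q)%:R%:E)%E.
Proof.
move=> p2 q2; case: HSigma => _ normS indS.
pose a (k : upair) : nat := ((edge k \in p) + (edge k \in q))%N.
pose g (k : upair) (y : R) := y ^+ a k.
pose X (k : upair) := Sigma (val k).1 (val k).2.
have prodE : (fun w => (at_Sigma Sigma (@X_pairing R n p) w *
      at_Sigma Sigma (@X_pairing R n q) w)%:E) =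
    (fun w => (\prod_k g k (X k w))%:E).
  apply/funext => w; congr EFin; rewrite !at_X_pairing -big_split/=.
  by apply: eq_bigr => k _; rewrite /g exprD.
have nX k : forall B, measurable B -> distribution P (X k) B = normal_prob 0 1 B.
  by apply: normS; exact: (valP k).
have moment k : P.-integrable setT (fun w => (g k (X k w))%:E) /\
    (\int[P]_w (g k (X k w))%:E = ((edge k \in p) == (edge k \in q))%:R%:E)%E.
  rewrite /g /a; case: (edge k \in p); case: (edge k \in q) => /=.
  - split; first exact: (integrable_sqr_standard_normal (nX k)).
    exact: (integral_sqr_standard_normal (nX k)).
  - split; first exact: (integrable_standard_normal (nX k)).
    exact: (integral_standard_normal (nX k)).
  - split; first exact: (integrable_standard_normal (nX k)).
    exact: (integral_standard_normal (nX k)).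
  - split; first exact: (finite_measure_integrable_cst P 1%R measurableT).
    transitivity (\int[P]_w (cst 1%E w))%E => //.
    by rewrite integral_cst// mul1e; exact: probability_setT.
rewrite prodE; have [iprod ->] := @independent_integral_prod _ _ _ P _ X indS g
  (fun k => exprn_measurable _) (fun k => (moment k).1).
split => //; congr EFin.
under eq_bigr do rewrite (moment _).2.
case: eqP => [<-|neq] /=; first by rewrite big1// => k _; rewrite eqxx.
have [k Hk] : exists k, (edge k \in p) != (edge k \in q).
  apply/existsP; apply: contra_notT neq; rewrite negb_exists => /forallP eqpq.
  apply/setP => e; case: (boolP (#|e| == 2%N)) => [/edge_surj[k ->]|e2].
    by have := eqpq k; rewrite negbK => /eqP.
  have /negbTE -> : e \notin p.
    by apply: contra e2 => ep; move/forall_inP: p2; apply.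
  have /negbTE -> // : e \notin q.
  by apply: contra e2 => eq; move/forall_inP: q2; apply.
by rewrite (bigD1 k)//= (negbTE Hk) mul0r.
Qed.

End GaussianMonomials.

(** The hafnian, all [X_ps] over the whole index set and the estimator have this shape; expectations
    of products become dot products of coefficient vectors. *)
Definition pairing_form (R : realType) n (c : pairing n -> R) : mxfun R n :=
  fun A => \sum_(p in pairings [set: 'I_n]%SET) c p * X_pairing p A.

Section GaussianForms.
Context (R : realType) (d : measure_display) (Omega : measurableType d).
Context (P : probability Omega R) (n : nat).
Variable Sigma : 'I_n -> 'I_n -> {RV P >-> R}.
Hypothesis HSigma : symmetric_gaussian Sigma.
Implicit Types c x y : pairing n -> R.
Local Notation PP := (pairings [set: 'I_n]%SET).

Let pairing_edges p : p \in PP -> [forall e in p, #|e : {set 'I_n}| == 2%N].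
Proof. by rewrite finset.inE => /andP[]. Qed.

Lemma expectation_pairing_formM x y :
  ('E_P[at_Sigma Sigma (fun A => (pairing_form x A * pairing_form y A)%R)] =
   (\sum_(p in PP) x p * y p)%R%:E)%E.
Proof.
rewrite unlock.
pose F (pq : pairing n * pairing n) w : \bar R := ((x pq.1 * y pq.2)%:E *
  (at_Sigma Sigma (@X_pairing R n pq.1) w *
   at_Sigma Sigma (@X_pairing R n pq.2) w)%:E)%E.
(* Exchanging sum and integral asks for integrability of all summands; those outside [PP] are set to
   zero. *)
pose F' pq := if (pq.1 \in PP) && (pq.2 \in PP) then F pq else cst 0%E.
have iF' pq : P.-integrable setT (F' pq).
  rewrite /F'; case: ifP => [/andP[p1 p2]|_]; last exact: integrable0.
  apply: integrableZl => //.
  exact: (integral_X_pairingM HSigma (pairing_edges p1) (pairing_edges p2)).1.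
transitivity (\int[P]_w \sum_pq F' pq w)%E.
  apply: eq_integral => w _; rewrite /at_Sigma/pairing_form mulr_suml -sumEFin.
  under eq_bigr do rewrite mulr_sumr -sumEFin.
  rewrite pair_big/= big_mkcond; apply: eq_bigr => -[p q] _.
  rewrite /F' /=; case: ifP => _ //; rewrite /F/= -EFinM; congr EFin.
  by rewrite mulrACA.
rewrite integral_sum//.
rewrite -sumEFin [RHS]big_mkcond/=.
rewrite (eq_bigr (fun pq : pairing n * pairing n =>
  if (pq.1 \in PP) && (pq.2 \in PP) then (x pq.1 * y pq.2 * (pq.1 == pq.2)%:R)%:E
  else 0%E)); last first.
  move=> [p q] _; rewrite /F'/=; case: ifP => [/andP[p1 p2]|_].
    have [i e] := integral_X_pairingM HSigma (pairing_edges p1) (pairing_edges p2).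
    by rewrite /F integralZl// e -EFinM.
  by rewrite integral0.
rewrite -(pair_bigA _ (fun p q => if (p \in PP) && (q \in PP) then
    (x p * y q * (p == q)%:R)%:E else 0%E))/=.
apply: eq_bigr => p _.
rewrite (bigD1 p)//= andbb eqxx mulr1 big1 ?adde0; first by case: ifP.
by move=> q /negbTE; rewrite eq_sym => ->; rewrite mulr0; case: ifP.
Qed.

Lemma expectation_pairing_form x : (0 < n)%N ->
  ('E_P[at_Sigma Sigma (pairing_form x)] = 0)%E.
Proof.
move=> n0; rewrite unlock; pose e0 : pairing n := finset.set0.
pose F p w : \bar R := ((x p)%:E *
  (at_Sigma Sigma (@X_pairing R n p) w *
   at_Sigma Sigma (@X_pairing R n e0) w)%:E)%E.
have set0_edges : [forall e in e0, #|e : {set 'I_n}| == 2%N].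
  by apply/forall_inP => e; rewrite finset.in_set0.
have X0 A : @X_pairing R n e0 A = 1.
  by rewrite /X_pairing big_pred0// => ij; rewrite finset.in_set0 andbF.
pose F' p := if p \in PP then F p else cst 0%E.
have iF' p : P.-integrable setT (F' p).
  rewrite /F'; case: ifP => [p1|_]; last exact: integrable0.
  apply: integrableZl => //.
  exact: (integral_X_pairingM HSigma (pairing_edges p1) set0_edges).1.
transitivity (\int[P]_w \sum_p F' p w)%E.
  apply: eq_integral => w _; rewrite /at_Sigma/pairing_form big_mkcond -sumEFin.
  apply: eq_bigr => p _; rewrite /F'; case: ifP => // _.
  by rewrite /F /at_Sigma X0 mulr1 EFinM.
rewrite integral_sum// big1// => p _; rewrite /F'.
case: ifP => [p1|_]; last by rewrite integral0.
have [i e] := integral_X_pairingM HSigma (pairing_edges p1) set0_edges.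
rewrite /F integralZl// e; case: eqP => [p0|]; last by rewrite mule0.
(* The empty set covers nothing, hence is not a pairing of the nonempty index set. *)
move: p1; rewrite p0 finset.inE => /andP[/and3P[/eqP cov _ _] _].
have := finset.in_setT (Ordinal n0).
by rewrite -cov => /finset.bigcupP[f]; rewrite finset.in_set0.
Qed.

Lemma X_set_pairing_form (S : {set {set {set 'I_n}}}) : S \subset PP ->
  @X_set R n S = pairing_form (fun p => (p \in S)%:R).
Proof.
move=> /fintype.subsetP SP; apply/funext => A; rewrite /X_set /pairing_form.
rewrite big_mkcond [RHS]big_mkcond; apply: eq_bigr => p _.
by case: (boolP (p \in S)) => [/SP ->|_]; rewrite ?mul1r// mul0r if_same.
Qed.

Lemma haf_pairing_form : @haf R n = pairing_form (fun=> 1).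
Proof.
by apply/funext => A; apply: eq_bigr => p _; rewrite mul1r.
Qed.

Lemma accurate_pairing_form eps x c :
  (\sum_(p in PP) (1 - c p) * x p) ^+ 2 <=
    eps ^+ 2 * (\sum_(p in PP) x p ^+ 2) * (\sum_(p in PP) c p ^+ 2) ->
  accurate Sigma eps (pairing_form x) (pairing_form c).
Proof.
move=> le_eps; rewrite /accurate.
have -> : (fun A => (haf A - pairing_form c A) * pairing_form x A) =
    (fun A : 'M[R]_n => pairing_form (fun p => 1 - c p) A * pairing_form x A).
  apply/funext => A; congr (_ * _); rewrite haf_pairing_form /pairing_form -sumrB.
  by apply: eq_bigr => p _; rewrite mulrBl.
by rewrite !expectation_pairing_formM -!EFinM lee_fin.
Qed.

Lemma accurate_cst1 eps c : (0 < n)%N -> 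
  accurate Sigma eps (cst 1) (pairing_form c).
Proof.
move=> n0; rewrite /accurate.
have -> : (fun A => (haf A - pairing_form c A) * cst 1 A) =
    (pairing_form (fun p => 1 - c p) : mxfun R n).
  apply/funext => A; rewrite haf_pairing_form /pairing_form mulr1 -sumrB.
  by apply: eq_bigr => p _; rewrite mulrBl.
rewrite expectation_pairing_form// expe2 mule0.
by rewrite !mule_ge0 ?lee_fin ?sqr_ge0//; apply: expectation_ge0 => w; exact: sqr_ge0.
Qed.

Lemma correlation_pairing_form x y : (0 < n)%N ->
  correlation P (at_Sigma Sigma (pairing_form x)) (at_Sigma Sigma (pairing_form y)) =
  (\sum_(p in PP) x p * y p) /
  Num.sqrt ((\sum_(p in PP) x p ^+ 2) * (\sum_(p in PP) y p ^+ 2)).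
Proof.
move=> n0.
have cov z z' : covariance P (at_Sigma Sigma (pairing_form z))
    (at_Sigma Sigma (pairing_form z')) = (\sum_(p in PP) z p * z' p)%:E.
  rewrite covariance.unlock !expectation_pairing_form//= -expectation_pairing_formM.
  congr expectation; apply/funext => w.
  by rewrite -[LHS]/((at_Sigma Sigma (pairing_form z) w - 0) *
    (at_Sigma Sigma (pairing_form z') w - 0)) !subr0.
by rewrite /correlation /variance !cov.
Qed.

End GaussianForms.

(** * Least singular values and perturbation *)

Section EuclideanRows.
Context (R : realType) (m : nat).
Implicit Types (u v w : 'rV[R]_m) (A B : 'M[R]_m).

Definition dotr u v : R := \sum_i u 0 i * v 0 i.
Definition sqn v : R := dotr v v.
Definition frob2 A : R := \sum_i \sum_j A i j ^+ 2.

Lemma dotrC u v : dotr u v = dotr v u.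
Proof. by apply: eq_bigr => i _; rewrite mulrC. Qed.

Lemma dotrDl u v w : dotr (u + v) w = dotr u w + dotr v w.
Proof. by rewrite -big_split; apply: eq_bigr => i _; rewrite mxE mulrDl. Qed.

Lemma dotrZl a u v : dotr (a *: u) v = a * dotr u v.
Proof. by rewrite mulr_sumr; apply: eq_bigr => i _; rewrite mxE mulrA. Qed.

Lemma dotrDr u v w : dotr w (u + v) = dotr w u + dotr w v.
Proof. by rewrite dotrC dotrDl !(dotrC w). Qed.

Lemma dotrZr a u v : dotr v (a *: u) = a * dotr v u.
Proof. by rewrite dotrC dotrZl dotrC. Qed.

Lemma dotrE u v : dotr u v = (u *m v^T) 0 0.
Proof. by rewrite mxE; apply: eq_bigr => i _; rewrite mxE. Qed.

Lemma dotr_mull u v A : dotr (u *m A) v = dotr u (v *m A^T).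
Proof. by rewrite !dotrE trmx_mul trmxK mulmxA. Qed.

Lemma sqn_ge0 v : 0 <= sqn v.
Proof. by apply: sumr_ge0 => i _; rewrite -expr2 sqr_ge0. Qed.

Lemma sqn_eq0 v : sqn v = 0 -> v = 0.
Proof.
move=> /eqP; rewrite psumr_eq0; last by move=> i _; rewrite -expr2 sqr_ge0.
move=> /allP v0; apply/rowP => i; rewrite mxE; apply/eqP.
by have := v0 i; rewrite mem_index_enum -expr2 sqrf_eq0 => /(_ isT).
Qed.

Lemma sqn_gt0 v : v != 0 -> 0 < sqn v.
Proof.
by rewrite lt_def sqn_ge0 andbT; apply: contra_neq; exact: sqn_eq0.
Qed.

(** Cauchy-Schwarz, from the squared norm of [sqn v *: u - dotr u v *: v], which is a multiple of
    [sqn v]. *)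
Lemma dotr_sqr_le u v : dotr u v ^+ 2 <= sqn u * sqn v.
Proof.
have [->|v0] := eqVneq v 0.
  have -> : dotr u 0 = 0 by rewrite /dotr big1// => i _; rewrite mxE mulr0.
  by rewrite expr0n/= mulr_ge0 ?sqn_ge0.
have := sqn_ge0 (sqn v *: u + (- dotr u v) *: v).
rewrite /sqn !(dotrDl, dotrDr, dotrZl, dotrZr) -!/(sqn _) (dotrC v u) => h.
have vp := sqn_gt0 v0; rewrite -subr_ge0 -(pmulr_rge0 _ vp).
by apply: le_trans h _; rewrite le_eqVlt; apply/orP; left; apply/eqP; ring.
Qed.

Lemma sqn_mulmx_le v A : sqn (v *m A) <= sqn v * frob2 A.
Proof.
have -> : sqn v * frob2 A = \sum_j sqn v * sqn (\row_i A i j).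
  rewrite -mulr_sumr; congr (_ * _); rewrite /frob2 exchange_big/=.
  by apply: eq_bigr => j _; apply: eq_bigr => i _; rewrite mxE expr2.
apply: ler_sum => j _; rewrite -expr2 mxE.
have := dotr_sqr_le v (\row_i A i j); congr (_ ^+ 2 <= _).
by apply: eq_bigr => i _; rewrite mxE.
Qed.

End EuclideanRows.

(** * Rayleigh quotients and least singular values *)

Section Rayleigh.
Context (R : realType) (m : nat).
Implicit Types (u v w : 'rV[R]_m).

Let continuous_dotr (f g : 'rV[R]_m -> 'rV[R]_m) :
  (forall i, continuous (fun v => f v 0 i)) ->
  (forall i, continuous (fun v => g v 0 i)) ->
  continuous (fun v => dotr (f v) (g v)).
Proof.
move=> cf cg v; apply: (@cvg_big _ _ _ 0 xpredT add_continuous _ (nbhs v) _ _ _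
  (nbhs_filter v)) => i _.
by apply: cvgM; [exact: cf|exact: cg].
Qed.

Let continuous_row_mul (B : 'M[R]_m) i : continuous (fun v => (v *m B) 0 i).
Proof.
move=> v; under eq_fun do rewrite mxE.
apply: (@cvg_big _ _ _ 0 xpredT add_continuous _ (nbhs v) _ _ _
  (nbhs_filter v)) => k _.
apply: cvgM; last exact: cvg_cst.
exact: coord_continuous.
Qed.

(** The quadratic form attains its minimum on the compact unit sphere, and stationarity makes the
    minimizer an eigenvector. All that is used of spectral theory below is this least eigenvalue:
    for [A^T *m A] it gives the least singular value, for a positive semidefinite matrix its lower
    bound. *)
Lemma rayleigh_min (B : 'M[R]_m) : (0 < m)%N -> B^T = B ->
  exists mu v, [/\ v != 0, v *m B = mu *: v &
                   forall w, mu * sqn w <= dotr (w *m B) w].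
Proof.
move=> m0 symB.
pose q (w : 'rV[R]_m) : R := dotr (w *m B) w.
pose S : set 'rV[R]_m := [set w | sqn w = 1].
have cont_id i : continuous (fun v : 'rV[R]_m => v 0 i) by exact: coord_continuous.
have cq : continuous q by apply: continuous_dotr => // i; exact: continuous_row_mul.
have csqn : continuous (@sqn R m) by exact: (@continuous_dotr id id).
have compS : compact S.
  apply: (@subclosed_compact _ _ [set v : 'rV[R]_m | forall i, `[-1, 1]%classic (v ord0 i)]).
  - rewrite (_ : S = (@sqn R m) @^-1` [set 1]); last by [].
    by apply: closed_comp => [v _|]; [exact: csqn|exact: closed_eq].
  - exact: (@rV_compact R m (fun=> `[-1, 1]%classic)
      (fun=> @segment_compact R (-1) 1)).
  - move=> v; rewrite /S /= => v1 i; rewrite in_itv/= -ler_norml.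
    rewrite -(@ler_pXn2r _ 2)// ?nnegrE// expr1n -v1 real_normK ?num_real//.
    rewrite /sqn /dotr (bigD1 i)//= -expr2 lerDl.
    by apply: sumr_ge0 => j _; rewrite -expr2 sqr_ge0.
have S0 : S !=set0.
  exists (delta_mx 0 (Ordinal m0)); rewrite /S /= /sqn /dotr (bigD1 (Ordinal m0))//=.
  rewrite mxE !eqxx mulr1 big1 ?addr0// => i /negbTE i0.
  by rewrite mxE i0 andbF mul0r.
have [v vS vmin] := EVT_min_rV S0 compS (continuous_subspaceT cq).
move: vS; rewrite inE /S /= => v1.
pose mu := q v.
have qZ a w : q (a *: w) = a ^+ 2 * q w.
  by rewrite /q -scalemxAl dotrZl dotrZr mulrA expr2.
have mumin w : mu * sqn w <= q w.
  have [->|w0] := eqVneq w 0.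
    by rewrite /q mul0mx /sqn /dotr !big1 ?mulr0// => i _; rewrite mxE mul0r.
  have wp := sqn_gt0 w0.
  pose a := (Num.sqrt (sqn w))^-1.
  have a2 : a ^+ 2 * sqn w = 1.
    by rewrite exprVn sqr_sqrtr ?sqn_ge0// mulVf// gt_eqF.
  have := vmin (a *: w); rewrite inE /S /=.
  rewrite /sqn dotrZl dotrZr mulrA -expr2 a2 => /(_ erefl); rewrite qZ -/mu => h.
  have -> : q w = (a ^+ 2 * q w) * sqn w by rewrite mulrAC a2 mul1r.
  by rewrite ler_wpM2r ?sqn_ge0.
exists mu, v; split=> //.
  apply/eqP => v0; move: v1; rewrite v0 /sqn /dotr big1 => [/esym/eqP|i _].
    by rewrite oner_eq0.
  by rewrite mxE mul0r.
(* The quadratic polynomial in t below is nonnegative and vanishes at 0, so its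
   linear coefficient, which is the squared norm of u, is zero. *)
have [u uD] : exists u : 'rV[R]_m, u = v *m B - mu *: v by eexists.
have uE : dotr u (v *m B) - mu * dotr u v = sqn u.
  rewrite /sqn [in RHS](_ : dotr u u = dotr u (v *m B - mu *: v)); last by rewrite -uD.
  by rewrite dotrDr -[- (mu *: v)]scaleNr dotrZr mulNr.
pose c := q u - mu * sqn u.
have pos t : 0 <= t * (2 * sqn u + t * c).
  have := mumin (v + t *: u); rewrite -subr_ge0; congr (0 <= _).
  rewrite /q mulmxDl -scalemxAl /sqn !(dotrDl, dotrDr, dotrZl, dotrZr).
  rewrite -/(q v) -/(sqn v) v1 -/(q u) -/(sqn u) -/mu (dotrC v u).
  have -> : dotr (u *m B) v = dotr u (v *m B) by rewrite dotr_mull symB.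
  rewrite (dotrC (v *m B) u) /c -uE; ring.
suff /sqn_eq0 : sqn u = 0 by rewrite uD => /eqP; rewrite subr_eq0 => /eqP.
pose k := `|c| + 1.
have k0 : 0 < k by rewrite ltr_wpDl.
(* Since [k] exceeds [|c|], the value at this point is minus a square times the positive number
   [2 * k - c], which forces the square to vanish. *)
have := pos (- (sqn u / k)).
have ck : c <= k by rewrite (le_trans (ler_norm c))// lerDl.
have su := sqn_ge0 u.
have -> : - (sqn u / k) * (2 * sqn u + - (sqn u / k) * c) =
   - ((sqn u / k) ^+ 2 * (2 * k - c)) by field; rewrite gt_eqF.
rewrite oppr_ge0 pmulr_lle0; last by lra.
move=> h; have /eqP : (sqn u / k) ^+ 2 = 0 by apply/le_anti; rewrite h sqr_ge0.
by rewrite sqrf_eq0 mulf_eq0 invr_eq0 (gt_eqF k0) orbF => /eqP.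
Qed.

End Rayleigh.

Section SingularValues.
Context (R : realType) (m : nat).
Hypothesis m_gt0 : (0 < m)%N.
Implicit Types (u v w : 'rV[R]_m) (A B C : 'M[R]_m).

Definition nrm v : R := Num.sqrt (sqn v).

Lemma nrm_ge0 v : 0 <= nrm v. Proof. exact: sqrtr_ge0. Qed.

Lemma nrm_sqr v : nrm v ^+ 2 = sqn v.
Proof. by rewrite sqr_sqrtr// sqn_ge0. Qed.

Lemma nrm_le v r : 0 <= r -> (nrm v <= r) = (sqn v <= r ^+ 2).
Proof. by move=> r0; rewrite -nrm_sqr ler_pXn2r ?nnegrE ?nrm_ge0. Qed.

Lemma le_nrm v r : 0 <= r -> (r <= nrm v) = (r ^+ 2 <= sqn v).
Proof. by move=> r0; rewrite -nrm_sqr ler_pXn2r ?nnegrE ?nrm_ge0. Qed.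

Lemma nrm_gt0 v : v != 0 -> 0 < nrm v.
Proof. by move=> v0; rewrite sqrtr_gt0 sqn_gt0. Qed.

Lemma ler_norm_dotr u v : `|dotr u v| <= nrm u * nrm v.
Proof.
rewrite -(@ler_pXn2r _ 2)// ?nnegrE ?mulr_ge0 ?nrm_ge0//.
by rewrite exprMn !nrm_sqr real_normK ?num_real// dotr_sqr_le.
Qed.

Lemma ler_nrmD u v : nrm (u + v) <= nrm u + nrm v.
Proof.
rewrite nrm_le ?addr_ge0 ?nrm_ge0// sqrrD !nrm_sqr.
rewrite {1}/sqn dotrDl !dotrDr -!/(sqn _) (dotrC v u).
have := le_trans (ler_norm _) (ler_norm_dotr u v); lra.
Qed.

Lemma frob2_ge0 A : 0 <= frob2 A.
Proof. by apply: sumr_ge0 => i _; apply: sumr_ge0 => j _; exact: sqr_ge0. Qed.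

Lemma frob2_tr A : frob2 A^T = frob2 A.
Proof.
rewrite /frob2 exchange_big; apply: eq_bigr => i _; apply: eq_bigr => j _.
by rewrite mxE.
Qed.

Definition frob A : R := Num.sqrt (frob2 A).

Lemma frob_ge0 A : 0 <= frob A. Proof. exact: sqrtr_ge0. Qed.

Lemma frob_sqr A : frob A ^+ 2 = frob2 A.
Proof. by rewrite sqr_sqrtr// frob2_ge0. Qed.

Lemma nrm_mulmx_le v A : nrm (v *m A) <= nrm v * frob A.
Proof.
rewrite nrm_le ?mulr_ge0 ?nrm_ge0 ?frob_ge0// exprMn nrm_sqr frob_sqr.
exact: sqn_mulmx_le.
Qed.

Lemma frob_le_entries A t : (forall i j, `|A i j| <= t) -> frob A <= m%:R * t.
Proof.
move=> At; have t0 : 0 <= t by apply: le_trans (At (Ordinal m_gt0) (Ordinal m_gt0)).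
rewrite -(@ler_pXn2r _ 2)// ?nnegrE ?mulr_ge0 ?frob_ge0// frob_sqr exprMn.
apply: (@le_trans _ _ (\sum_(i < m) \sum_(j < m) t ^+ 2)).
  apply: ler_sum => i _; apply: ler_sum => j _.
  by rewrite -(real_normK (num_real (A i j))) ler_pXn2r ?nnegrE.
by rewrite !sumr_const !card_ord -mulrnA -[leLHS]mulr_natl natrM expr2.
Qed.

(** The square of [s] is the least eigenvalue of [A^T *m A]. Vectors are rows, so [v *m A^T] is the
    transpose of [A] applied to the column of [v]. *)
Lemma least_singular_valueP A : let s := least_singular_value A in
  [/\ 0 <= s, forall v, s * nrm v <= nrm (v *m A^T) &
      exists2 v, v != 0 & nrm (v *m A^T) = s * nrm v].
Proof.
have sqE v : dotr (v *m (A^T *m A)) v = sqn (v *m A^T).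
  by rewrite /sqn [in RHS]dotr_mull trmxK mulmxA dotrC.
have symAA : (A^T *m A)^T = A^T *m A by rewrite trmx_mul trmxK.
have [mu [v [v0 veig vmin]]] := rayleigh_min m_gt0 symAA.
have vp := sqn_gt0 v0.
have muE : sqn (v *m A^T) = mu * sqn v by rewrite -sqE veig dotrZl.
have mu0 : 0 <= mu by rewrite -(pmulr_lge0 _ vp) -muE sqn_ge0.
have -> : least_singular_value A = Num.sqrt mu.
  apply/le_anti/andP; split.
    apply: inf_lbound; first by exists 0 => x [].
    split; first exact: sqrtr_ge0.
    by rewrite sqr_sqrtr//; apply/eigenvalueP; exists v.
  apply: lb_le_inf.
    exists (Num.sqrt mu); split; first exact: sqrtr_ge0.
    by rewrite sqr_sqrtr//; apply/eigenvalueP; exists v.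
  move=> s [s0 /eigenvalueP[w weig w0]].
  rewrite -(@ler_pXn2r _ 2)// ?nnegrE ?sqrtr_ge0// sqr_sqrtr//.
  by have := vmin w; rewrite weig dotrZl ler_pM2r// sqn_gt0.
split; first exact: sqrtr_ge0.
  move=> w; rewrite le_nrm ?mulr_ge0 ?sqrtr_ge0 ?nrm_ge0//.
  by rewrite exprMn nrm_sqr sqr_sqrtr// -sqE.
exists v => //; apply/eqP; rewrite -(@eqrXn2 _ 2)// ?mulr_ge0 ?sqrtr_ge0 ?nrm_ge0//.
by rewrite exprMn !nrm_sqr sqr_sqrtr// muE.
Qed.

(** Weyl's inequality: both matrices are evaluated at a minimizing vector of [B]. *)
Lemma least_singular_value_lip A B :
  least_singular_value A <= least_singular_value B + frob (A - B).
Proof.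
have [_ hA _] := least_singular_valueP A.
have [_ _ [v v0 hB]] := least_singular_valueP B.
rewrite -(ler_pM2r (nrm_gt0 v0)); apply: le_trans (hA v) _.
have -> : v *m A^T = v *m B^T + v *m (A - B)^T.
  by rewrite -mulmxDr -linearD/= addrC subrK.
apply: le_trans (ler_nrmD _ _) _; rewrite hB mulrDl lerD2l mulrC.
by have := nrm_mulmx_le v (A - B)^T; rewrite /frob frob2_tr.
Qed.

Lemma unitmx_least_singular_value A : 0 < least_singular_value A -> A \in unitmx.
Proof.
move=> s0; have [_ hA _] := least_singular_valueP A.
rewrite -unitmx_tr -row_free_unit -kermx_eq0; apply/eqP/row_matrixP => i.
rewrite row0; apply/eqP/contraT => ki.
have := hA (row i (kermx A^T)).
rewrite -row_mul mulmx_ker row0 /nrm {2}/sqn /dotr big1 ?sqrtr0; last first.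
  by move=> j _; rewrite mxE mul0r.
by rewrite leNgt mulr_gt0// sqrtr_gt0 sqn_gt0.
Qed.

(** On an eigenvector of the least eigenvalue [mu >= 0] the matrix stretches by exactly [mu], so
    [t <= mu]. Semidefiniteness excludes a negative eigenvalue of large modulus. *)
Lemma psd_lower_bound C t : C^T = C -> (forall v, 0 <= dotr (v *m C) v) ->
  0 <= t -> (forall v, t * nrm v <= nrm (v *m C)) ->
  forall v, t * sqn v <= dotr (v *m C) v.
Proof.
move=> symC psd t0 ht w.
have [mu [v [v0 veig vmin]]] := rayleigh_min m_gt0 symC.
apply: le_trans (vmin w); rewrite ler_wpM2r ?sqn_ge0//.
have mu0 : 0 <= mu.
  by have := psd v; rewrite veig dotrZl pmulr_lge0// sqn_gt0.
have := ht v; rewrite veig.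
have -> : nrm (mu *: v) = mu * nrm v.
  apply/eqP; rewrite -(@eqrXn2 _ 2)// ?mulr_ge0 ?nrm_ge0//.
  by rewrite exprMn !nrm_sqr /sqn dotrZl dotrZr mulrA expr2.
by rewrite ler_pM2r// nrm_gt0.
Qed.

End SingularValues.

(** * Effect of the estimation error on accuracy *)

Section Perturbation.
Context (R : realType) (m : nat).
Hypothesis m_gt0 : (0 < m)%N.
Variables (C Ch : 'M[R]_m).
Hypotheses (symC : C^T = C) (symCh : Ch^T = Ch).
Hypothesis psdC : forall v : 'rV[R]_m, 0 <= dotr (v *m C) v.
Local Notation D := (Ch - C).
Local Notation r := (least_singular_value Ch).
Implicit Types v : 'rV[R]_m.

(* The two bounds are the accuracy of f with respect to X_i, divided by |S_i|, and
   with respect to f. *)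
Lemma perturbed_accuracy eps v : 0 < r -> r <= 2 -> 0 < eps -> eps <= 1 ->
  frob D <= eps * r / 2 ->
  (forall i, (v *m D) 0 i ^+ 2 <= eps ^+ 2 * dotr (v *m C) v) /\
  dotr (v *m D) v ^+ 2 <= eps ^+ 2 * dotr (v *m C) v ^+ 2.
Proof.
move=> r0 r2 e0 e1 leD.
have D2 : frob D <= r / 2.
  by apply: le_trans leD _; rewrite -mulrA -[leRHS]mul1r ler_wpM2r// divr_ge0// ltW.
(* As [eps <= 1], the error has norm at most [r / 2], so [C] still stretches every vector by at
   least [r / 2]. *)
have qC w : r / 2 * sqn w <= dotr (w *m C) w.
  apply: psd_lower_bound => // [|w']; first by rewrite divr_ge0// ltW.
  have [_ hCh _] := least_singular_valueP m_gt0 Ch.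
  have := hCh w'; rewrite symCh.
  have -> : w' *m Ch = w' *m C + w' *m D by rewrite -mulmxDr addrC subrK.
  move=> h; have := le_trans h (ler_nrmD _ _).
  have := nrm_mulmx_le w' D; have := nrm_ge0 w'.
  move=> h1 h2 h3; have h4 : nrm w' * frob D <= nrm w' * (r / 2) by rewrite ler_wpM2l.
  lra.
have er0 : 0 <= eps * r / 2 by rewrite divr_ge0// mulr_ge0// ltW.
have frobD2 : frob D ^+ 2 <= (eps * r / 2) ^+ 2.
  by rewrite ler_pXn2r ?nnegrE ?frob_ge0.
have sv := sqn_ge0 v.
split.
  move=> i; apply: (@le_trans _ _ (sqn (v *m D))).
    rewrite /sqn /dotr (bigD1 i)//= -expr2 lerDl.
    by apply: sumr_ge0 => j _; rewrite -expr2 sqr_ge0.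
  apply: le_trans (sqn_mulmx_le _ _) _; rewrite -frob_sqr.
  apply: (@le_trans _ _ (sqn v * (eps * r / 2) ^+ 2)); first by rewrite ler_wpM2l.
  (* A factor [r / 2] is left over here, and [r <= 2] disposes of it. In the bound for [f] itself
     nothing is left over. *)
  have -> : sqn v * (eps * r / 2) ^+ 2 = eps ^+ 2 * ((r / 2) * (r / 2 * sqn v)) by field.
  rewrite ler_wpM2l ?sqr_ge0//; apply: le_trans (qC v).
  rewrite -[leRHS]mul1r ler_wpM2r ?mulr_ge0 ?divr_ge0 ?(ltW r0)//.
  by rewrite ler_pdivrMr// mul1r.
rewrite -exprMn -(real_normK (num_real (dotr _ _))).
have qv0 := psdC v.
rewrite ler_pXn2r ?nnegrE ?mulr_ge0 ?(ltW e0)//.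
apply: le_trans (ler_norm_dotr _ _) _.
apply: (@le_trans _ _ (nrm v * (eps * r / 2) * nrm v)).
  rewrite ler_wpM2r ?nrm_ge0//; apply: le_trans (nrm_mulmx_le _ _) _.
  by rewrite ler_wpM2l ?nrm_ge0.
have -> : nrm v * (eps * r / 2) * nrm v = eps * (r / 2 * sqn v).
  by rewrite -nrm_sqr; field.
by rewrite ler_wpM2l// ltW.
Qed.

(** Tested on one basis vector, whose image is a row of [m] entries of modulus at most 1. Together
    with the stopping rule this leaves finitely many scales above 2. *)
Lemma least_singular_value_sqr_le : (forall i j, `|Ch i j| <= 1) ->
  r ^+ 2 <= m%:R.
Proof.
move=> le1; have [r0 hCh _] := least_singular_valueP m_gt0 Ch.
pose i0 := Ordinal m_gt0; pose e : 'rV[R]_m := delta_mx 0 i0.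
have sqe : sqn e = 1.
  rewrite /sqn /dotr (bigD1 i0)//= big1 ?addr0 => [|i /negbTE i00].
    by rewrite mxE !eqxx mulr1.
  by rewrite mxE i00 andbF mul0r.
have := hCh e; rewrite le_nrm ?mulr_ge0 ?nrm_ge0// exprMn nrm_sqr sqe mulr1 symCh.
move=> h; apply: le_trans h _; rewrite -rowE /sqn /dotr.
apply: (@le_trans _ _ (\sum_(j < m) 1)); last by rewrite sumr_const card_ord.
apply: ler_sum => j _; rewrite mxE -expr2 -(real_normK (num_real _)).
by rewrite exprn_ile1.
Qed.

(* Split m = tr (Ch^-1 Ch) = tr (Ch^-1 C) + tr (Ch^-1 D); the first trace is at
   most m / r since C is a Gram matrix with unit diagonal, the second one at most
   sqrt m / r * frob D. *)
Lemma frob_ge_large_singular_value (T : finType) (g : T -> 'rV[R]_m) :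
  (forall i j, C i j = \sum_p g p 0 i * g p 0 j) -> (forall i, C i i = 1) ->
  0 < r -> m%:R * (r - 1) <= Num.sqrt m%:R * frob D.
Proof.
move=> gram diag r0.
have uCh := unitmx_least_singular_value m_gt0 r0.
pose K := invmx Ch.
have [_ hCh _] := least_singular_valueP m_gt0 Ch.
have nK w : nrm (w *m K) <= nrm w / r.
  by rewrite ler_pdivlMr// mulrC; have := hCh (w *m K); rewrite symCh mulmxKV.
have trE (A B : 'M[R]_m) : \tr (A *m B) = \sum_i \sum_j A i j * B j i.
  by apply: eq_bigr => i _; rewrite mxE.
have tr1 : \tr (K *m C) <= m%:R / r.
  have -> : \tr (K *m C) = \sum_p dotr (g p *m K) (g p).
    rewrite trE; under eq_bigr do under eq_bigr do rewrite gram mulr_sumr.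
    under eq_bigr do rewrite exchange_big/=.
    rewrite exchange_big/=; apply: eq_bigr => p _.
    rewrite exchange_big/= /dotr; apply: eq_bigr => j _.
    rewrite mxE mulr_suml; apply: eq_bigr => i _; ring.
  have -> : m%:R = \sum_p sqn (g p).
    rewrite /sqn /dotr exchange_big/=.
    under eq_bigr do rewrite -gram diag.
    by rewrite sumr_const card_ord.
  rewrite mulr_suml; apply: ler_sum => p _.
  apply: le_trans (ler_norm _) _; apply: le_trans (ler_norm_dotr _ _) _.
  by rewrite -nrm_sqr expr2 mulrAC ler_wpM2r ?nrm_ge0.
(* Each row of the inverse is the image of a unit vector, hence has norm at most [1 / r]. *)
have frobK : frob2 K <= m%:R / r ^+ 2.
  have -> : m%:R / r ^+ 2 = \sum_(i < m) 1 / r ^+ 2.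
    by rewrite sumr_const card_ord -[RHS]mulr_natl mul1r.
  apply: ler_sum => i _.
  have := nK (delta_mx 0 i); rewrite nrm_le ?divr_ge0 ?nrm_ge0 ?(ltW r0)//.
  have -> : nrm (delta_mx 0 i : 'rV[R]_m) = 1.
    rewrite /nrm /sqn /dotr (bigD1 i)//= big1 ?addr0 => [|j /negbTE ji].
      by rewrite mxE !eqxx mulr1 sqrtr1.
    by rewrite mxE ji andbF mul0r.
  rewrite exprMn exprVn expr1n -rowE; congr (_ <= _).
  by apply: eq_bigr => j _; rewrite mxE expr2.
have tr2 : \tr (K *m D) <= Num.sqrt m%:R / r * frob D.
  have -> : \tr (K *m D) = dotr (mxvec K) (mxvec D^T).
    rewrite trE /dotr (reindex _ (curry_mxvec_bij m m))/=.
    rewrite pair_bigA/=; apply: eq_bigr => -[i j] _.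
    by rewrite !mxvecE [D^T i j]mxE.
  have sqnvec (A : 'M[R]_m) : sqn (mxvec A) = frob2 A.
    rewrite /sqn /dotr (reindex _ (curry_mxvec_bij m m))/=.
    rewrite /frob2 pair_bigA/=; apply: eq_bigr => -[i j] _.
    by rewrite !mxvecE expr2.
  apply: le_trans (ler_norm _) _; apply: le_trans (ler_norm_dotr _ _) _.
  rewrite {2}/nrm sqnvec frob2_tr -/(frob D) ler_wpM2r ?frob_ge0//.
  rewrite nrm_le ?divr_ge0 ?sqrtr_ge0 ?(ltW r0)// sqnvec.
  by rewrite exprMn exprVn sqr_sqrtr.
have : m%:R = \tr (K *m C) + \tr (K *m D).
  by rewrite -linearD/= -mulmxDr addrC subrK mulVmx// mxtrace1.
move=> trm; have le_m : m%:R <= m%:R / r + Num.sqrt m%:R / r * frob D.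
  by rewrite [leLHS]trm lerD.
have : m%:R * r <= (m%:R / r + Num.sqrt m%:R / r * frob D) * r by rewrite ler_pM2r.
have -> : (m%:R / r + Num.sqrt m%:R / r * frob D) * r = m%:R + Num.sqrt m%:R * frob D.
  by field; rewrite gt_eqF.
by rewrite mulrBr mulr1 lerBlDl.
Qed.

End Perturbation.

(** * Deviations of the estimated correlation matrix *)

Section RealInequalities.
Context (R : realType).
Implicit Types x y z p : R.

(** Writing [expR x] as the inverse fourth power of [expR (- (x / 4)) >= 1 - x / 4] reduces the
    claim to the polynomial inequality [1 <= (1 - x / 4) ^+ 4 * (1 + x + x ^+ 2)]. *)
Lemma expR_le_quadratic x : x <= 1 / 2 -> expR x <= 1 + x + x ^+ 2.
Proof.
move=> x_le.
have y_gt0 : 0 < 1 - x / 4 by lra.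
have q_gt0 : 0 < 1 + x + x ^+ 2.
  have -> : 1 + x + x ^+ 2 = (x + 1 / 2) ^+ 2 + 3 / 4 by field.
  by have := sqr_ge0 (x + 1 / 2); lra.
have y_le : 1 - x / 4 <= expR (- (x / 4)) by exact: expR_ge1Dx.
have -> : expR x = (expR (- (x / 4)) ^+ 4)^-1.
  by rewrite -expRM_natl -expRN; congr expR; field.
rewrite invf_ple ?posrE ?exprn_gt0 ?expR_gt0//.
apply: (@le_trans _ _ ((1 - x / 4) ^+ 4)); last first.
  by rewrite ler_pXn2r// nnegrE ?expR_ge0// ltW.
rewrite -div1r ler_pdivrMr//.
have -> : (1 - x / 4) ^+ 4 * (1 + x + x ^+ 2) =
  1 + x ^+ 2 * ((1/256) * (96 - 176 * x + 81 * x ^+ 2 - 15 * x ^+ 3 + x ^+ 4)) by field.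
rewrite lerDl; apply: mulr_ge0; first exact: sqr_ge0.
apply: mulr_ge0; first exact: divr_ge0 (ler0n _ 1) (ler0n _ 256).
have h1 : 0 <= (1 / 2 - x) * x ^+ 2 by rewrite mulr_ge0 ?sqr_ge0//; lra.
have h2 := sqr_ge0 (x + 1 / 16); have h3 := sqr_ge0 (x ^+ 2); have h4 := sqr_ge0 x.
(* A certificate of positivity: for [x <= 1 / 2] every summand on the right is nonnegative. *)
have -> : 96 - 176 * x + 81 * x ^+ 2 - 15 * x ^+ 3 + x ^+ 4 =
  (367 / 2) * (1 / 2 - x) + 15 * ((1 / 2 - x) * x ^+ 2) + (x ^+ 2) ^+ 2 +
  60 * (x + 1 / 16) ^+ 2 + (27 / 2) * x ^+ 2 + (257 / 64) by field.
lra.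
Qed.

(** Used to trade part of an exponent for a polynomial factor that cancels the small weights in the
    potential. *)
Lemma expR_ge2M z : 2 * z <= expR z.
Proof.
have [z_lt0|z_ge0] := ltP z 0.
  by apply: (@le_trans _ _ 0); [lra|exact: expR_ge0].
have h : 1 + z / 2 <= expR (z / 2) by exact: expR_ge1Dx.
have -> : expR z = expR (z / 2) ^+ 2 by rewrite -expRM_natl; congr expR; field.
apply: (@le_trans _ _ ((1 + z / 2) ^+ 2)); last first.
  by rewrite ler_pXn2r ?nnegrE ?expR_ge0//; lra.
have -> : (1 + z / 2) ^+ 2 = 2 * z + (1 - z / 2) ^+ 2 by field.
by rewrite lerDl sqr_ge0.
Qed.

(* With x = l (1 - p) and x = - l p, the quadratic bound on expR gives
   1 + l ^+ 2 * p * (1 - p) <= 1 + l ^+ 2 / 4. *)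
Lemma bernoulli_mgf_le l p : `|l| <= 1 / 2 -> 0 <= p <= 1 ->
  p * expR (l * (1 - p)) + (1 - p) * expR (- (l * p)) <= expR (l ^+ 2 / 4).
Proof.
move=> l_le /andP[p0 p1].
have lb x : 0 <= x <= 1 -> `|l * x| <= 1 / 2.
  move=> /andP[x0 x1]; rewrite normrM (ger0_norm x0).
  by rewrite (le_trans _ l_le)// ler_piMr.
have h1 : l * (1 - p) <= 1 / 2.
  by rewrite (le_trans (ler_norm _))// lb// subr_ge0 p1 lerBlDr lerDl.
have h2 : - (l * p) <= 1 / 2.
  by rewrite (le_trans (ler_norm _))// normrN lb// p0.
apply: (@le_trans _ _ (1 + l ^+ 2 / 4)); last exact: expR_ge1Dx.
apply: (@le_trans _ _ (p * (1 + l * (1 - p) + (l * (1 - p)) ^+ 2) +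
   (1 - p) * (1 + - (l * p) + (- (l * p)) ^+ 2))).
  by apply: lerD; apply: ler_wpM2l; rewrite ?subr_ge0// expR_le_quadratic.
have -> : p * (1 + l * (1 - p) + (l * (1 - p)) ^+ 2) +
   (1 - p) * (1 + - (l * p) + (- (l * p)) ^+ 2) = 1 + l ^+ 2 * (p * (1 - p)) by ring.
rewrite lerD2l ler_wpM2l ?sqr_ge0//.
have -> : p * (1 - p) = 4^-1 - (p - 1 / 2) ^+ 2 by field.
by rewrite gerBl sqr_ge0.
Qed.

Lemma dyadic_bracket x : 1 <= x -> exists a, 2 ^+ a <= x < 2 ^+ a.+1.
Proof.
move=> x1.
have [N xN] : exists N, x < 2 ^+ N.
  exists (Num.truncn x).+1; apply: lt_le_trans (truncnS_gt _) _.
  by rewrite -natrX ler_nat ltnW// ltn_expl.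
elim: N xN => [|N IHN] xN; first by rewrite expr0 ltNge x1 in xN.
by have [/IHN//|Nx] := ltP x (2 ^+ N); exists N; rewrite Nx.
Qed.

Lemma geometric_half_le J : \sum_(k < J) (2 ^+ k)^-1 <= 2 :> R.
Proof.
have -> : \sum_(k < J) (2 ^+ k)^-1 = 2 - 2 * (2 ^+ J)^-1 :> R.
  elim: J => [|J IHJ]; first by rewrite big_ord0 expr0 invr1 mulr1 subrr.
  rewrite big_ord_recr IHJ /= exprS invfM mulrA mulfV ?pnatr_eq0//; ring.
by rewrite gerBl mulr_ge0// invr_ge0 exprn_ge0.
Qed.

End RealInequalities.

Section Deviations.
Context (R : realType) (n m : nat) (Ts : 'I_m -> pstruct n).
Hypothesis Ts_wf : forall i, ps_wf (Ts i).
Hypothesis Ts_index : forall i, ps_index (Ts i) = [set: 'I_n]%SET.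
Hypothesis Ts_sorted : forall i j : 'I_m, (i <= j)%N ->
  (#|ps_set (Ts j)| <= #|ps_set (Ts i)|)%N.
Implicit Types (M : 'M[R]_m) (i j k l : 'I_m) (s : nat).
Local Notation ov := (overlap R Ts).

Definition root_card i : R := Num.sqrt #|ps_set (Ts i)|%:R.

Lemma root_card_gt0 i : 0 < root_card i.
Proof. by rewrite sqrtr_gt0 ltr0n card_ps_set_gt0. Qed.

Lemma root_card_neq0 i : root_card i != 0.
Proof. by rewrite gt_eqF// root_card_gt0. Qed.

Lemma root_card_sqr i : root_card i ^+ 2 = #|ps_set (Ts i)|%:R.
Proof. by rewrite sqr_sqrtr. Qed.

(** The ordering of the structures enters here: rescaling a frequency to a correlation never
    amplifies its error, nor lifts it above 1. *)
Lemma root_card_le i j : (i <= j)%N -> root_card j / root_card i <= 1.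
Proof.
move=> ij; rewrite ler_pdivrMr ?root_card_gt0// mul1r ler_sqrt// ler_nat.
exact: Ts_sorted.
Qed.

Definition root_row : 'rV[R]_m := \row_i root_card i.

(** The correlation matrix in terms of cardinalities, identified with the probabilistic one by
    [correlation_mx_corr]. The analysis of the loop is thereby free of the Gaussian space. *)
Definition corr_mx : 'M[R]_m := \matrix_(i, j)
  (#|(ps_set (Ts i) :&: ps_set (Ts j))%SET|%:R / (root_card i * root_card j)).

Lemma corr_mx_sym : corr_mx^T = corr_mx.
Proof. by apply/matrixP => i j; rewrite !mxE finset.setIC mulrC (mulrC (root_card j)) mulrC. Qed.

Lemma corr_mx_diag i : corr_mx i i = 1.
Proof. by rewrite mxE finset.setIid -root_card_sqr expr2 mulfV// mulf_neq0 ?root_card_neq0. Qed.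

Lemma corr_mx_overlap i j : corr_mx i j = ov i j * (root_card j / root_card i).
Proof.
rewrite mxE /overlap -root_card_sqr.
by field; rewrite !root_card_neq0.
Qed.

Definition count_inv s M := (forall k, M k k = s%:R) /\
  forall k l, (k < l)%N -> 0 <= M k l <= s%:R.

Definition count_close t s M := forall k l, (k < l)%N ->
  `|M k l - s%:R * ov k l| <= s%:R * t.

Local Notation Ch s M := (Chat root_row s M).

Lemma Chat_upper s M i j : (i <= j)%N ->
  Ch s M i j = M i j / s%:R * (root_card j / root_card i).
Proof. by move=> ij; rewrite !mxE ij. Qed.

Lemma Chat_sym s M : (Ch s M)^T = Ch s M.
Proof.
apply/matrixP => i j; rewrite !mxE; case: (ltngtP i j) => // /val_inj ->; by [].
Qed.

Lemma Chat_diag s M i : count_inv s.+1 M -> Ch s.+1 M i i = 1.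
Proof.
move=> [diag _]; rewrite Chat_upper// diag !mulfV ?mulr1// ?root_card_neq0//.
Qed.

Lemma sym_upper (B : 'M[R]_m) (Q : R -> Prop) : B^T = B ->
  (forall i, Q (B i i)) -> (forall i j, (i < j)%N -> Q (B i j)) ->
  forall i j, Q (B i j).
Proof.
move=> symB diag upper i j; case: (ltngtP i j) => [ij|ji|/val_inj ->].
- exact: upper.
- by rewrite -symB mxE; exact: upper.
- exact: diag.
Qed.

Lemma Chat_le1 s M : count_inv s.+1 M -> forall i j, `|Ch s.+1 M i j| <= 1.
Proof.
move=> inv; apply: (sym_upper (Q := fun x => `|x| <= 1)); first exact: Chat_sym.
  by move=> i; rewrite Chat_diag// normr1.
move=> i j ij; rewrite Chat_upper ?(ltnW ij)//.
have /andP[M0 M1] := inv.2 _ _ ij.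
rewrite ger0_norm ?mulr_ge0 ?invr_ge0 ?(ltW (root_card_gt0 _))//.
rewrite mulr_ile1 ?mulr_ge0 ?invr_ge0 ?(ltW (root_card_gt0 _)) ?root_card_le ?(ltnW ij)//.
by rewrite ler_pdivrMr// mul1r.
Qed.

Lemma corr_mx_le1 i j : `|corr_mx i j| <= 1.
Proof.
apply: (sym_upper (Q := fun x => `|x| <= 1)) => [|k|k l kl]; first exact: corr_mx_sym.
  by rewrite corr_mx_diag normr1.
have /andP[ov0 ov1] := overlap01 R Ts_wf k l.
rewrite corr_mx_overlap ger0_norm ?mulr_ge0 ?invr_ge0 ?(ltW (root_card_gt0 _))//.
by rewrite mulr_ile1 ?mulr_ge0 ?invr_ge0 ?(ltW (root_card_gt0 _)) ?root_card_le ?(ltnW kl).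
Qed.

Lemma Chat_close t s M : count_inv s.+1 M -> 0 <= t -> count_close t s.+1 M ->
  forall i j, `|(Ch s.+1 M - corr_mx) i j| <= t.
Proof.
have subE (A B : 'M[R]_m) i j : (A - B) i j = A i j - B i j by rewrite !mxE.
move=> inv t0 close; apply: (sym_upper (Q := fun x => `|x| <= t)).
- by rewrite linearB/= Chat_sym corr_mx_sym.
- by move=> i; rewrite subE Chat_diag// corr_mx_diag subrr normr0.
move=> i j ij; rewrite subE Chat_upper ?(ltnW ij)// corr_mx_overlap -mulrBl.
rewrite normrM -[leRHS]mulr1 ler_pM ?normr_ge0//; last first.
  by rewrite ger0_norm ?root_card_le ?(ltnW ij)// divr_ge0// ltW// root_card_gt0.
have s0 : (0 : R) < s.+1%:R by [].
rewrite -(ler_pM2l s0) -{1}(ger0_norm (ltW s0)) -normrM mulrBr mulrC divfK ?gt_eqF//.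
exact: close.
Qed.

Lemma corr_mx_gram i j : corr_mx i j = \sum_(p : {set {set 'I_n}})
  ((p \in ps_set (Ts i))%:R / root_card i) * ((p \in ps_set (Ts j))%:R / root_card j).
Proof.
rewrite mxE -sum1_card natr_sum big_mkcond/= mulr_suml; apply: eq_bigr => p _.
rewrite finset.in_setI invfM.
by case: (p \in ps_set (Ts i)); case: (p \in ps_set (Ts j)) => /=; ring.
Qed.

Definition indicator_row (p : pairing n) : 'rV[R]_m :=
  \row_i ((p \in ps_set (Ts i))%:R / root_card i).

Lemma dotr_corr_mx (v : 'rV[R]_m) :
  dotr (v *m corr_mx) v = \sum_(p : {set {set 'I_n}}) dotr v (indicator_row p) ^+ 2.
Proof.
rewrite /dotr; under eq_bigr do rewrite mxE mulr_suml.
under eq_bigr do under eq_bigr do rewrite corr_mx_gram mulr_sumr mulr_suml.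
under eq_bigr do rewrite exchange_big/=.
rewrite exchange_big/=; apply: eq_bigr => p _.
rewrite expr2 mulr_suml exchange_big/=; apply: eq_bigr => i _.
rewrite mulr_sumr; apply: eq_bigr => j _; rewrite !mxE; ring.
Qed.

Lemma corr_mx_psd (v : 'rV[R]_m) : 0 <= dotr (v *m corr_mx) v.
Proof. by rewrite dotr_corr_mx; apply: sumr_ge0 => p _; exact: sqr_ge0. Qed.

End Deviations.

(** * Exponential supermartingales of the counts *)

Section Supermartingale.
Context (R : realType) (n m : nat) (Ts : 'I_m -> pstruct n).
Hypothesis Ts_wf : forall i, ps_wf (Ts i).
Hypothesis Ts_index : forall i, ps_index (Ts i) = [set: 'I_n]%SET.
Implicit Types (M : 'M[R]_m) (i j k l : 'I_m) (s : nat) (a : R).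
Local Notation ov := (overlap R Ts).

(** The exponential supermartingale of a sum of centred Bernoulli variables; the compensator
    [a ^+ 2 / 4] per round is the bound of [bernoulli_mgf_le]. *)
Definition exp_dev a s M k l : R :=
  expR (a * (M k l - s%:R * ov k l) - s%:R * (a ^+ 2 / 4)).

(** Both signs and all entries above the diagonal are summed: the union bound over entries and
    directions is paid once, in the initial value. *)
Definition exp_devs a s M : R :=
  \sum_(k < m) \sum_(l < m | (k < l)%N) (exp_dev a s M k l + exp_dev (- a) s M k l).

Lemma exp_devs_ge0 a s M : 0 <= exp_devs a s M.
Proof.
by apply: sumr_ge0 => k _; apply: sumr_ge0 => l _; rewrite addr_ge0 ?expR_ge0.
Qed.

Lemma expect_exp_dev a s M k l : (k < l)%N -> `|a| <= 1 / 2 ->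
  expect (sample_round Ts M) (fun M' => exp_dev a s.+1 M' k l) <= exp_dev a s M k l.
Proof.
move=> kl a_le.
pose h x := expR (a * (x - s.+1%:R * ov k l) - s.+1%:R * (a ^+ 2 / 4)).
rewrite (expect_sample_round_entry Ts_wf Ts_index M h kl) /h.
have mgf := bernoulli_mgf_le a_le (overlap01 R Ts_wf k l).
set p := ov k l in mgf *.
have -> : a * (M k l + 1 - s.+1%:R * p) - s.+1%:R * (a ^+ 2 / 4) =
   (a * (M k l - s%:R * p) - s%:R * (a ^+ 2 / 4)) + a * (1 - p) - a ^+ 2 / 4.
  by rewrite -natr1; ring.
have -> : a * (M k l - s.+1%:R * p) - s.+1%:R * (a ^+ 2 / 4) =
   (a * (M k l - s%:R * p) - s%:R * (a ^+ 2 / 4)) + - (a * p) - a ^+ 2 / 4.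
  by rewrite -natr1; ring.
rewrite !expRD -/p /exp_dev -/p.
set E := expR (a * _ - _); set c := expR (- (a ^+ 2 / 4)).
have -> : p * (expR (a * (M k l - s%:R * p)) * expR (- (s%:R * (a ^+ 2 / 4))) *
    expR (a * (1 - p)) * c) + (1 - p) * (expR (a * (M k l - s%:R * p)) *
    expR (- (s%:R * (a ^+ 2 / 4))) * expR (- (a * p)) * c) =
  E * (c * (p * expR (a * (1 - p)) + (1 - p) * expR (- (a * p)))).
  by rewrite /E expRD; ring.
rewrite -[leRHS]mulr1 ler_wpM2l ?expR_ge0//.
by rewrite -[leRHS](expRxMexpNx_1 (a ^+ 2 / 4)) mulrC ler_wpM2r ?expR_ge0.
Qed.

(** The bound on [a] is conditional because the sum is empty for [m = 1], while [small_rate] is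
    guaranteed to be at most 1/2 from [m = 2] on. *)
Lemma expect_exp_devs a s M : ((1 < m)%N -> 0 <= a <= 1 / 2) ->
  expect (sample_round Ts M) (exp_devs a s.+1) <= exp_devs a s M.
Proof.
move=> ha; rewrite expect_sum; apply: ler_sum => k _.
rewrite expect_sum; apply: ler_sum => l kl.
have /andP[a0 a1] : 0 <= a <= 1 / 2.
  apply: ha; apply: leq_ltn_trans (ltn_ord l).
  exact: leq_ltn_trans (leq0n k) kl.
rewrite expectD; apply: lerD; apply: expect_exp_dev => //.
  by rewrite ger0_norm.
by rewrite normrN ger0_norm.
Qed.

Lemma exp_devs0 a : exp_devs a 0 0 <= m%:R ^+ 2.
Proof.
have e0 b k l : exp_dev b 0 0 k l = 1.
  by rewrite /exp_dev mxE !mul0r subrr mulr0 subr0 expR0.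
rewrite /exp_devs; under eq_bigr do under eq_bigr do rewrite !e0.
have -> : \sum_(k < m) \sum_(l < m | (k < l)%N) (1 + 1) =
  \sum_(k < m) \sum_(l < m) ((k < l)%N%:R + (l < k)%N%:R) :> R.
  under eq_bigr do rewrite big_split/= big_mkcond/=.
  under [RHS]eq_bigr do rewrite big_split.
  rewrite !big_split/=; congr (_ + _).
    by apply: eq_bigr => k _; apply: eq_bigr => l _; case: ltnP.
  rewrite [RHS]exchange_big/=.
  by apply: eq_bigr => k _; apply: eq_bigr => l _; case: ltnP.
apply: (@le_trans _ _ (\sum_(k < m) \sum_(l < m) 1)).
  apply: ler_sum => k _; apply: ler_sum => l _.
  by case: ltngtP => _; rewrite ?addr0 ?add0r.
by rewrite !sumr_const card_ord -mulrnA -natrX.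
Qed.

(** One entry that is too far off suffices; the sign of its deviation selects one of its two
    exponentials. *)
Lemma exp_devs_ge a t s M : 0 <= a -> ~ count_close Ts t s M ->
  expR (s%:R * (a * t - a ^+ 2 / 4)) <= exp_devs a s M.
Proof.
move=> a0 nclose.
have [k [l [kl dev]]] : exists k l, (k < l)%N /\ s%:R * t < `|M k l - s%:R * ov k l|.
  apply: contra_notP nclose => H k l kl; rewrite leNgt; apply/negP => dev.
  by apply: H; exists k, l.
have one : exp_dev a s M k l + exp_dev (- a) s M k l <= exp_devs a s M.
  rewrite /exp_devs (bigD1 k)//= (bigD1 l)//= -addrA lerDl addr_ge0//.
    by apply: sumr_ge0 => j _; rewrite addr_ge0 ?expR_ge0.
  apply: sumr_ge0 => i _; apply: sumr_ge0 => j _; by rewrite addr_ge0 ?expR_ge0.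
apply: le_trans one; rewrite /exp_dev.
have E0 := expR_ge0; move: dev; rewrite ltr_normr => /orP[] dev.
  apply: ler_wpDr; first exact: E0.
  by rewrite ler_expR mulrBr lerB// mulrCA ler_wpM2l// ltW.
apply: ler_wpDl; first exact: E0.
by rewrite ler_expR mulrBr sqrrN lerB// mulrCA mulNr -mulrN ler_wpM2l// ltW.
Qed.

End Supermartingale.

(** * Stopping arguments for the loop *)

Section Loop.
Context (R : realType) (n m : nat) (Ts : 'I_m -> pstruct n).
Hypothesis Ts_wf : forall i, ps_wf (Ts i).
Hypothesis Ts_index : forall i, ps_index (Ts i) = [set: 'I_n]%SET.
Variables (delta eps : R).
Implicit Types (M : 'M[R]_m) (s k : nat).

Local Notation Ch s M := (Chat (root_row R Ts) s M).
Local Notation sv s M := (least_singular_value (Ch s M)).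
Local Notation rnd := (round Ts delta eps (root_row R Ts)).
Local Notation cont s M := (continue m delta eps s (sv s M)).

Lemma expect_repeat k s M g : expect (repeatP rnd k.+1 (s, M)) g =
  expect (sample_round Ts M) (fun M' =>
    if cont s.+1 M' then expect (repeatP rnd k (s.+1, M')) g
    else g (Some (Ch s.+1 M'))).
Proof.
rewrite /= expect_bind /round expect_bind /=; congr (expect _ _).
by apply/funext => M' /=; case: ifP.
Qed.

Definition sample_cost (S : nat) : nat :=
  (m * (1 + m * (4 * S ^ 4 + (S * (S * (2 * n + 3) + 2 * S * n + 1) + 1))))%N.

Lemma runs_within_count_inv S s M : (forall i, (ps_size (Ts i) <= S)%N) ->
  count_inv s M ->
  runs_within (sample_round Ts M) (sample_cost S) (count_inv s.+1).
Proof.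
move=> leS [diag upper].
apply: runs_within_le (runs_within_sample_round Ts_wf Ts_index M leS) (leqnn _) _.
move=> M' [diag' upper']; split=> [k|k l kl].
  by rewrite diag' diag natr1.
have /andP[h1 h2] := upper _ _ kl; have /andP[h3 h4] := upper' _ _ kl.
by rewrite (le_trans h1 h3)/= (le_trans h4)// -natr1 lerD2r.
Qed.

Let size_bound i : (ps_size (Ts i) <= \sum_j ps_size (Ts j))%N.
Proof. by rewrite (bigD1 i)//= leq_addr. Qed.

(** Optional stopping, as an induction on the remaining rounds. [W] has to dominate the bad event
    only up to round [K], so it may be built from finitely many scales chosen after [K]. *)
Lemma repeat_prob_le (W : nat -> 'M[R]_m -> R) (Bad : 'M[R]_m -> Prop) K :
  (forall s M, expect (sample_round Ts M) (W s.+1) <= W s M) ->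
  (forall s M, 0 <= W s M) ->
  (forall s M, (s < K)%N -> count_inv s.+1 M -> ~~ cont s.+1 M ->
     Bad (Ch s.+1 M) -> 1 <= W s.+1 M) ->
  forall k s M, count_inv s M -> (s + k <= K)%N ->
  expect (repeatP rnd k (s, M))
    (fun o => if o is Some C then `[<Bad C>]%:R else 0) <= W s M.
Proof.
move=> supW W0 badW; elim=> [|k IHk] s M inv sk; first exact: W0.
rewrite expect_repeat; apply: le_trans (supW s M).
apply: le_expect (runs_within_count_inv size_bound inv) _ => M' inv'.
case: ifPn => [_|stop]; first by apply: IHk => //; rewrite addSnnS.
case: asboolP => [bad|_]; last exact: W0.
by apply: badW => //; apply: leq_trans sk; rewrite addnS ltnS leq_addr.
Qed.

(* Beyond round sstar the loop continues with probability at most the expectation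
   of g ^+ s * V, and V is a supermartingale: the tail is geometric. *)
Section Tail.
Variables (V : nat -> 'M[R]_m -> R) (g sstar : R).
Hypothesis supV : forall s M, expect (sample_round Ts M) (V s.+1) <= V s M.
Hypothesis V_ge0 : forall s M, 0 <= V s M.
Hypotheses (g_gt0 : 0 < g) (g_lt1 : g < 1).
Hypothesis cont_le : forall s M, count_inv s.+1 M -> sstar <= s.+1%:R ->
  cont s.+1 M -> 1 <= g ^+ s.+1 * V s.+1 M.

Lemma repeat_none_le k s M : count_inv s M -> sstar <= (s + k.+1)%:R ->
  expect (repeatP rnd k.+1 (s, M)) (fun o => if o is Some _ then 0 else 1) <=
  g ^+ (s + k.+1) * V s M.
Proof.
elim: k s M => [|k IHk] s M inv sk; rewrite expect_repeat.
  apply: (@le_trans _ _ (expect (sample_round Ts M) (fun M' => g ^+ s.+1 * V s.+1 M'))).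
    apply: le_expect (runs_within_count_inv size_bound inv) _ => M' inv'.
    case: ifP => [c|_] /=; last by rewrite mulr_ge0// exprn_ge0// ltW.
    by apply: cont_le => //; rewrite addn1 in sk.
  by rewrite expectZ addn1 ler_wpM2l// exprn_ge0// ltW.
apply: (@le_trans _ _ (expect (sample_round Ts M)
    (fun M' => g ^+ (s + k.+2) * V s.+1 M'))).
  apply: le_expect (runs_within_count_inv size_bound inv) _ => M' inv'.
  case: ifP => [c|_] /=; last by rewrite mulr_ge0// exprn_ge0// ltW.
  by rewrite -addSnnS; apply: IHk => //; rewrite addSnnS.
by rewrite expectZ ler_wpM2l// exprn_ge0// ltW.
Qed.

(** A drift function. Before [sstar] it counts the rounds to go; the 1 pays for the current round;
    [g ^+ s.+1 / (1 - g)] is the sum of [g ^+ j] over [j > s], the expected number of later rounds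
    in units of [V]. *)
Definition remaining_rounds s M : R :=
  Num.max 0 (sstar - s%:R) + 1 + g ^+ s.+1 / (1 - g) * V s M.

(** The potential drops by at least one per round in expectation, so its initial value bounds the
    expected number of rounds. *)
Lemma remaining_rounds_step s M : count_inv s M ->
  1 + expect (sample_round Ts M)
    (fun M' => if cont s.+1 M' then remaining_rounds s.+1 M' else 0) <=
  remaining_rounds s M.
Proof.
move=> inv.
have g1 : 0 < 1 - g by rewrite subr_gt0.
have gn0 k : 0 <= g ^+ k by rewrite exprn_ge0// ltW.
(* The first term of the geometric series is split off: by [cont_le] it pays for the next round
   whenever the loop continues. *)
have coef : g ^+ s.+1 / (1 - g) = g ^+ s.+1 + g ^+ s.+2 / (1 - g).
  by rewrite [g ^+ s.+2]exprS; field; rewrite gt_eqF.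
have [le_s|gt_s] := leP sstar s.+1%:R.
  have -> : remaining_rounds s M = Num.max 0 (sstar - s%:R) + 1 +
      (g ^+ s.+1 * V s M + g ^+ s.+2 / (1 - g) * V s M).
    by rewrite /remaining_rounds coef; ring.
  apply: (@le_trans _ _ (1 + expect (sample_round Ts M)
      (fun M' => (g ^+ s.+1 + g ^+ s.+2 / (1 - g)) * V s.+1 M'))); last first.
    rewrite expectZ -mulrDl.
    have h := supV s M.
    have : 0 <= Num.max 0 (sstar - s%:R) by rewrite le_max lexx.
    have : (g ^+ s.+1 + g ^+ s.+2 / (1 - g)) * expect (sample_round Ts M) (V s.+1) <=
        (g ^+ s.+1 + g ^+ s.+2 / (1 - g)) * V s M.
      by rewrite ler_wpM2l// addr_ge0// divr_ge0// ltW.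
    lra.
  rewrite lerD2l; apply: le_expect (runs_within_count_inv size_bound inv) _ => M' inv'.
  case: ifP => [c|_]; last first.
    by rewrite mulr_ge0// addr_ge0// divr_ge0// ltW.
  rewrite /remaining_rounds max_l ?subr_le0// add0r mulrDl lerD2r.
  exact: cont_le.
apply: (@le_trans _ _ (1 + expect (sample_round Ts M) (fun M' =>
   (sstar - s.+1%:R + 1) + g ^+ s.+2 / (1 - g) * V s.+1 M'))).
  rewrite lerD2l; apply: le_expect (runs_within_count_inv size_bound inv) _ => M' inv'.
  have p0 : 0 <= g ^+ s.+2 / (1 - g) * V s.+1 M' by rewrite mulr_ge0// divr_ge0// ltW.
  case: ifP => [c|_].
    by rewrite /remaining_rounds max_r ?subr_ge0// ltW.
  by rewrite addr_ge0// addr_ge0// subr_ge0 ltW.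
rewrite expectD expect_cst expectZ /remaining_rounds.
have h : g ^+ s.+2 / (1 - g) * expect (sample_round Ts M) (V s.+1) <=
    g ^+ s.+1 / (1 - g) * V s M.
  apply: ler_pM => //.
  - by rewrite divr_ge0// ltW.
  - rewrite -(expect_cst (sample_round Ts M) 0).
    exact: le_expect (runs_within_count_inv size_bound inv) _.
  - by rewrite coef lerDr.
have : sstar - s%:R <= Num.max 0 (sstar - s%:R) by rewrite le_max lexx orbT.
move: h; rewrite -natr1; lra.
Qed.

Lemma repeat_cost_le S k s M : (forall i, (ps_size (Ts i) <= S)%N) -> count_inv s M ->
  expected_cost (repeatP rnd k (s, M)) <=
  (sample_cost S + (m ^ 2 + m ^ 3).+2)%:R * remaining_rounds s M.
Proof.
move=> leS; set c := (_ + _)%N.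
have rem_ge0 s' M' : 0 <= remaining_rounds s' M'.
  rewrite /remaining_rounds !addr_ge0 ?le_max ?lexx// mulr_ge0//.
  by rewrite divr_ge0 ?exprn_ge0 ?subr_ge0 ?ltW.
elim: k s M => [|k IHk] s M inv; first by rewrite /= mulr_ge0.
rewrite [repeatP _ _ _]/= expected_cost_bind.
have wr : runs_within (rnd (s, M)) c (fun=> True).
  rewrite /round /c; apply: runs_within_bind (runs_within_count_inv leS inv) _ => M' _ /=.
  by split.
apply: (@le_trans _ _ (c%:R * (1 + expect (sample_round Ts M)
    (fun M' => if cont s.+1 M' then remaining_rounds s.+1 M' else 0)))); last first.
  by rewrite ler_wpM2l// remaining_rounds_step.
rewrite mulrDr mulr1; apply: lerD; first exact: expected_cost_le wr.
rewrite -expectZ /round expect_bind.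
apply: le_expect (runs_within_count_inv leS inv) _ => M' inv' /=.
by case: ifP => _ /=; [exact: IHk|rewrite mulr0].
Qed.

End Tail.

End Loop.

(** * Probability of stopping with an inaccurate matrix *)

Section FailureProbability.
Context (R : realType) (n m : nat) (Ts : 'I_m -> pstruct n).
Hypothesis Ts_wf : forall i, ps_wf (Ts i).
Hypothesis Ts_index : forall i, ps_index (Ts i) = [set: 'I_n]%SET.
Hypothesis Ts_sorted : forall i j : 'I_m, (i <= j)%N ->
  (#|ps_set (Ts j)| <= #|ps_set (Ts i)|)%N.
Hypothesis m_gt0 : (0 < m)%N.
Variables (delta eps : R).
Hypotheses (delta_gt0 : 0 < delta) (delta_lt1 : delta < 1).
Hypotheses (eps_gt0 : 0 < eps) (eps_le1 : eps <= 1).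
Implicit Types (M : 'M[R]_m) (s k : nat).

Local Notation Ch s M := (Chat (root_row R Ts) s M).
Local Notation sv s M := (least_singular_value (Ch s M)).
Local Notation rnd := (round Ts delta eps (root_row R Ts)).
Local Notation cont s M := (continue m delta eps s (sv s M)).
Local Notation L := (ln (2 / delta)).
Local Notation A := (80 * m%:R ^+ 2 * (m%:R ^+ 2 + 3 * L)).

(* A failure of the sufficient condition of perturbed_accuracy. *)
Definition inaccurate_mx (B : 'M[R]_m) : Prop :=
  ~ (least_singular_value B <= 2 /\
     frob (B - corr_mx R Ts) <= eps * least_singular_value B / 2).

Let mR : (1 : R) <= m%:R. Proof. by rewrite ler1n. Qed.
Let m0 : (0 : R) < m%:R. Proof. by rewrite ltr0n. Qed.
Let root0 : (0 : R) < Num.sqrt m%:R. Proof. by rewrite sqrtr_gt0. Qed.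
Let root2 : Num.sqrt m%:R ^+ 2 = m%:R :> R. Proof. by rewrite sqr_sqrtr// ltW. Qed.
Let L_gt0 : 0 < L.
Proof.
by rewrite ln_gt0// ltr_pdivlMr// mul1r (lt_trans delta_lt1)// ltr1n.
Qed.
Let A_gt0 : 0 < A.
Proof. by rewrite !mulr_gt0 ?exprn_gt0// addr_gt0 ?exprn_gt0// mulr_gt0. Qed.
Let expL : expR L = 2 / delta. Proof. by rewrite lnK// posrE divr_gt0. Qed.

(** Entrywise error [t] gives Frobenius norm at most [m * t]. For [r <= 2] the tolerance makes this
    [eps * r / 2]. For larger [r] it is chosen so that the trace inequality
    [m * (r - 1) <= sqrt m * (m * t)] has right side [m * r / 2], which would force [r <= 2]. *)
Lemma inaccurate_mx_dev s M : count_inv s.+1 M -> 0 < sv s.+1 M ->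
  inaccurate_mx (Ch s.+1 M) ->
  (sv s.+1 M <= 2 /\ ~ count_close Ts (eps * sv s.+1 M / (2 * m%:R)) s.+1 M) \/
  [/\ 2 < sv s.+1 M, sv s.+1 M ^+ 2 <= m%:R &
     ~ count_close Ts (sv s.+1 M / (2 * Num.sqrt m%:R)) s.+1 M].
Proof.
move=> inv r0 bad; set r := sv s.+1 M in r0 bad *.
have frob_close t : 0 <= t -> count_close Ts t s.+1 M ->
    frob (Ch s.+1 M - corr_mx R Ts) <= m%:R * t.
  by move=> t0 close; apply: frob_le_entries => //; exact: Chat_close.
have [r_le2|r_gt2] := leP r 2; [left|right].
  split=> // close; apply: bad; split=> //; apply: le_trans (frob_close _ _ close) _.
    by rewrite divr_ge0 ?mulr_ge0// ltW.
  by rewrite le_eqVlt; apply/orP; left; apply/eqP; rewrite -/r; field; rewrite gt_eqF.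
split=> //.
  by apply: least_singular_value_sqr_le => //; [exact: Chat_sym|exact: Chat_le1].
move=> close; have := frob_close _ _ close.
have h := @frob_ge_large_singular_value _ _ m_gt0 (corr_mx R Ts) (Ch s.+1 M)
  (Chat_sym _ _ _) _ (indicator_row R Ts) _ (corr_mx_diag R Ts_wf) r0.
have {}h : m%:R * (r - 1) <= Num.sqrt m%:R * frob (Ch s.+1 M - corr_mx R Ts).
  apply: h => i j; rewrite corr_mx_gram//; apply: eq_bigr => p _.
  by rewrite !mxE.
move=> h2; have {}h2 : frob (Ch s.+1 M - corr_mx R Ts) <= m%:R * (r / (2 * Num.sqrt m%:R)).
  by apply: h2; rewrite divr_ge0 ?mulr_ge0// ltW.
have : m%:R * (r - 1) <= Num.sqrt m%:R * (m%:R * (r / (2 * Num.sqrt m%:R))).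
  by apply: le_trans h _; rewrite ler_pM2l.
have -> : Num.sqrt m%:R * (m%:R * (r / (2 * Num.sqrt m%:R))) = m%:R * (r / 2).
  by field; rewrite gt_eqF.
by rewrite ler_pM2l//; lra.
Qed.

(* Scale k of the first kind serves the least singular values in
   (2 ^- k, 2 * 2 ^- k], scale k of the second kind those in [2 ^ k, 2 ^ k.+1).
   Each weight is the share of delta given to the scale, divided by the bound
   m ^ 2 on the initial value of exp_devs. *)
Definition small_rate k : R := eps / 2 ^+ k / m%:R.
Definition small_weight k : R := delta / 2 ^+ k / (4 * m%:R ^+ 2).
Definition large_rate k : R := 2 ^+ k / (2 * Num.sqrt m%:R).
Definition large_weight : R := delta / (4 * m%:R ^+ 3).

(** With [t = eps * r / (2 * m)] the exponent [a * t - a ^+ 2 / 4] is maximal at [a = 2 * t], and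
    [small_rate] is this optimum at the lower end [r = rho] of the scale. Replacing [r] by [2 * rho]
    in the stopping rule costs 16, the square of the rate 4 more; of the constant 80 there remains
    5/4, enough for [z + L]. Then [expR L = 2 / delta] cancels [delta], and [expR z >= 2 * z]
    cancels the rest of the weight. *)
Lemma small_scale_weight k (s r : R) : (2 ^+ k)^-1 < r -> r <= 2 * (2 ^+ k)^-1 ->
  A / (eps ^+ 2 * r ^+ 4) <= s ->
  1 <= small_weight k * expR (s * (small_rate k * (eps * r / (2 * m%:R)) -
         small_rate k ^+ 2 / 4)).
Proof.
rewrite /small_weight /small_rate; pose rho : R := (2 ^+ k)^-1.
rewrite -/rho => r_gt r_le s_ge.
have rho0 : 0 < rho by rewrite invr_gt0 exprn_gt0.
have rho1 : rho <= 1 by rewrite invf_le1 ?exprn_gt0// exprn_ege1// ler1n.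
have rho2 : 0 < 2 * rho by rewrite mulr_gt0.
clearbody rho.
have r0 : 0 < r by exact: lt_trans r_gt.
have A0 := A_gt0.
have s_ge' : A / (eps ^+ 2 * (2 * rho) ^+ 4) <= s.
  apply: le_trans s_ge; rewrite ler_pM2l// lef_pV2 ?posrE ?mulr_gt0 ?exprn_gt0//.
  by rewrite ler_pM2l ?exprn_gt0// ler_pXn2r ?nnegrE// ?ltW// mulr_gt0.
(* The difference of the two sides is a nonnegative multiple of [r - rho]. *)
have rate_ge : (eps * rho / (2 * m%:R)) ^+ 2 <=
    eps * rho / m%:R * (eps * r / (2 * m%:R)) - (eps * rho / m%:R) ^+ 2 / 4.
  rewrite -subr_ge0.
  have -> : eps * rho / m%:R * (eps * r / (2 * m%:R)) - (eps * rho / m%:R) ^+ 2 / 4 -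
     (eps * rho / (2 * m%:R)) ^+ 2 = eps ^+ 2 * rho / (2 * m%:R ^+ 2) * (r - rho).
    by field; rewrite gt_eqF.
  by rewrite mulr_ge0 ?divr_ge0 ?mulr_ge0 ?exprn_ge0 ?subr_ge0
    ?(ltW rho0) ?(ltW eps_gt0) ?(ltW m0) ?(ltW r_gt).
pose z : R := 5 / 4 * m%:R ^+ 2 / rho ^+ 2.
have exp_ge : z + L <=
    s * (eps * rho / m%:R * (eps * r / (2 * m%:R)) - (eps * rho / m%:R) ^+ 2 / 4).
  apply: (@le_trans _ _ (A / (eps ^+ 2 * (2 * rho) ^+ 4) * (eps * rho / (2 * m%:R)) ^+ 2)).
    have -> : A / (eps ^+ 2 * (2 * rho) ^+ 4) * (eps * rho / (2 * m%:R)) ^+ 2 =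
        z + 15 / 4 * L / rho ^+ 2.
      by rewrite /z; field; rewrite !gt_eqF.
    rewrite lerD2l ler_pdivlMr ?exprn_gt0//.
    have : rho ^+ 2 <= 1 by rewrite exprn_ile1// ltW.
    have sqrho : 0 <= rho ^+ 2 by exact: sqr_ge0.
    by move=> h; have := L_gt0; nra.
  apply: ler_pM => //; last exact: sqr_ge0.
  by rewrite divr_ge0 ?(ltW A0)// mulr_ge0 ?exprn_ge0 ?mulr_ge0 ?(ltW eps_gt0) ?(ltW rho0).
apply: (@le_trans _ _ (delta * rho / (4 * m%:R ^+ 2) * (2 * z * (2 / delta)))).
  have -> : delta * rho / (4 * m%:R ^+ 2) * (2 * z * (2 / delta)) = 5 / 4 / rho.
    by rewrite /z; field; rewrite !gt_eqF.
  by rewrite ler_pdivlMr// mul1r; lra.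
rewrite ler_wpM2l ?divr_ge0 ?mulr_ge0 ?exprn_ge0 ?(ltW rho0) ?(ltW delta_gt0) ?(ltW m0)//.
apply: (@le_trans _ _ (expR (z + L))); last by rewrite ler_expR.
by rewrite expRD expL ler_wpM2r ?divr_ge0 ?(ltW delta_gt0)// expR_ge2M.
Qed.

(** The optimal rate [2 ^+ k / sqrt m] may reach 1, beyond the range of [bernoulli_mgf_le];
    [large_rate] is half of it. The exponent is at least [2 * m ^ 2 + L]: one [expR (m ^ 2)] yields
    [2 * m ^ 2], the other yields [m], and with [2 / delta] they cancel the weight exactly. *)
Lemma large_scale_weight k (s r : R) : 2 ^+ k <= r -> r < 2 ^+ k.+1 -> r ^+ 2 <= m%:R ->
  A / (eps ^+ 2 * r ^+ 4) <= s ->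
  1 <= large_weight * expR (s * (large_rate k * (r / (2 * Num.sqrt m%:R)) -
         large_rate k ^+ 2 / 4)).
Proof.
rewrite exprS /large_weight /large_rate; pose rho : R := 2 ^+ k.
rewrite -/rho => r_ge r_lt r_m s_ge.
have rho0 : 0 < rho by rewrite exprn_gt0.
have rho2 : 0 < 2 * rho by rewrite mulr_gt0.
clearbody rho.
have r0 : 0 < r by exact: lt_le_trans r_ge.
have A0 := A_gt0.
(* Here [eps ^+ 2 * r ^+ 4] is at most [(2 * rho) ^+ 2 * m], by [eps <= 1], [r < 2 * rho] and
   [r ^+ 2 <= m]. *)
have s_ge' : A / ((2 * rho) ^+ 2 * m%:R) <= s.
  apply: le_trans s_ge; rewrite ler_pM2l// lef_pV2 ?posrE ?mulr_gt0 ?exprn_gt0//.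
  apply: (@le_trans _ _ (r ^+ 4)).
    by rewrite ler_piMl ?exprn_ge0 ?(ltW r0)// exprn_ile1// ltW.
  rewrite (exprD r 2 2); apply: ler_pM; rewrite ?sqr_ge0//.
  by rewrite ler_pXn2r ?nnegrE ?ltW// mulr_gt0.
have q0 := root0; have q2 := root2; set q : R := Num.sqrt m%:R in q0 q2 *.
have rate_ge : 3 / 16 * rho ^+ 2 / m%:R <=
    rho / (2 * q) * (r / (2 * q)) - (rho / (2 * q)) ^+ 2 / 4.
  rewrite -subr_ge0 -q2.
  have -> : rho / (2 * q) * (r / (2 * q)) - (rho / (2 * q)) ^+ 2 / 4 -
     3 / 16 * rho ^+ 2 / q ^+ 2 = rho / (4 * q ^+ 2) * (r - rho).
    by field; rewrite gt_eqF.
  by rewrite mulr_ge0 ?divr_ge0 ?mulr_ge0 ?exprn_ge0 ?subr_ge0 ?(ltW rho0) ?(ltW q0).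
have exp_ge : m%:R ^+ 2 + m%:R ^+ 2 + L <=
    s * (rho / (2 * q) * (r / (2 * q)) - (rho / (2 * q)) ^+ 2 / 4).
  apply: (@le_trans _ _ (A / ((2 * rho) ^+ 2 * m%:R) * (3 / 16 * rho ^+ 2 / m%:R))).
    have -> : A / ((2 * rho) ^+ 2 * m%:R) * (3 / 16 * rho ^+ 2 / m%:R) =
        15 / 4 * (m%:R ^+ 2 + 3 * L) by field; rewrite !gt_eqF.
    by have := sqr_ge0 (m%:R : R); have := L_gt0; lra.
  apply: ler_pM => //.
  - by rewrite divr_ge0 ?(ltW A0)// mulr_ge0 ?exprn_ge0 ?mulr_ge0 ?(ltW m0) ?(ltW rho0).
  - by rewrite divr_ge0 ?mulr_ge0 ?exprn_ge0 ?(ltW m0) ?(ltW rho0).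
apply: (@le_trans _ _ (delta / (4 * m%:R ^+ 3) * (2 * m%:R ^+ 2 * m%:R * (2 / delta)))).
  rewrite le_eqVlt; apply/orP; left; apply/eqP; field; rewrite !gt_eqF//.
rewrite ler_wpM2l ?divr_ge0 ?mulr_ge0 ?exprn_ge0 ?(ltW delta_gt0) ?(ltW m0)//.
apply: (@le_trans _ _ (expR (m%:R ^+ 2 + m%:R ^+ 2 + L))); last by rewrite ler_expR.
rewrite !expRD expL ler_wpM2r ?divr_ge0 ?(ltW delta_gt0)//.
have mm : m%:R <= 2 * m%:R ^+ 2 :> R.
  by rewrite expr2; have := mR; have := m0; nra.
apply: ler_pM; rewrite ?mulr_ge0 ?exprn_ge0 ?(ltW m0) ?expR_ge2M//.
exact: le_trans mm (expR_ge2M _).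
Qed.

(** Each family starts at no more than [delta / 2]. Large scales are kept while [2 ^+ k <= sqrt m]:
    this keeps their rates at most 1/2 and still reaches every [r] with [r ^+ 2 <= m]; [m.+1] is a
    crude bound on their number. *)
Definition failure_potential J s M : R :=
  \sum_(k < J) small_weight k * exp_devs Ts (small_rate k) s M +
  \sum_(k < m.+1 | 2 ^+ k <= Num.sqrt m%:R :> R)
    large_weight * exp_devs Ts (large_rate k) s M.

Let small_weight_ge0 k : 0 <= small_weight k.
Proof. by rewrite !divr_ge0 ?mulr_ge0 ?exprn_ge0 ?(ltW delta_gt0) ?(ltW m0). Qed.

Let large_weight_ge0 : 0 <= large_weight.
Proof. by rewrite !divr_ge0 ?mulr_ge0 ?exprn_ge0 ?(ltW delta_gt0) ?(ltW m0). Qed.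

Let small_rate_ge0 k : 0 <= small_rate k.
Proof. by rewrite !divr_ge0 ?exprn_ge0 ?(ltW eps_gt0) ?(ltW m0). Qed.

Let large_rate_ge0 k : 0 <= large_rate k.
Proof. by rewrite divr_ge0 ?mulr_ge0 ?exprn_ge0 ?(ltW root0). Qed.

Lemma failure_potential_ge0 J s M : 0 <= failure_potential J s M.
Proof.
by rewrite addr_ge0 ?sumr_ge0// => k _; rewrite mulr_ge0 ?exp_devs_ge0.
Qed.

Lemma expect_failure_potential J s M :
  expect (sample_round Ts M) (failure_potential J s.+1) <= failure_potential J s M.
Proof.
rewrite expectD !expect_sum; apply: lerD; apply: ler_sum => k.
  move=> _; rewrite expectZ ler_wpM2l//; apply: expect_exp_devs => // m1.
  rewrite small_rate_ge0 /small_rate ler_pdivrMr//.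
  have : eps / 2 ^+ k <= 1.
    rewrite ler_pdivrMr ?exprn_gt0// mul1r (le_trans eps_le1)// exprn_ege1//.
    by rewrite ler1n.
  have : (2 : R) <= m%:R by rewrite ler_nat.
  lra.
move=> km; rewrite expectZ ler_wpM2l//; apply: expect_exp_devs => // _.
rewrite large_rate_ge0 /large_rate ler_pdivrMr ?mulr_gt0//.
by rewrite mulrA divfK// mul1r.
Qed.

Lemma failure_potential0 J : failure_potential J 0 0 <= delta.
Proof.
have m2 : m%:R ^+ 2 != 0 :> R by rewrite expf_neq0// gt_eqF.
have -> : delta = delta / 2 + delta / 2 by field.
apply: lerD.
  apply: (@le_trans _ _ (\sum_(k < J) delta / 4 * (2 ^+ k)^-1)).
    apply: ler_sum => k _.
    have -> : delta / 4 * (2 ^+ k)^-1 = small_weight k * m%:R ^+ 2.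
      by rewrite /small_weight; field; rewrite gt_eqF// expf_neq0.
    by rewrite ler_wpM2l// exp_devs0.
  rewrite -mulr_sumr; have h := geometric_half_le R J.
  apply: (@le_trans _ _ (delta / 4 * 2)); last by lra.
  by rewrite ler_wpM2l// divr_ge0// ltW.
apply: (@le_trans _ _ (\sum_(k < m.+1) delta / (4 * m%:R))).
  rewrite big_mkcond; apply: ler_sum => k _.
  have h0 : 0 <= delta / (4 * m%:R) by rewrite divr_ge0 ?mulr_ge0 ?(ltW delta_gt0) ?(ltW m0).
  case: ifP => // _.
  have -> : delta / (4 * m%:R) = large_weight * m%:R ^+ 2.
    by rewrite /large_weight; field; rewrite gt_eqF.
  by rewrite ler_wpM2l// exp_devs0.
rewrite sumr_const card_ord -[leLHS]mulr_natl -natr1.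
rewrite mulrA ler_pdivrMr ?mulr_gt0//.
have := mR; have := delta_gt0; nra.
Qed.

(** A single scale does the work: the one whose dyadic interval contains [r]. The condition on [J]
    ensures that this scale is present in the first sum when [r <= 2]. *)
Lemma failure_potential_ge1 J s M :
  2 / Num.min 1 (A / (eps ^+ 2 * s.+1%:R)) < J%:R ->
  count_inv s.+1 M -> ~~ cont s.+1 M -> inaccurate_mx (Ch s.+1 M) ->
  1 <= failure_potential J s.+1 M.
Proof.
move=> J_gt inv; rewrite /continue negb_or -ltNge -leNgt => /andP[r0 s_ge] bad.
set r := sv s.+1 M in r0 s_ge bad *.
have A0 := A_gt0.
set r1 := Num.min 1 _ in J_gt.
have e2 : 0 < eps ^+ 2 by rewrite exprn_gt0.
have r1_gt0 : 0 < r1 by rewrite lt_min ltr01 divr_gt0// mulr_gt0.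
(* The stopping rule bounds [r ^+ 4] from below; for [r < 1] this also bounds [r], as
   [r ^+ 4 <= r]. *)
have r1_le : r1 <= r.
  have [r_ge1|r_lt1] := leP 1 r; first by rewrite ge_min r_ge1.
  rewrite ge_min; apply/orP; right.
  rewrite ler_pdivrMr ?mulr_gt0//.
  move: s_ge; rewrite ler_pdivrMr ?mulr_gt0 ?exprn_gt0// => h.
  apply: le_trans h _.
  have -> : s.+1%:R * (eps ^+ 2 * r ^+ 4) = r ^+ 4 * (eps ^+ 2 * s.+1%:R) by ring.
  rewrite ler_wpM2r ?mulr_ge0 ?(ltW eps_gt0)//.
  by rewrite -[leRHS]expr1 ler_wiXn2l ?(ltW r0) ?(ltW r_lt1).
have sum_ge0 : forall k : nat, 0 <= large_weight * exp_devs Ts (large_rate k) s.+1 M.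
  by move=> k; rewrite mulr_ge0 ?exp_devs_ge0.
have small_ge0 : forall k : nat, 0 <= small_weight k * exp_devs Ts (small_rate k) s.+1 M.
  by move=> k; rewrite mulr_ge0 ?exp_devs_ge0.
case: (inaccurate_mx_dev inv r0 bad) => [[r2 dev]|[r2 rm dev]].
  have [k /andP[k1 k2]] : exists k, 2 ^+ k <= 2 / r < 2 ^+ k.+1.
    by apply: dyadic_bracket; rewrite ler_pdivlMr// mul1r.
  have p2 : 0 < 2 ^+ k :> R by rewrite exprn_gt0.
  have kJ : (k < J)%N.
    rewrite -(ltr_nat R); apply: lt_trans J_gt.
    apply: (@lt_le_trans _ _ (2 ^+ k)); first by rewrite -natrX ltr_nat ltn_expl.
    apply: le_trans k1 _; rewrite ler_pM2l// lef_pV2 ?posrE//.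
  apply: (@le_trans _ _ (small_weight k * exp_devs Ts (small_rate k) s.+1 M)).
    apply: le_trans (@small_scale_weight k _ _ _ _ s_ge) _.
    - rewrite -[ltLHS]mul1r ltr_pdivrMr// mulrC.
      by move: k2; rewrite ltr_pdivrMr// exprS -mulrA -[ltLHS]mulr1 ltr_pM2l.
    - by move: k1; rewrite ler_pdivlMr// => h; rewrite ler_pdivlMr// mulrC.
    - by rewrite ler_wpM2l// exp_devs_ge.
  rewrite /failure_potential (bigD1 (Ordinal kJ))//= -addrA lerDl addr_ge0//.
    by apply: sumr_ge0 => i _; exact: small_ge0.
  by apply: sumr_ge0 => i _; exact: sum_ge0.
have [k /andP[k1 k2]] : exists k, 2 ^+ k <= r < 2 ^+ k.+1.
  by apply: dyadic_bracket; lra.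
have r_root : r <= Num.sqrt m%:R.
  by rewrite -(@ler_pXn2r _ 2)// ?nnegrE ?(ltW r0) ?(ltW root0)// root2.
have km : (k < m.+1)%N.
  rewrite ltnS ltnW// -(ltr_nat R); apply: (@lt_le_trans _ _ (2 ^+ k)).
    by rewrite -natrX ltr_nat ltn_expl.
  apply: le_trans k1 _; apply: le_trans r_root _.
  rewrite -[leRHS]root2 expr2 ler_peMl ?(ltW root0)//.
  by rewrite -(@ler_pXn2r _ 2)// ?nnegrE ?(ltW root0)// expr1n root2.
have kroot : 2 ^+ (Ordinal km) <= Num.sqrt m%:R :> R by exact: le_trans k1 r_root.
apply: (@le_trans _ _ (large_weight * exp_devs Ts (large_rate k) s.+1 M)).
  apply: le_trans (large_scale_weight k1 k2 rm s_ge) _.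
  by rewrite ler_wpM2l// exp_devs_ge.
rewrite /failure_potential addrC (bigD1 (Ordinal km))//= -addrA lerDl addr_ge0//.
  by apply: sumr_ge0 => i _; exact: sum_ge0.
by apply: sumr_ge0 => i _; exact: small_ge0.
Qed.

Lemma repeat_inaccurate_le (Bad : 'M[R]_m -> Prop) K :
  (forall s M, 0 < sv s M -> Bad (Ch s M) -> inaccurate_mx (Ch s M)) ->
  expect (repeatP rnd K (0%N, 0))
    (fun o => if o is Some C then `[<Bad C>]%:R else 0) <= delta.
Proof.
move=> Bad_inaccurate.
pose r1 : R := Num.min 1 (A / (eps ^+ 2 * K.+1%:R)).
(* The lower bound on [r] at a stopping round decreases with the round, so the horizon [K]
   determines a number of scales that serves all rounds. *)
pose J := (Num.truncn (2 / r1)).+1.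
apply: le_trans (failure_potential0 J).
have inv0 : count_inv 0 (0 : 'M[R]_m).
  by split=> [k|k l _]; rewrite mxE// lexx.
apply: (@repeat_prob_le _ _ _ _ Ts_wf Ts_index delta eps _ _ K) => //.
- exact: expect_failure_potential.
- exact: failure_potential_ge0.
move=> s M sK inv stop bad; apply: failure_potential_ge1 => //; last first.
  by apply: Bad_inaccurate bad; move: stop; rewrite negb_or -ltNge => /andP[].
apply: le_lt_trans (truncnS_gt _).
have A0 := A_gt0.
have e2 : 0 < eps ^+ 2 by rewrite exprn_gt0.
have pos k : 0 < A / (eps ^+ 2 * k.+1%:R) by rewrite divr_gt0// mulr_gt0.
rewrite ler_pM2l// lef_pV2 ?posrE ?lt_min ?ltr01 ?pos//.
rewrite /r1 le_min ge_min lexx /= ge_min; apply/orP; right.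
rewrite (ler_pM2l A0) lef_pV2 ?posrE; last 2 first.
- by rewrite mulr_gt0.
- by rewrite mulr_gt0.
by rewrite ler_pM2l// ler_nat ltnW.
Qed.

End FailureProbability.

(** [1280 = 80 * 2 ^ 4] comes from [r >= sigma / 2], and [6 = 3 * 2] from bounding the logarithm by
    its argument. *)
Lemma stop_threshold_ge (R : realType) (delta eps r sigma x : R) :
  0 < delta -> 0 < eps -> 0 < sigma -> sigma / 2 <= r -> 0 < x ->
  80 * x ^+ 2 * (x ^+ 2 + 3 * ln (2 / delta)) / (eps ^+ 2 * r ^+ 4) <=
  1280 * x ^+ 2 * (x ^+ 2 + 6 / delta) / (eps ^+ 2 * sigma ^+ 4).
Proof.
move=> delta_gt0 eps_gt0 sigma_gt0 r_ge x_gt0.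
have half_gt0 : 0 < sigma / 2 by rewrite divr_gt0.
have r_gt0 : 0 < r by exact: lt_le_trans r_ge.
have lnle : ln (2 / delta) <= 2 / delta.
  have := expR_ge1Dx (ln (2 / delta)); rewrite lnK ?posrE ?divr_gt0//; lra.
have -> : 1280 * x ^+ 2 * (x ^+ 2 + 6 / delta) / (eps ^+ 2 * sigma ^+ 4) =
   80 * x ^+ 2 * (x ^+ 2 + 3 * (2 / delta)) / (eps ^+ 2 * (sigma / 2) ^+ 4).
  by field; rewrite !gt_eqF.
have p1 : 0 < eps ^+ 2 * r ^+ 4 by apply: mulr_gt0; apply: exprn_gt0.
have p2 : 0 < eps ^+ 2 * (sigma / 2) ^+ 4 by apply: mulr_gt0; apply: exprn_gt0.
have x2 : 0 <= 80 * x ^+ 2 := mulr_ge0 (ler0n _ 80) (sqr_ge0 x).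
apply: (@le_trans _ _ (80 * x ^+ 2 * (x ^+ 2 + 3 * (2 / delta)) / (eps ^+ 2 * r ^+ 4))).
  apply: ler_wpM2r; first by rewrite invr_ge0 ltW.
  by apply: ler_wpM2l => //; rewrite lerD2l; apply: ler_wpM2l.
apply: ler_wpM2l.
  apply: mulr_ge0 => //; apply: addr_ge0; first exact: sqr_ge0.
  by apply: mulr_ge0 => //; apply: divr_ge0 => //; exact: ltW.
rewrite lef_pV2 ?posrE//; apply: ler_wpM2l; first exact: sqr_ge0.
by rewrite ler_pXn2r// nnegrE ltW.
Qed.

(** * Termination when the correlation matrix is nonsingular *)

Section Termination.
Context (R : realType) (n m : nat) (Ts : 'I_m -> pstruct n).
Hypothesis Ts_wf : forall i, ps_wf (Ts i).
Hypothesis Ts_index : forall i, ps_index (Ts i) = [set: 'I_n]%SET.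
Hypothesis Ts_sorted : forall i j : 'I_m, (i <= j)%N ->
  (#|ps_set (Ts j)| <= #|ps_set (Ts i)|)%N.
Hypothesis m_gt0 : (0 < m)%N.
Variables (delta eps : R).
Hypotheses (delta_gt0 : 0 < delta) (eps_gt0 : 0 < eps).
Implicit Types (M : 'M[R]_m) (s k : nat).
Local Notation sigma := (least_singular_value (corr_mx R Ts)).
Hypothesis sigma_gt0 : 0 < sigma.

Local Notation Ch s M := (Chat (root_row R Ts) s M).
Local Notation sv s M := (least_singular_value (Ch s M)).
Local Notation rnd := (round Ts delta eps (root_row R Ts)).
Local Notation cont s M := (continue m delta eps s (sv s M)).

Let m0 : (0 : R) < m%:R. Proof. by rewrite ltr0n. Qed.

(** It serves both as the tolerated deviation per entry, since [m * dev_rate = sigma / 2], and as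
    the rate in the exponential supermartingale. *)
Definition dev_rate : R := sigma / (2 * m%:R).
(** With rate and deviation equal, the exponent gained per round is [3 / 4 * dev_rate ^+ 2]; the
    decay uses only 1/2 of [dev_rate ^+ 2]. *)
Definition decay : R := expR (- (dev_rate ^+ 2 / 2)).
(* The bound in continue at a singular value sigma / 2, using
   ln (2 / delta) <= 2 / delta. *)
Definition stop_threshold : R :=
  1280 * m%:R ^+ 2 * (m%:R ^+ 2 + 6 / delta) / (eps ^+ 2 * sigma ^+ 4).

Lemma dev_rate_gt0 : 0 < dev_rate.
Proof. by rewrite divr_gt0// mulr_gt0. Qed.

Lemma dev_rate_le : dev_rate <= 1 / 2.
Proof.
have h : sigma ^+ 2 <= m%:R.
  apply: least_singular_value_sqr_le => //; first exact: corr_mx_sym.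
  exact: corr_mx_le1.
have mR : (1 : R) <= m%:R by rewrite ler1n.
have {}h : sigma <= m%:R.
  rewrite -(@ler_pXn2r _ 2)// ?nnegrE ?(ltW sigma_gt0)// (le_trans h)//.
  by rewrite expr2 ler_peMl// ltW.
by rewrite /dev_rate ler_pdivrMr ?mulr_gt0//; lra.
Qed.

Lemma decay_gt0 : 0 < decay. Proof. exact: expR_gt0. Qed.

Lemma decay_lt1 : decay < 1.
Proof. by rewrite expR_lt1 oppr_lt0 divr_gt0// exprn_gt0// dev_rate_gt0. Qed.

Lemma continue_dev s M : count_inv s.+1 M -> stop_threshold <= s.+1%:R ->
  cont s.+1 M -> 1 <= decay ^+ s.+1 * exp_devs Ts dev_rate s.+1 M.
Proof.
move=> inv s_ge c.
have nclose : ~ count_close Ts dev_rate s.+1 M.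
  move=> close.
  have fD : frob (corr_mx R Ts - Ch s.+1 M) <= sigma / 2.
    have -> : sigma / 2 = m%:R * dev_rate by rewrite /dev_rate; field; rewrite gt_eqF.
    apply: frob_le_entries => // i j.
    have -> : corr_mx R Ts - Ch s.+1 M = - (Ch s.+1 M - corr_mx R Ts) by rewrite opprB.
    rewrite mxE normrN; apply: Chat_close => //; exact: ltW dev_rate_gt0.
  have sv_ge : sigma / 2 <= sv s.+1 M.
    have := least_singular_value_lip m_gt0 (corr_mx R Ts) (Ch s.+1 M).
    rewrite -lerBlDr; apply: le_trans; rewrite lerBrDr -lerBrDl.
    by apply: le_trans fD _; rewrite lerBrDl -splitr.
  have sv0 : 0 < sv s.+1 M by apply: lt_le_trans sv_ge; exact: divr_gt0.
  move: c; rewrite /continue leNgt sv0 /= ltNge => /negP; apply.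
  apply: le_trans s_ge.
  exact: stop_threshold_ge.
have V_ge := exp_devs_ge (ltW dev_rate_gt0) nclose.
apply: le_trans (ler_wpM2l (exprn_ge0 s.+1 (ltW decay_gt0)) V_ge).
rewrite /decay -expRM_natl -expRD -[leLHS]expR0 ler_expR.
have -> : s.+1%:R * - (dev_rate ^+ 2 / 2) +
  s.+1%:R * (dev_rate * dev_rate - dev_rate ^+ 2 / 4) =
  s.+1%:R * (dev_rate ^+ 2 / 4) by field.
by rewrite mulr_ge0 ?divr_ge0 ?sqr_ge0.
Qed.

Let super s M :
  expect (sample_round Ts M) (exp_devs Ts dev_rate s.+1) <= exp_devs Ts dev_rate s M.
Proof.
by apply: expect_exp_devs => // _; rewrite (ltW dev_rate_gt0) dev_rate_le.
Qed.

Let inv0 : count_inv 0 (0 : 'M[R]_m).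
Proof. by split=> [k|k l _]; rewrite mxE// lexx. Qed.

Lemma repeat_unfinished_le k : stop_threshold <= k.+1%:R ->
  expect (repeatP rnd k.+1 (0%N, 0)) (fun o => if o is Some _ then 0 else 1) <=
  decay ^+ k.+1 * m%:R ^+ 2.
Proof.
move=> k_ge.
have := @repeat_none_le _ _ _ _ Ts_wf Ts_index delta eps (exp_devs Ts dev_rate)
  decay stop_threshold super (exp_devs_ge0 _ _) decay_gt0 continue_dev k 0 0 inv0.
rewrite add0n => /(_ k_ge) h; apply: le_trans h _.
by rewrite ler_wpM2l ?exprn_ge0 ?(ltW decay_gt0)// exp_devs0.
Qed.

Lemma stop_threshold_ge0 : 0 <= stop_threshold.
Proof.
apply: divr_ge0; last first.
  by apply: mulr_ge0; apply: exprn_ge0; apply: ltW.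
apply: mulr_ge0; first exact: mulr_ge0 (ler0n _ 1280) (sqr_ge0 _).
by apply: addr_ge0; [exact: sqr_ge0|apply: divr_ge0 => //; exact: ltW].
Qed.

(** The last summand is the geometric tail: the ratio is at most [2 / dev_rate ^+ 2 = 8 * m ^ 2 /
    sigma ^ 2], and the initial potential contributes another [m ^ 2]. *)
Lemma repeat_expected_cost_le S k : (forall i, (ps_size (Ts i) <= S)%N) ->
  expected_cost (repeatP rnd k (0%N, 0)) <=
  (sample_cost n m S + (m ^ 2 + m ^ 3).+2)%:R *
  (stop_threshold + 1 + 8 * m%:R ^+ 4 / sigma ^+ 2).
Proof.
move=> leS.
have := @repeat_cost_le _ _ _ _ Ts_wf Ts_index delta eps (exp_devs Ts dev_rate)
  decay stop_threshold super (exp_devs_ge0 _ _) decay_gt0 decay_lt1 continue_dev S k 0 0 leS inv0.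
move=> h; apply: le_trans h _; rewrite ler_wpM2l//.
have thr0 := stop_threshold_ge0.
rewrite /remaining_rounds subr0 max_r// lerD2l expr1.
have d0 := dev_rate_gt0; have g1 := decay_lt1; have g0 := decay_gt0.
have d2 : 0 < dev_rate ^+ 2 / 2 by rewrite divr_gt0// exprn_gt0.
(* With [y = dev_rate ^+ 2 / 2] the left side is [1 / (expR y - 1)]. *)
have ratio : decay / (1 - decay) <= (dev_rate ^+ 2 / 2)^-1.
  rewrite ler_pdivrMr ?subr_gt0// mulrC ler_pdivlMr//.
  have : 1 + dev_rate ^+ 2 / 2 <= decay^-1 by rewrite /decay expRN invrK; exact: expR_ge1Dx.
  rewrite -(ler_pM2l g0) mulfV ?gt_eqF//; lra.
have -> : 8 * m%:R ^+ 4 / sigma ^+ 2 = (dev_rate ^+ 2 / 2)^-1 * m%:R ^+ 2.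
  by rewrite /dev_rate; field; rewrite !gt_eqF.
apply: ler_pM; rewrite ?exp_devs_ge0 ?exp_devs0//.
by rewrite divr_ge0 ?subr_ge0 ?(ltW g0) ?(ltW g1).
Qed.

End Termination.

(** * The estimator *)

Section EstimatorAccuracy.
Context (R : realType) (d : measure_display) (Omega : measurableType d).
Context (P : probability Omega R) (n : nat).
Variable Sigma : 'I_n -> 'I_n -> {RV P >-> R}.
Hypothesis HSigma : symmetric_gaussian Sigma.
Hypothesis n_gt0 : (0 < n)%N.
Context (m : nat) (Ts : 'I_m -> pstruct n).
Hypothesis m_gt0 : (0 < m)%N.
Hypothesis Ts_wf : forall i, ps_wf (Ts i).
Hypothesis Ts_index : forall i, ps_index (Ts i) = [set: 'I_n]%SET.
Local Notation PP := (pairings [set: 'I_n]%SET).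
Local Notation C := (corr_mx R Ts).
Local Notation ind := (indicator_row R Ts).
Local Notation dS := (root_row R Ts).

Let ps_set_PP i : ps_set (Ts i) \subset PP.
Proof. by rewrite -(Ts_index i) ps_set_sub. Qed.

Let big_PP (F : pairing n -> R) : (forall p, p \notin PP -> F p = 0) ->
  \sum_(p in PP) F p = \sum_(p : {set {set 'I_n}}) F p.
Proof.
move=> F0; rewrite big_mkcond; apply: eq_bigr => p _.
by case: ifPn => // /F0 ->.
Qed.

Let ind0 p : p \notin PP -> ind p = 0.
Proof.
move=> pN; apply/rowP => i; rewrite !mxE.
have /negbTE -> : p \notin ps_set (Ts i).
  by apply: contra pN; exact: (fintype.subsetP (ps_set_PP i)).
by rewrite mul0r.
Qed.

Let dotr0 (v : 'rV[R]_m) : dotr v 0 = 0.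
Proof. by rewrite /dotr big1// => i _; rewrite mxE mulr0. Qed.

Let ind_coef i p : (p \in ps_set (Ts i))%:R = root_card R Ts i * ind p 0 i.
Proof. by rewrite mxE mulrCA mulfV ?mulr1 ?root_card_neq0. Qed.

Let sum_ind i : \sum_(p : {set {set 'I_n}}) ind p 0 i = root_card R Ts i.
Proof.
apply: (mulfI (root_card_neq0 R Ts_wf i)); rewrite mulr_sumr.
under eq_bigr do rewrite -ind_coef.
rewrite -expr2 root_card_sqr// -sum1_card natr_sum [RHS]big_mkcond.
by apply: eq_bigr => p _; case: (_ \in _).
Qed.

Let sum_dotr_ind (v : 'rV[R]_m) i :
  \sum_(p : {set {set 'I_n}}) dotr v (ind p) * ind p 0 i = (v *m C) 0 i.
Proof.
rewrite mxE; under [RHS]eq_bigr do rewrite corr_mx_gram// mulr_sumr.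
rewrite exchange_big/=; apply: eq_bigr => p _.
rewrite /dotr mulr_suml; apply: eq_bigr => j _; rewrite !mxE; ring.
Qed.

Lemma X_ps_form i : @X_ps R n (Ts i) = pairing_form (fun p => (p \in ps_set (Ts i))%:R).
Proof. exact: X_set_pairing_form. Qed.

Lemma correlation_mx_corr :
  correlation_mx P (fun i => at_Sigma Sigma (X_ps (Ts i))) = C.
Proof.
have sumE i j : \sum_(p in PP) (p \in ps_set (Ts i))%:R * (p \in ps_set (Ts j))%:R =
    #|(ps_set (Ts i) :&: ps_set (Ts j))%SET|%:R :> R.
  rewrite -sum1_card natr_sum big_mkcond [RHS]big_mkcond; apply: eq_bigr => p _.
  rewrite finset.in_setI; case: (boolP (p \in ps_set (Ts i))) => [pi|_].
    by rewrite (fintype.subsetP (ps_set_PP i) _ pi) mul1r; case: (_ \in _).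
  by rewrite mul0r if_same.
apply/matrixP => i j; rewrite !mxE !X_ps_form correlation_pairing_form// sumE.
rewrite -sqrtrM ?ler0n//; congr (_ / Num.sqrt (_ * _)).
- by under eq_bigr do rewrite expr2; rewrite sumE finset.setIid.
- by under eq_bigr do rewrite expr2; rewrite sumE finset.setIid.
Qed.

Definition weighted_estimator (B : 'M[R]_m) : mxfun R n :=
  let beta : 'cV[R]_m := invmx (diag_mx dS) *m invmx B *m dS^T in
  fun A => \sum_i beta i 0 * X_ps (Ts i) A.

(** The factor [D^-1] in [beta] is absorbed by the normalization of the indicators. *)
Lemma weighted_estimator_form B :
  weighted_estimator B = pairing_form (fun p => dotr (invmx B *m dS^T)^T (ind p)).
Proof.
pose beta : 'cV[R]_m := invmx (diag_mx dS) *m invmx B *m dS^T.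
have unitd : diag_mx dS \in unitmx.
  rewrite unitmxE det_diag unitfE; apply/prodf_neq0 => i _.
  by rewrite mxE root_card_neq0.
have betaE i : root_card R Ts i * beta i 0 = (invmx B *m dS^T) i 0.
  have <- : diag_mx dS *m beta = invmx B *m dS^T by rewrite /beta -mulmxA mulKVmx.
  by rewrite mul_diag_mx !mxE.
apply/funext => A; rewrite /weighted_estimator -/beta.
under eq_bigr do rewrite X_ps_form /pairing_form mulr_sumr.
rewrite exchange_big/=; apply: eq_bigr => p _.
rewrite /dotr mulr_suml; apply: eq_bigr => i _.
rewrite ind_coef [in RHS]mxE -betaE; ring.
Qed.

Lemma weighted_estimator_accurate eps B : 0 < eps -> eps <= 1 ->
  B^T = B -> 0 < least_singular_value B -> ~ inaccurate_mx Ts eps B ->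
  all_accurate Sigma eps (fun f => [set X : mxfun R n |
    [\/ X = cst 1, exists i, X = X_ps (Ts i) | X = f]]) (weighted_estimator B).
Proof.
move=> e0 e1 symB r0; rewrite /inaccurate_mx => /contrapT[r2 leD].
have uB := unitmx_least_singular_value m_gt0 r0.
pose v : 'rV[R]_m := (invmx B *m dS^T)^T.
have vB : v *m B = dS.
  by rewrite /v trmx_mul trmxK trmx_inv symB mulmxKV.
have [acc1 acc2] := perturbed_accuracy m_gt0 (corr_mx_sym R Ts) symB
  (corr_mx_psd Ts) v r0 r2 e0 e1 leD.
pose c p := dotr v (ind p).
have sum_c2 : \sum_(p in PP) c p ^+ 2 = dotr (v *m C) v.
  rewrite dotr_corr_mx//; apply: big_PP => p /ind0 p0.
  by rewrite /c p0 dotr0 expr0n.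
have vD i : (v *m (B - C)) 0 i = root_card R Ts i - (v *m C) 0 i.
  by rewrite mulmxBr vB !mxE.
move=> X; rewrite weighted_estimator_form -/v -/c /= => -[->|[i ->]|->].
- exact: accurate_cst1.
- rewrite X_ps_form; apply: accurate_pairing_form => //.
  have -> : \sum_(p in PP) (p \in ps_set (Ts i))%:R ^+ 2 = root_card R Ts i ^+ 2.
    rewrite root_card_sqr// -sum1_card natr_sum big_mkcond [RHS]big_mkcond.
    apply: eq_bigr => p _; case: (boolP (p \in ps_set (Ts i))) => [pi|_].
      by rewrite (fintype.subsetP (ps_set_PP i) _ pi) expr1n.
    by rewrite expr0n if_same.
  have -> : \sum_(p in PP) (1 - c p) * (p \in ps_set (Ts i))%:R =
      root_card R Ts i * (v *m (B - C)) 0 i.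
    rewrite big_PP => [|p /ind0 p0]; last by rewrite ind_coef p0 mxE !mulr0.
    under eq_bigr do rewrite ind_coef mulrCA mulrBl mul1r.
    by rewrite -mulr_sumr sumrB sum_ind sum_dotr_ind vD.
  rewrite exprMn sum_c2 [leRHS]mulrAC [leLHS]mulrC.
  by rewrite ler_wpM2r ?sqr_ge0//.
- apply: accurate_pairing_form => //.
  have -> : \sum_(p in PP) (1 - c p) * c p = dotr (v *m (B - C)) v.
    under eq_bigr do rewrite mulrBl mul1r -expr2.
    rewrite sumrB sum_c2 big_PP => [|p /ind0 p0]; last by rewrite /c p0 dotr0.
    have -> : \sum_(p : {set {set 'I_n}}) c p = dotr dS v.
      rewrite /c /dotr exchange_big/=; apply: eq_bigr => i _.
      by rewrite -mulr_sumr sum_ind mulrC [in RHS]mxE.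
    by rewrite -vB mulmxBr dotrDl -[- (v *m C)]scaleN1r dotrZl mulN1r.
  by rewrite sum_c2 -mulrA -expr2.
Qed.

End EstimatorAccuracy.

Section EstimatorSemantics.
Context (R : realType) (n m : nat) (Ts : 'I_m -> pstruct n).
Hypothesis Ts_wf : forall i, ps_wf (Ts i).
Hypothesis Ts_index : forall i, ps_index (Ts i) = [set: 'I_n]%SET.
Variables (delta eps : R) (S : nat).
Hypothesis le_S : forall i, (ps_size (Ts i) <= S)%N.
Local Notation rnd := (round Ts delta eps (root_row R Ts)).
Local Notation numP := (Defs.mapP (@NumPairings R n) [seq Ts i | i <- enum 'I_m]).
Implicit Types k : nat.

Let runs_within_numP :
  runs_within numP (m * S ^ 3) (eq [seq num_pairings (Ts i) | i <- enum 'I_m]).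
Proof.
rewrite -[X in (X * _)%N](size_enum_ord m); apply: runs_within_mapP => i.
by apply: runs_within_le (runs_within_NumPairings R (Ts i)) _ _ => //; rewrite leq_exp2r.
Qed.

Let root_rowE :
  \row_(i < m) Num.sqrt (nth 0%N [seq num_pairings (Ts j) | j <- enum 'I_m] i)%:R =
  root_row R Ts.
Proof.
apply/rowP => i; rewrite !mxE (nth_map i) ?size_enum_ord//.
by rewrite nth_ord_enum /root_card card_ps_set.
Qed.

Let EstimatorE k : Estimator Ts delta eps k =
  bind numP (fun N => let dS := \row_i Num.sqrt (nth 0%N N i)%:R in
    Tick (m + m ^ 2) (bind (repeatP (round Ts delta eps dS) k (0%N, 0))
     (fun o => if o is Some C then Tick (m ^ 3 + m ^ 2)
        (Ret (Some (fun A =>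
          \sum_i (invmx (diag_mx dS) *m invmx C *m dS^T) i 0 * X_ps (Ts i) A)))
      else Ret None))).
Proof. by []. Qed.

Lemma expect_Estimator k g :
  expect (Estimator Ts delta eps k) g =
  expect (repeatP rnd k (0%N, 0)) (fun o => g (omap (weighted_estimator Ts) o)).
Proof.
rewrite EstimatorE expect_bind (expect_within_eq _ runs_within_numP) /= root_rowE expect_bind.
by congr expect; apply/funext => -[].
Qed.

(** The size of this bound, which grows with [k], is irrelevant: it certifies the coin biases, as
    [le_expect] requires. *)
Lemma runs_within_repeat k st : runs_within (repeatP rnd k st)
  (k * (sample_cost n m S + (m ^ 2 + m ^ 3).+2)) (fun=> True).
Proof.
elim: k st => [//|k IHk] st; rewrite mulSn /=.
apply: (@runs_within_bind _ _ _ _ _ _ _ (fun=> True)) => [|[//|C]] //.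
apply: (@runs_within_bind _ _ _ _ _ _ _ (fun=> True)) => //=.
by apply: runs_within_le (runs_within_sample_round Ts_wf Ts_index _ le_S) _ _.
Qed.

Lemma expected_cost_Estimator k :
  expected_cost (Estimator Ts delta eps k) <=
  (m * S ^ 3)%:R + (m + m ^ 2)%:R + expected_cost (repeatP rnd k (0%N, 0)) +
  (m ^ 3 + m ^ 2)%:R.
Proof.
rewrite EstimatorE expected_cost_bind (expect_within_eq _ runs_within_numP) /= root_rowE.
rewrite expected_cost_bind -!addrA lerD ?(expected_cost_le runs_within_numP)//.
rewrite !lerD2l -[leRHS](expect_cst (repeatP rnd k (0%N, 0))).
apply: le_expect (runs_within_repeat k _) _ => -[C|] _ /=; last exact: ler0n.
by rewrite addr0.
Qed.

End EstimatorSemantics.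

(** * The probability bounds for the estimator *)

Section EstimatorClauses.
Context (R : realType) (d : measure_display) (Omega : measurableType d).
Context (P : probability Omega R) (n : nat).
Variable Sigma : 'I_n -> 'I_n -> {RV P >-> R}.
Hypothesis HSigma : symmetric_gaussian Sigma.
Hypothesis n_gt0 : (0 < n)%N.
Context (m : nat) (Ts : 'I_m -> pstruct n).
Hypothesis m_gt0 : (0 < m)%N.
Hypothesis Ts_wf : forall i, ps_wf (Ts i).
Hypothesis Ts_index : forall i, ps_index (Ts i) = [set: 'I_n]%SET.
Hypothesis Ts_sorted : forall i j : 'I_m, (i <= j)%N ->
  (#|ps_set (Ts j)| <= #|ps_set (Ts i)|)%N.
Variables (delta eps : R).
Hypotheses (delta_gt0 : 0 < delta) (eps_gt0 : 0 < eps) (eps_le1 : eps <= 1).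
Implicit Types k : nat.
Local Notation alg := (Estimator Ts delta eps).
Local Notation rnd := (round Ts delta eps (root_row R Ts)).
Local Notation good := (all_accurate Sigma eps (fun f => [set X : mxfun R n |
    [\/ X = cst 1, exists i, X = X_ps (Ts i) | X = f]])).
Local Notation sigma := (least_singular_value (corr_mx R Ts)).

Let le_max_size i : (ps_size (Ts i) <= \max_j ps_size (Ts j))%N.
Proof. exact: leq_bigmax. Qed.

Let runs_within_rep k :=
  runs_within_repeat Ts_wf Ts_index delta eps le_max_size k (0%N, 0).

Let indicator_output (E : set (mxfun R n)) (o : option 'M[R]_m) :
  \1_[set o : option (mxfun R n) | exists2 a, o = Some a & E a]
    (omap (weighted_estimator Ts) o) =
  (if o is Some C then `[<E (weighted_estimator Ts C)>]%:R else 0) :> R.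
Proof.
rewrite indicE; case: o => [C|] /=; last first.
  by rewrite memNset// => -[].
congr (nat_of_bool _)%:R; apply/idP/asboolP; rewrite in_setE /=.
  by move=> [a [->]].
by move=> EC; exists (weighted_estimator Ts C).
Qed.

Let prob_output E k :
  prob (alg k) [set o | exists2 a, o = Some a & E a] =
  expect (repeatP rnd k (0%N, 0))
    (fun o => if o is Some C then `[<E (weighted_estimator Ts C)>]%:R else 0).
Proof.
rewrite /prob (expect_Estimator Ts_wf delta eps le_max_size).
by congr expect; apply/funext => o; exact: indicator_output.
Qed.

Let inaccurate_prob_le k :
  prob (alg k) [set o | exists2 a, o = Some a & (~` good) a] <= delta.
Proof.
(* For [delta >= 1] the bound is trivial; below 1 the logarithm in the stopping rule is positive. *)
rewrite prob_output; have [delta_ge1|delta_lt1] := leP 1 delta.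
  apply: le_trans delta_ge1; rewrite -[leRHS](expect_cst (repeatP rnd k (0%N, 0))).
  apply: le_expect (runs_within_rep k) _ => -[C|] _ //.
  by rewrite lern1 leq_b1.
apply: (@repeat_inaccurate_le _ _ _ _ Ts_wf Ts_index Ts_sorted m_gt0 delta eps) => //.
move=> s M sv_gt0 bad; apply: contrapT => nbad; apply: bad.
by apply: weighted_estimator_accurate => //; exact: Chat_sym.
Qed.

Lemma output_inaccurate_le : (output_prob alg (~` good) <= delta%:E)%E.
Proof. by apply: ge_ereal_sup => _ [k _ <-]; rewrite lee_fin. Qed.

(** After [k] rounds a run is accurate, inaccurate or unfinished. The second event has probability
    at most [delta] for every [k], and the third tends to 0 when [sigma > 0], so the loss beyond
    [delta] is arbitrarily small. *)
Lemma Estimator_multiaccurate : 0 < sigma ->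
  multiaccurate Sigma delta eps (fun f => [set X : mxfun R n |
    [\/ X = cst 1, exists i, X = X_ps (Ts i) | X = f]]) alg.
Proof.
move=> sigma_gt0; apply/lee_addgt0Pr => e e_gt0.
pose thr := stop_threshold Ts delta eps.
have [k [k_ge unfinished]] :
    exists k, thr <= k.+1%:R /\ (decay R Ts) ^+ k.+1 * m%:R ^+ 2 <= e.
  have cv : (decay R Ts ^+ k * m%:R ^+ 2) @[k --> \oo] --> (0 : R).
    rewrite -[X in _ --> X](mul0r (m%:R ^+ 2)); apply: cvgMl.
    by apply: cvg_expr; rewrite ger0_norm ?decay_lt1// ltW// decay_gt0.
  move/cvgrPdist_le/(_ e e_gt0): cv => [N _ hN].
  exists (maxn N (Num.truncn thr)); split.
    by apply/ltW/(lt_le_trans (truncnS_gt thr)); rewrite ler_nat ltnS leq_maxr.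
  have /hN : (N <= (maxn N (Num.truncn thr)).+1)%N by rewrite leqW// leq_maxl.
  rewrite /= sub0r normrN; exact: le_trans (ler_norm _).
have total : prob (alg k.+1) [set o | exists2 a, o = Some a & good a] +
    prob (alg k.+1) [set o | exists2 a, o = Some a & (~` good) a] +
    expect (repeatP rnd k.+1 (0%N, 0)) (fun o => if o is Some _ then 0 else 1) = 1.
  rewrite !prob_output -!expectD -[RHS](expect_cst (repeatP rnd k.+1 (0%N, 0))).
  congr expect; apply/funext => -[C|]; rewrite ?add0r ?addr0//.
  by rewrite asbool_neg; case: asboolP; rewrite /= ?addr0 ?add0r.
apply: (@le_trans _ _
  ((prob (alg k.+1) [set o | exists2 a, o = Some a & good a])%:E + e%:E)%E).
  rewrite lee_fin.
  have := inaccurate_prob_le k.+1.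
  have := repeat_unfinished_le Ts_wf Ts_index Ts_sorted m_gt0 delta_gt0 eps_gt0
    sigma_gt0 k_ge.
  by move: total => /[swap] h1 /[swap] h2; lra.
by rewrite leeD2r//; apply: ereal_sup_ubound; exists k.+1.
Qed.

End EstimatorClauses.

(** * Polynomial bound on the expected runtime *)

Section Runtime.
Implicit Type A : comNzRingType.

(** The variables stand for [1 / delta], [1 / eps], [1 / sigma] and the total size. Over an
    arbitrary commutative ring, one term provides both the formal polynomial and its value, related
    by a ring morphism. *)
Definition rounds_poly A (x y z w : A) : A :=
  1280%:R * w ^+ 2 * (w ^+ 2 + 6%:R * x) * (y ^+ 2 * z ^+ 4) + 1 +
  8%:R * w ^+ 4 * z ^+ 2.

Definition sample_poly A (w : A) : A :=
  w * (1 + w * (4%:R * w ^+ 4 + (w * (w * (2%:R * (2%:R * w) + 3%:R) +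
    2%:R * w * (2%:R * w) + 1) + 1))).

Definition runtime_poly A (x y z w : A) : A :=
  w * w ^+ 3 + (w + w ^+ 2) +
  (sample_poly w + (w ^+ 2 + w ^+ 3 + 2%:R)) * rounds_poly x y z w +
  (w ^+ 3 + w ^+ 2).

Lemma rmorph_runtime_poly (A B : comNzRingType) (f : {rmorphism A -> B}) x y z w :
  f (runtime_poly x y z w) = runtime_poly (f x) (f y) (f z) (f w).
Proof.
by rewrite /runtime_poly /rounds_poly /sample_poly
  !(rmorphD, rmorphM, rmorphXn, rmorph1, rmorph_nat).
Qed.

Context (R : realType) (n : nat).

(** Bounds [n] by twice a representation size, so that [n] does not appear as a further variable of
    the runtime polynomial. *)
Lemma card_ps_index_le (t : pstruct n) : (#|ps_index t| <= 2 * ps_size t)%N.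
Proof.
elim: t => /= [i j|t1 IH1 t2 IH2|t1 IH1 t2 IH2].
- by rewrite cards2; case: (_ != _).
- by apply: leq_trans IH1 _; rewrite leq_mul2l leqW// leq_addr.
- apply: leq_trans (leq_card_setU _ _) _; apply: leq_trans (leq_add IH1 IH2) _.
  by rewrite -mulnDr leq_mul2l leqW.
Qed.

Context (m : nat) (Ts : 'I_m -> pstruct n).
Hypothesis m_gt0 : (0 < m)%N.
Hypothesis Ts_wf : forall i, ps_wf (Ts i).
Hypothesis Ts_index : forall i, ps_index (Ts i) = [set: 'I_n]%SET.
Hypothesis Ts_sorted : forall i j : 'I_m, (i <= j)%N ->
  (#|ps_set (Ts j)| <= #|ps_set (Ts i)|)%N.
Variables (delta eps : R).
Hypotheses (delta_gt0 : 0 < delta) (eps_gt0 : 0 < eps).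
Local Notation sigma := (least_singular_value (corr_mx R Ts)).
Hypothesis sigma_gt0 : 0 < sigma.
Local Notation S := (\sum_(i < m) ps_size (Ts i))%N.
Local Notation w := (S%:R : R).

Let size_le i : (ps_size (Ts i) <= S)%N.
Proof. by rewrite (bigD1 i)//= leq_addr. Qed.

Let m_le : (m <= S)%N.
Proof.
rewrite -[X in (X <= _)%N]card_ord -sum1_card leq_sum// => i _.
exact: ps_size_gt0.
Qed.

Let n_le : (n <= 2 * S)%N.
Proof.
have := card_ps_index_le (Ts (Ordinal m_gt0)).
rewrite Ts_index cardsT card_ord => /leq_trans; apply.
by rewrite leq_mul2l size_le.
Qed.

Let w_ge : m%:R <= w. Proof. by rewrite ler_nat. Qed.

Let rounds_le : stop_threshold Ts delta eps + 1 + 8 * m%:R ^+ 4 / sigma ^+ 2 <=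
  rounds_poly delta^-1 eps^-1 sigma^-1 w.
Proof.
have pw j : m%:R ^+ j <= w ^+ j by apply: lerXn2r; rewrite // nnegrE ler0n.
rewrite /rounds_poly !exprVn lerD//.
  rewrite lerD2r /stop_threshold invfM ler_wpM2r//.
    by rewrite mulr_ge0// invr_ge0 exprn_ge0// ltW.
  apply: ler_pM.
  - exact: mulr_ge0 (ler0n _ _) (sqr_ge0 _).
  - by rewrite addr_ge0 ?sqr_ge0// divr_ge0// ltW.
  - exact: ler_wpM2l (ler0n _ _) _ _ (pw 2).
  - by rewrite lerD2r.
rewrite ler_wpM2r ?invr_ge0 ?sqr_ge0//.
exact: ler_wpM2l (ler0n _ _) _ _ (pw 4).
Qed.

Lemma expected_cost_le_poly k :
  expected_cost (Estimator Ts delta eps k) <=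
  runtime_poly delta^-1 eps^-1 sigma^-1 w.
Proof.
apply: le_trans (expected_cost_Estimator Ts_wf Ts_index delta eps size_le k) _.
rewrite /runtime_poly.
have mS j : (m ^ j <= S ^ j)%N by case: j => // j; rewrite leq_exp2r.
apply: lerD; last by rewrite -!natrX -natrD ler_nat leq_add.
apply: lerD.
  by rewrite -!natrX -natrM -!natrD ler_nat !leq_add// leq_mul.
apply: le_trans (repeat_expected_cost_le Ts_wf Ts_index Ts_sorted m_gt0
  delta_gt0 eps_gt0 sigma_gt0 k size_le) _.
apply: ler_pM => //; first by rewrite !addr_ge0 ?stop_threshold_ge0//
    mulr_ge0 ?(mulr_ge0 (ler0n _ _))// ?exprn_ge0// invr_ge0 sqr_ge0.
(* [sample_poly] is the cost of a round with [n] replaced by [2 * S] and [m] by [S]. *)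
have -> : sample_poly w = (sample_cost (2 * S) S S)%:R.
  by rewrite /sample_cost /sample_poly !(natrD, natrM, natrX).
rewrite -!natrX -!natrD ler_nat -addn2 !leq_add//.
rewrite /sample_cost !(leq_mul, leq_add)//.
Qed.

Lemma expected_runtime_le :
  (expected_runtime (Estimator Ts delta eps) <=
    (runtime_poly delta^-1 eps^-1 sigma^-1 w)%:E)%E.
Proof.
by apply: ge_ereal_sup => _ [k _ <-]; rewrite lee_fin expected_cost_le_poly.
Qed.

End Runtime.

Theorem theorem4p15 (R : realType) :
  exists Q : mpoly.mpoly 4 R,
  forall (n : nat) (n_gt0 : (0 < n)%N) (n_even : ~~ odd n)
    (d : measure_display) (Omega : measurableType d) (P : probability Omega R)
    (Sigma : 'I_n -> 'I_n -> {RV P >-> R}) (HSigma : symmetric_gaussian Sigma)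
    (m : nat) (m_gt0 : (0 < m)%N) (Ts : 'I_m -> pstruct n)
    (Ts_wf : forall i, ps_wf (Ts i))
    (Ts_index : forall i, ps_index (Ts i) = [set: 'I_n]%SET)
    (Ts_sorted : forall i j : 'I_m, (i <= j)%N ->
       (#|ps_set (Ts j)| <= #|ps_set (Ts i)|)%N)
    (delta eps : R) (delta_gt0 : 0 < delta) (eps_gt0 : 0 < eps),
  let alg := Estimator Ts delta eps in
  let preds := fun f : mxfun R n =>
    [set X : mxfun R n | [\/ X = cst 1, exists i, X = X_ps (Ts i) | X = f]] in
  let sigma := least_singular_value
    (correlation_mx P (fun i => at_Sigma Sigma (X_ps (Ts i)))) in
  (* For sigma = 0 the algorithm need not stop; the second clause then says that
     it outputs an inaccurate f with probability at most delta. *)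
  [/\ eps <= 1 -> 0 < sigma -> multiaccurate Sigma delta eps preds alg,
      eps <= 1 ->
        (output_prob alg (~` all_accurate Sigma eps preds) <= delta%:E)%E
    & 0 < sigma ->
        (expected_runtime alg <=
          (mpoly.meval
             (tnth [tuple delta^-1; eps^-1; sigma^-1;
                          (\sum_(i < m) ps_size (Ts i))%:R])
             Q)%:E)%E].
Proof.
pose X i := mpoly.mpolyX R (mpoly.mnm1 (inord i : 'I_4)).
exists (runtime_poly (X 0%N) (X 1%N) (X 2%N) (X 3%N)).
move=> n n_gt0 n_even d Omega P Sigma HSigma m m_gt0 Ts Ts_wf Ts_index Ts_sorted
  delta eps delta_gt0 eps_gt0 alg preds sigma.
have sigmaE : sigma = least_singular_value (corr_mx R Ts).
  by rewrite /sigma (correlation_mx_corr HSigma).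
split.
- by rewrite sigmaE => eps_le1 sigma_gt0; exact: Estimator_multiaccurate.
- by move=> eps_le1; exact: output_inaccurate_le.
- rewrite sigmaE => sigma_gt0.
  rewrite rmorph_runtime_poly /= /X !mpoly.mevalXU !(tnth_nth 0) !inordK//=.
  exact: expected_runtime_le.
Qed.
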